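(* Let $\Lambda\in P^+$, let $\beta=\alpha_{i_1}+\cdots+\alpha_{i_n}\in Q_n^+$ with $i_1,\dots,i_n\in I$ pairwise distinct, and fix $\gamma=(\gamma_1,\dots,\gamma_n)\in I^\beta$. Order $\{i_1,\dots,i_n\}=\{\gamma_1,\dots,\gamma_n\}$ by $\gamma_1<\gamma_2<\cdots<\gamma_n$. For $\nu\in I^\beta$ and $1\le t\le n$, let $k_{\nu,t}=\max\{1\le p<t\mid\nu_p<\nu_t\}$, or $k_{\nu,t}=0$ if $\{1\le p<t\mid\nu_p<\nu_t\}=\emptyset$. Set $$T_\gamma^\Lambda=\Bigl\{x^{\underline a}e(\nu)\ \Bigm|\ \nu\in I^\beta,\ \underline a\in\mathbb{N}^n,\ a_t<-\sum_{l=\max\{k_{\nu,t},1\}}^{t-1}a_{\nu_t,\nu_l}+\delta_{k_{\nu,t},0}\langle\alpha_{\nu_t}^\vee,\Lambda\rangle\ \text{ for all }1\le t\le n\Bigr\}.$$ Then the canonical image of $T_\gamma^\Lambda$ in $\mathscr{R}_\beta^\Lambda/[\mathscr{R}_\beta^\Lambda,\mathscr{R}_\beta^\Lambda]$ is a $\mathbf{k}$-basis of $\mathscr{R}_\beta^\Lambda/[\mathscr{R}_\beta^\Lambda,\mathscr{R}_\beta^\Lambda]$.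
   Context: **Cartan datum.** $I$ is an index set and $A=(a_{ij})_{i,j\in I}$ is a symmetrizable generalized Cartan matrix (integral; $a_{ii}=2$; $a_{ij}\le 0$ for $i\ne j$; $a_{ij}=0\Leftrightarrow a_{ji}=0$; there are $d_i\in\mathbb{Z}_{>0}$ with $(d_ia_{ij})$ symmetric). In the claim, $a_{\nu_t,\nu_l}$ are Cartan matrix entries and $\underline a=(a_1,\dots,a_n)$ is an exponent vector, $x^{\underline a}=x_1^{a_1}\cdots x_n^{a_n}$. $P$ is a free abelian group of finite rank, $P^\vee=\mathrm{Hom}(P,\mathbb{Z})$ with natural pairing $\langle\cdot,\cdot\rangle:P^\vee\times P\to\mathbb{Z}$; there are linearly independent simple roots $\alpha_i\in P$, simple coroots $\alpha_i^\vee\in P^\vee$ with $\langle\alpha_i^\vee,\alpha_j\rangle=a_{ij}$, and fundamental weights $\Lambda_i\in P$ with $\langle\alpha_j^\vee,\Lambda_i\rangle=\delta_{ij}$. $P^+=\{\lambda\in P:\langle\alpha_i^\vee,\lambda\rangle\ge0\ \forall i\}$, $Q_n^+=\{\sum_i k_i\alpha_i:k_i\in\mathbb{Z}_{\ge0},\sum_i k_i=n\}$ ($n\ge1$ here). Put $(\alpha_i,\alpha_j)=d_ia_{ij}$. $\mathfrak{S}_n$ acts on $I^n$ by $w.\nu=(\nu_{w^{-1}(1)},\dots,\nu_{w^{-1}(n)})$; $I^\beta=\{\nu\in I^n:\sum_k\alpha_{\nu_k}=\beta\}$; $s_k=(k,k+1)$. $\mathbb{N}$ contains $0$. **KLR algebra.**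 $\mathbf{k}$ is a field. Fix $Q_{i,j}\in\mathbf{k}[u,v]$ with $Q_{i,i}=0$, $Q_{i,j}(u,v)=Q_{j,i}(v,u)$, and for $i\ne j$, $Q_{i,j}(u,v)=\sum_{p,q\ge0}c_{i,j,p,q}u^pv^q$ where $c_{i,j,p,q}=0$ unless $(\alpha_i,\alpha_i)p+(\alpha_j,\alpha_j)q=-2(\alpha_i,\alpha_j)$, and $c_{i,j,-a_{ij},0}\ne0$. $\mathscr{R}_\beta$ is the associative $\mathbf{k}$-algebra generated by $e(\nu)$ ($\nu\in I^\beta$), $x_1,\dots,x_n$, $\tau_1,\dots,\tau_{n-1}$ with relations: $e(\nu)e(\nu')=\delta_{\nu\nu'}e(\nu)$, $\sum_\nu e(\nu)=1$, $x_kx_l=x_lx_k$, $x_ke(\nu)=e(\nu)x_k$, $\tau_le(\nu)=e(s_l.\nu)\tau_l$, $\tau_k\tau_l=\tau_l\tau_k$ if $|k-l|>1$, $\tau_k^2e(\nu)=Q_{\nu_k,\nu_{k+1}}(x_k,x_{k+1})e(\nu)$; $(\tau_kx_l-x_{s_k(l)}\tau_k)e(\nu)=-e(\nu)$ if $l=k,\nu_k=\nu_{k+1}$, $=e(\nu)$ if $l=k+1,\nu_k=\nu_{k+1}$, and $=0$ otherwise; $(\tau_{k+1}\tau_k\tau_{k+1}-\tau_k\tau_{k+1}\tau_k)e(\nu)=\frac{Q_{\nu_k,\nu_{k+1}}(x_k,x_{k+1})-Q_{\nu_{k+2},\nu_{k+1}}(x_{k+2},x_{k+1})}{x_k-x_{k+2}}e(\nu)$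 if $\nu_k=\nu_{k+2}$, and $=0$ otherwise. **Cyclotomic quotient.** For $\Lambda\in P^+$, $\mathscr{R}_\beta^\Lambda=\mathscr{R}_\beta/I_{\Lambda,\beta}$, where $I_{\Lambda,\beta}$ is the two-sided ideal generated by $\sum_{\nu\in I^\beta}x_1^{\langle\alpha_{\nu_1}^\vee,\Lambda\rangle}e(\nu)$. $[B,B]$ denotes the $\mathbf{k}$-span of commutators in $B$. *)

(* Defs.v *)
From HB Require Import structures.
From mathcomp Require Import all_boot all_order all_algebra.
From mathcomp Require Import perm generic_quotient ring_quotient.
From mathcomp Require Import finmap boolp monalg.

Set Implicit Arguments.
Unset Strict Implicit.
Unset Printing Implicit Defensive.

Import GRing.Theory.
Local Open Scope ring_scope.
Local Open Scope quotient_scope.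

(* A k-algebra is a ring with a central ring morphism from k.  The library's
   lalgType and algType cannot be used: they exclude the zero ring, while a
   cyclotomic quotient may vanish (e.g. for Lambda = 0). *)
Record kalg (k : pzRingType) := KAlg {
  kalg_ring : pzRingType;
  kalg_in : {rmorphism k -> kalg_ring};
  kalg_central : forall c x, kalg_in c * x = x * kalg_in c
}.
Definition kalg_sort (k : pzRingType) (A : kalg k) : Type := kalg_ring A.
Coercion kalg_sort : kalg >-> Sortclass.

Section KAlgTheory.
Variables (k : pzRingType) (A : kalg k).

HB.instance Definition _ := GRing.PzRing.on (kalg_sort A).

Definition kalg_scale (c : k) (x : A) : A := (kalg_in A c : A) * x.

Lemma kalg_scaleA a b x : kalg_scale a (kalg_scale b x) = kalg_scale (a * b) x.
Proof. by rewrite /kalg_scale mulrA rmorphM. Qed.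

Lemma kalg_scale1 : left_id 1 kalg_scale.
Proof. by move=> x; rewrite /kalg_scale rmorph1 mul1r. Qed.

Lemma kalg_scaleDr : right_distributive kalg_scale +%R.
Proof. by move=> c x y; rewrite /kalg_scale mulrDr. Qed.

Lemma kalg_scaleDl x : {morph kalg_scale^~ x : a b / a + b}.
Proof. by move=> a b; rewrite /kalg_scale rmorphD mulrDl. Qed.

HB.instance Definition _ := GRing.Zmodule_isLmodule.Build k (kalg_sort A)
  kalg_scaleA kalg_scale1 kalg_scaleDr kalg_scaleDl.

Lemma kalg_scalerAl (c : k) (x y : A) : c *: (x * y) = (c *: x) * y.
Proof. exact: mulrA. Qed.

Lemma kalg_scalerAr (c : k) (x y : A) : c *: (x * y) = x * (c *: y).
Proof.
by rewrite /GRing.scale /= /kalg_scale !mulrA; congr (_ * _); apply: kalg_central.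
Qed.

End KAlgTheory.

Inductive span (k : pzRingType) (V : lmodType k) (S : V -> Prop) : V -> Prop :=
| span0 : span S 0
| span_cons c x y of S x & span S y : span S (c *: x + y).

Section LinearQuotient.
Variables (k : pzRingType) (V : lmodType k) (S : V -> Prop).

Lemma span_gen x : S x -> span S x.
Proof.
move=> Sx; rewrite -[x]addr0 -[x]scale1r; apply: span_cons => //.
exact: span0.
Qed.

Lemma spanD x y : span S x -> span S y -> span S (x + y).
Proof.
elim=> [|c u v Su _ IH] sy; first by rewrite add0r.
by rewrite -addrA; apply: span_cons => //; apply: IH.
Qed.

Lemma spanZ c x : span S x -> span S (c *: x).
Proof.
elim=> [|d u v Su _ IH]; first by rewrite scaler0; apply: span0.
by rewrite scalerDr scalerA; apply: span_cons.
Qed.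

Definition in_span : {pred V} := fun v => `[< span S v >].

Lemma in_spanP v : reflect (span S v) (v \in in_span).
Proof. exact: asboolP. Qed.

Lemma in_span_zmod_closed : zmod_closed in_span.
Proof.
split=> [|x y /in_spanP sx /in_spanP sy]; apply/in_spanP; first exact: span0.
by apply: spanD => //; rewrite -scaleN1r; apply: spanZ.
Qed.
HB.instance Definition _ :=
  GRing.isZmodClosed.Build V in_span in_span_zmod_closed.

Definition lquot : Type := Quotient.quot in_span.
HB.instance Definition _ := GRing.Zmodule.on lquot.

Definition lproj : V -> lquot := \pi_(Quotient.quot in_span).

Lemma lproj_eq x y : (lproj x = lproj y) <-> span S (x - y).
Proof.
split=> [/eqP|/in_spanP]; rewrite /lproj.
  by rewrite -Quotient.idealrBE => /in_spanP.
by rewrite Quotient.idealrBE => /eqP.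
Qed.

Lemma lprojK x : lproj (repr x) = x.
Proof. exact: reprK. Qed.

Lemma lproj_zmod : zmod_morphism lproj.
Proof. exact: pi_is_zmod_morphism. Qed.
HB.instance Definition _ := GRing.isZmodMorphism.Build V lquot lproj lproj_zmod.

Definition lquot_scale (c : k) (x : lquot) : lquot := lproj (c *: repr x).

Lemma lquot_scaleE c x : lquot_scale c (lproj x) = lproj (c *: x).
Proof.
apply/lproj_eq; rewrite -scalerBr; apply: spanZ.
by apply/lproj_eq; rewrite lprojK.
Qed.

Lemma lquot_scaleA a b x :
  lquot_scale a (lquot_scale b x) = lquot_scale (a * b) x.
Proof. by rewrite -[x]lprojK !lquot_scaleE scalerA. Qed.

Lemma lquot_scale1 : left_id 1 lquot_scale.
Proof. by move=> x; rewrite -[x]lprojK lquot_scaleE scale1r. Qed.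

Lemma lquot_scaleDr : right_distributive lquot_scale +%R.
Proof.
move=> c x y; rewrite -[x]lprojK -[y]lprojK -raddfD !lquot_scaleE.
by rewrite scalerDr raddfD.
Qed.

Lemma lquot_scaleDl x : {morph lquot_scale^~ x : a b / a + b}.
Proof.
by move=> a b; rewrite -[x]lprojK !lquot_scaleE scalerDl raddfD.
Qed.

HB.instance Definition _ := GRing.Zmodule_isLmodule.Build k lquot
  lquot_scaleA lquot_scale1 lquot_scaleDr lquot_scaleDl.

Lemma lproj_scalable : scalable lproj.
Proof. by move=> c x; rewrite -lquot_scaleE. Qed.
HB.instance Definition _ :=
  GRing.isScalable.Build k V lquot *:%R lproj lproj_scalable.

End LinearQuotient.

Section AlgebraQuotient.
Variables (k : pzRingType) (A : kalg k) (S : A -> Prop).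

(* The two-sided ideal generated by S is the linear span of the a * s * b. *)
Definition sandwich (y : A) : Prop := exists a s b, S s /\ y = a * s * b.
Definition ideal_gen : A -> Prop := span sandwich.

Lemma ideal_genMl a x : ideal_gen x -> ideal_gen (a * x).
Proof.
elim=> [|c _ v [b [s [d [Ss ->]]]] _ IH]; first by rewrite mulr0; apply: span0.
rewrite mulrDr -kalg_scalerAr; apply: span_cons => //.
by exists (a * b), s, d; rewrite !mulrA.
Qed.

Lemma ideal_genMr a x : ideal_gen x -> ideal_gen (x * a).
Proof.
elim=> [|c _ v [b [s [d [Ss ->]]]] _ IH]; first by rewrite mul0r; apply: span0.
rewrite mulrDl -kalg_scalerAl; apply: span_cons => //.
by exists b, s, (d * a); rewrite !mulrA.
Qed.

Definition aquot : Type := lquot sandwich.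
HB.instance Definition _ := GRing.Zmodule.on aquot.

Definition aquot_pi : A -> aquot := @lproj k A sandwich.
Definition aquot_repr (x : aquot) : A :=
  repr (x : Quotient.quot (in_span sandwich)).
HB.instance Definition _ := GRing.Additive.on aquot_pi.

Lemma aquot_pi_eq x y : (aquot_pi x = aquot_pi y) <-> ideal_gen (x - y).
Proof. exact: lproj_eq. Qed.

Lemma aquot_reprK x : aquot_pi (aquot_repr x) = x.
Proof. exact: lprojK. Qed.

Definition aquot_one : aquot := aquot_pi 1.
Definition aquot_mul (x y : aquot) : aquot :=
  aquot_pi (aquot_repr x * aquot_repr y).

Lemma aquot_mulE x y : aquot_mul (aquot_pi x) (aquot_pi y) = aquot_pi (x * y).
Proof.
apply/aquot_pi_eq; set x' := aquot_repr _; set y' := aquot_repr _.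
have -> : x' * y' - x * y = x' * (y' - y) + (x' - x) * y.
  by rewrite mulrBr mulrBl addrA addrNK.
apply: spanD; [apply: ideal_genMl | apply: ideal_genMr];
  by apply/aquot_pi_eq; rewrite aquot_reprK.
Qed.

Lemma aquot_mulA : associative aquot_mul.
Proof.
move=> x y z; rewrite -[x]aquot_reprK -[y]aquot_reprK -[z]aquot_reprK.
by rewrite !aquot_mulE mulrA.
Qed.

Lemma aquot_mul1 : left_id aquot_one aquot_mul.
Proof. by move=> x; rewrite -[x]aquot_reprK aquot_mulE mul1r. Qed.

Lemma aquot_mulr1 : right_id aquot_one aquot_mul.
Proof. by move=> x; rewrite -[x]aquot_reprK aquot_mulE mulr1. Qed.

Lemma aquot_mulDl : left_distributive aquot_mul +%R.
Proof.
move=> x y z; rewrite -[x]aquot_reprK -[y]aquot_reprK -[z]aquot_reprK.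
by rewrite -raddfD !aquot_mulE mulrDl raddfD.
Qed.

Lemma aquot_mulDr : right_distributive aquot_mul +%R.
Proof.
move=> x y z; rewrite -[x]aquot_reprK -[y]aquot_reprK -[z]aquot_reprK.
by rewrite -raddfD !aquot_mulE mulrDr raddfD.
Qed.

HB.instance Definition _ := GRing.Zmodule_isPzRing.Build aquot
  aquot_mulA aquot_mul1 aquot_mulr1 aquot_mulDl aquot_mulDr.

Lemma aquot_pi_monoid : monoid_morphism aquot_pi.
Proof. by split=> // x y; rewrite -aquot_mulE. Qed.
HB.instance Definition _ :=
  GRing.isMonoidMorphism.Build A aquot aquot_pi aquot_pi_monoid.

Definition aquot_in : {rmorphism k -> aquot} :=
  GRing.RMorphism.clone _ _
    ((aquot_pi : kalg_ring A -> aquot) \o kalg_in A) _.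

Lemma aquot_central c x : aquot_in c * x = x * aquot_in c.
Proof.
rewrite -[x]aquot_reprK /= -!rmorphM; congr aquot_pi; exact: kalg_central.
Qed.

(* The quotient of A by the two-sided ideal generated by S. *)
Definition quot_alg : kalg k := KAlg aquot_central.

Definition aproj : A -> quot_alg := aquot_pi.

Lemma aproj_eq x y : (aproj x = aproj y) <-> ideal_gen (x - y).
Proof. exact: lproj_eq. Qed.

Lemma aproj_surj (x : quot_alg) : exists y, x = aproj y.
Proof. by exists (aquot_repr x); rewrite /aproj aquot_reprK. Qed.

Lemma aproj_zmod : zmod_morphism aproj.
Proof. exact: raddfB. Qed.
HB.instance Definition _ := GRing.isZmodMorphism.Build A quot_alg aproj aproj_zmod.
HB.instance Definition _ :=
  GRing.isMonoidMorphism.Build A quot_alg aproj aquot_pi_monoid.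
Lemma aproj_scalable : scalable aproj.
Proof. by move=> c x; apply: (rmorphM aproj). Qed.
HB.instance Definition _ :=
  GRing.isScalable.Build k A quot_alg *:%R aproj aproj_scalable.

End AlgebraQuotient.

Section Cocenter.
Variables (k : pzRingType) (B : kalg k).

Definition commutator (z : B) : Prop := exists x y : B, z = x * y - y * x.

(* B / [B, B] *)
Definition cocenter : Type := lquot commutator.
HB.instance Definition _ := GRing.Lmodule.on cocenter.

Definition to_cocenter : B -> cocenter := @lproj k B commutator.
HB.instance Definition _ := GRing.Linear.on to_cocenter.

End Cocenter.

(* The image of T under f is a basis of W, as a family indexed by T: distinct
   elements of T are required to have distinct images. *)
Definition image_is_basis (k : pzRingType) (V W : lmodType k) (f : V -> W)
    (T : V -> Prop) : Prop :=
  (forall (s : seq V) (c : V -> k), uniq s -> (forall v, v \in s -> T v) ->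
     \sum_(v <- s) c v *: f v = 0 -> forall v, v \in s -> c v = 0)
  /\ (forall w : W, exists (s : seq V) (c : V -> k),
     (forall v, v \in s -> T v) /\ w = \sum_(v <- s) c v *: f v).

Section FreeAlgebra.
Variables (k : comNzRingType) (G : choiceType).

Lemma free_alg_central (c : k) (x : {malg k[{fmonom G}]}) :
  c%:A * x = x * c%:A.
Proof.
rewrite -scalerAl mul1r -{1}[x]mulr1; apply/malgP => m.
rewrite mcoeffZ mcoeffMl.
rewrite (mcoeffMlw _ (fsubset_refl _) (msuppZ_le c _)) mulr_sumr.
apply: eq_bigr => i _; rewrite mulr_sumr; apply: eq_bigr => j _.
by rewrite mcoeffZ mulrnAr mulrCA.
Qed.

(* k<G>: polynomials in the noncommuting variables G. *)
Definition free_alg : kalg k :=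
  @KAlg k {malg k[{fmonom G}]} (in_alg {malg k[{fmonom G}]}) free_alg_central.

Definition fvar (g : G) : free_alg := << fmu g >>.

End FreeAlgebra.

(* The index set is a finType: the simple roots are linearly independent in a
   lattice of finite rank, so I is necessarily finite. *)
Record cartan_datum (I : finType) := CartanDatum {
  cartan : I -> I -> int;
  cartan_diag : forall i, cartan i i = 2;
  cartan_le0 : forall i j, i != j -> cartan i j <= 0;
  cartan_eq0 : forall i j, cartan i j = 0 <-> cartan j i = 0;
  symd : I -> nat;
  symd_gt0 : forall i, (0 < symd i)%N;
  symd_sym : forall i j, (symd i)%:Z * cartan i j = (symd j)%:Z * cartan j i;
  wlat : zmodType;
  wlat_free : exists (r : nat) (b : 'I_r -> wlat), forall x : wlat,
    exists! c : {ffun 'I_r -> int}, x = \sum_j b j *~ c j;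
  sroot : I -> wlat;
  sroot_indep : forall c : I -> int,
    \sum_i sroot i *~ c i = 0 -> forall i, c i = 0;
  coroot : I -> {additive wlat -> int};
  corootE : forall i j, coroot i (sroot j) = cartan i j;
  fundw : I -> wlat;
  fundwE : forall i j, coroot j (fundw i) = (j == i)%:R
}.

Section Datum.
Variables (I : finType) (D : cartan_datum I).

Definition dominant (L : wlat D) : Prop := forall i, 0 <= coroot D i L.

(* (alpha_i, alpha_j) *)
Definition rform (i j : I) : int := (symd D i)%:Z * cartan D i j.

(* I^beta, for words of length n *)
Definition Iseq (n : nat) (beta : wlat D) : Type :=
  {nu : {ffun 'I_n -> I} | \sum_k sroot D (nu k) == beta}.
HB.instance Definition _ n beta := Finite.on (Iseq n beta).

Definition letter n beta (nu : Iseq n beta) (p : 'I_n) : I := val nu p.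
Coercion letter : Iseq >-> Funclass.

(* The polynomials Q_{i,j}(u, v): the inner variable is u and the outer one is
   v, so the coefficient of u^p v^q is (Q i j)`_q`_p. *)
Record klr_poly (k : fieldType) := KlrPoly {
  qpoly : I -> I -> {poly {poly k}};
  qpoly_diag : forall i, qpoly i i = 0;
  qpoly_sym : forall i j, qpoly i j = swapXY (qpoly j i);
  qpoly_supp : forall i j (p q : nat), i != j ->
    rform i i * p%:Z + rform j j * q%:Z != - 2 * rform i j ->
    (qpoly i j)`_q`_p = 0;
  qpoly_lead : forall i j, i != j -> (qpoly i j)`_0`_`|cartan D i j|%N != 0
}.

End Datum.

Section PolyEval.
Variables (k : fieldType) (A : kalg k) (P : {poly {poly k}}).

Definition qeval (u v : A) : A :=
  \sum_(q < size P) \sum_(p < size P`_q) P`_q`_p *: (u ^+ p * v ^+ q).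

(* (P(u, v) - P(w, v)) / (u - w), expanded term by term; see qdiffP. *)
Definition qdiff (u v w : A) : A :=
  \sum_(q < size P) \sum_(p < size P`_q)
    P`_q`_p *: ((\sum_(r < p) u ^+ (p.-1 - r) * w ^+ r) * v ^+ q).

Lemma qdiffP u v w : GRing.comm u w ->
  (u - w) * qdiff u v w = qeval u v - qeval w v.
Proof.
move=> cuw; rewrite mulr_sumr -sumrB; apply: eq_bigr => q _.
rewrite mulr_sumr -sumrB; apply: eq_bigr => p _.
rewrite -kalg_scalerAr mulrA -scalerBr -mulrBl.
by rewrite (subrXX_comm p cuw).
Qed.

End PolyEval.

Section Strands.
Variable n : nat.

(* For 0-based k < n - 1, tau k crosses the strands lo k = k, hi k = k + 1. *)
Fact hi_subproof (k : 'I_n.-1) : (k.+1 < n)%N.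
Proof. by case: n k => [|m] []. Qed.
Definition lo (k : 'I_n.-1) : 'I_n := widen_ord (leq_pred n) k.
Definition hi (k : 'I_n.-1) : 'I_n := Ordinal (hi_subproof k).
Definition sperm (k : 'I_n.-1) : 'S_n := tperm (lo k) (hi k).

End Strands.

Section KLR.
Variables (I : finType) (D : cartan_datum I) (k : fieldType).
Variables (Q : klr_poly D k) (n : nat) (beta : wlat D).
Implicit Types (nu : Iseq n beta).

Fact sact_subproof (m : 'I_n.-1) nu :
  \sum_j sroot D ([ffun j => nu (sperm m j)] j) == beta.
Proof.
apply/eqP; apply: etrans (eqP (valP nu)).
rewrite (reindex_inj (@perm_inj _ (sperm m))) /=.
by apply: eq_bigr => j _; rewrite ffunE /letter tpermK.
Qed.
Definition sact (m : 'I_n.-1) nu : Iseq n beta :=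
  exist _ [ffun j => nu (sperm m j)] (sact_subproof m nu).

Inductive klr_gen :=
| Idem of Iseq n beta
| Dot of 'I_n
| Cross of 'I_n.-1.

Definition klr_gen_encode g : Iseq n beta + 'I_n + 'I_n.-1 :=
  match g with
  | Idem nu => inl (inl nu) | Dot l => inl (inr l) | Cross m => inr m
  end.
Definition klr_gen_decode (s : Iseq n beta + 'I_n + 'I_n.-1) : klr_gen :=
  match s with
  | inl (inl nu) => Idem nu | inl (inr l) => Dot l | inr m => Cross m
  end.
Lemma klr_gen_encodeK : cancel klr_gen_encode klr_gen_decode.
Proof. by case. Qed.
HB.instance Definition _ := Choice.copy klr_gen (can_type klr_gen_encodeK).

Local Notation F := (free_alg k klr_gen).
Local Notation e nu := (fvar k (Idem nu) : F).
Local Notation x l := (fvar k (Dot l) : F).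
Local Notation tau m := (fvar k (Cross m) : F).
Local Notation QQ := (qpoly Q).

(* klr_rel a b is the defining relation a = b. *)
Inductive klr_rel : F -> F -> Prop :=
| rel_ee nu nu' : klr_rel (e nu * e nu') (if nu == nu' then e nu else 0)
| rel_e1 : klr_rel (\sum_nu e nu) 1
| rel_xx l l' : klr_rel (x l * x l') (x l' * x l)
| rel_xe l nu : klr_rel (x l * e nu) (e nu * x l)
| rel_te m nu : klr_rel (tau m * e nu) (e (sact m nu) * tau m)
| rel_tt (m m' : 'I_n.-1) of (m.+1 < m')%N || (m'.+1 < m)%N :
    klr_rel (tau m * tau m') (tau m' * tau m)
| rel_t2 m nu :
    klr_rel (tau m ^+ 2 * e nu)
            (qeval (QQ (nu (lo m)) (nu (hi m))) (x (lo m)) (x (hi m)) * e nu)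
| rel_tx m l nu :
    klr_rel ((tau m * x l - x (sperm m l) * tau m) * e nu)
            (if nu (lo m) != nu (hi m) then 0
             else if l == lo m then - e nu
             else if l == hi m then e nu
             else 0)
| rel_braid (m m' : 'I_n.-1) nu of m' = m.+1 :> nat :
    klr_rel ((tau m' * tau m * tau m' - tau m * tau m' * tau m) * e nu)
            (if nu (lo m) == nu (hi m') then
               qdiff (QQ (nu (lo m)) (nu (hi m)))
                     (x (lo m)) (x (hi m)) (x (hi m')) * e nu
             else 0).

Definition klr : kalg k :=
  quot_alg (fun z : F => exists a b, klr_rel a b /\ z = a - b).

Definition klr_pi : F -> klr := @aproj k F _.

Lemma klr_pi_rel a b : klr_rel a b -> klr_pi a = klr_pi b.
Proof.
move=> rab; apply/aproj_eq/span_gen.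
by exists 1, (a - b), 1; rewrite mul1r mulr1; split=> //; exists a, b.
Qed.

Definition klr_e nu : klr := klr_pi (e nu).
Definition klr_x l : klr := klr_pi (x l).
Definition klr_tau m : klr := klr_pi (tau m).

Definition cyc_gen (hn : (0 < n)%N) (L : wlat D) : klr :=
  \sum_(nu : Iseq n beta)
    klr_x (Ordinal hn) ^+ `|coroot D (nu (Ordinal hn)) L|%N * klr_e nu.

Definition cyclotomic (hn : (0 < n)%N) (L : wlat D) : kalg k :=
  quot_alg (fun z : klr => z = cyc_gen hn L).

Definition cyc_pi (hn : (0 < n)%N) (L : wlat D) : klr -> cyclotomic hn L :=
  @aproj k klr _.

Section Basis.
Variables (L : wlat D) (gamma : Iseq n beta).

(* i < j when i occurs before j in the word gamma. *)
Definition gamma_lt (i j : I) : bool :=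
  [exists p : 'I_n, exists q : 'I_n, [&& (p < q)%N, gamma p == i & gamma q == j]].

(* The 1-based position k_{nu,t} (0 when there is none); t is 0-based. *)
Definition kpos nu (t : 'I_n) : nat :=
  \max_(p < n | (p < t)%N && gamma_lt (nu p) (nu t)) p.+1.

(* The summation index l is 0-based, the bound maxn (kpos nu t) 1 is 1-based. *)
Definition exp_bound nu (t : 'I_n) : int :=
  - (\sum_(l < n | (maxn (kpos nu t) 1 <= l.+1)%N && (l < t)%N)
       cartan D (nu t) (nu l))
  + (if kpos nu t == 0%N then coroot D (nu t) L else 0).

Definition Tset (z : klr) : Prop :=
  exists (nu : Iseq n beta) (a : 'I_n -> nat),
    (forall t, (a t)%:Z < exp_bound nu t) /\
    z = (\prod_(t < n) klr_x t ^+ a t) * klr_e nu.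

End Basis.

End KLR.

(* Main.v *)
From HB Require Import structures.
Require Import Defs.
From mathcomp Require Import all_boot all_order all_algebra.
From mathcomp Require Import perm finmap boolp monalg zify ring.

Set Implicit Arguments.
Unset Strict Implicit.
Unset Printing Implicit Defensive.

Import GRing.Theory.
Local Open Scope ring_scope.

(** The letters of beta are distinct, so the words in I^beta are the orderings
    of n letters, numbered by their position in gamma. A dot then slides
    along its strand through every crossing without error term, and for
    each letter j the sum y_j over all words of the dot on the strand
    labelled j is central (y_central). Over the polynomial ring S in the
    y_j the algebra is spanned by the elements tau_w e(nu), one w for each
    permutation. As tau_w e(nu) = e(w.nu) tau_w with w.nu different from nu
    unless w = 1, these are commutators for w <> 1, and the cocenter is
    generated over S by the classes of the e(nu) (tracial_span).

    The relations among these classes are Q_ab(y_a, y_b) (e(nu) - e(nu')) = 0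
    when nu' comes from nu by exchanging two neighbours a, b, because both
    terms are traces of tau_m^2, and y_a^d e(nu) = 0 when nu begins with a
    and d is the corresponding exponent of Lambda. A linear map from the
    S-module M with this presentation to a vector space X is a family of
    X-valued arrays, indexed by words and exponents, that satisfies the
    transposed relations; it is called functional below. The heart of the
    proof is functional_determined: such a family is determined by its
    values at the exponents within the bounds of the theorem, and these
    values can be prescribed freely. This says that the monomials of the
    theorem form a basis of M.

    It is proved by induction on the number of letters, splitting every word u
    x w at its least letter x. Exchanging x with the letters of u and then
    applying the relation for the first letter gives the polynomial B(u) =
    P_x prod_(l in u) Q_xl, monic in x of the degree allowed for x, which
    kills the word u x w. The part u carries a problem of the same kind. So
    does the part w, with the polynomials Q_xb as first-letter relations,
    up to words in which x stands further to the right: Q_xb [u x b w'] =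
    Q_xb [u b x w']. Hence uniqueness follows by induction on the length of
    w. For existence one writes the value at u x w as a sum over all ways
    of moving a subword of w to the end of u (unshuffle), which turns
    solutions of the decoupled problem in u and w into functionals, and
    adjusts the summands by decreasing length of u.

    Spanning follows by applying uniqueness to the map from the cocenter to its
    quotient by the span of the monomials (trace_eq0). For independence, M
    must be shown to be no larger than the cocenter, that is, every
    functional has to come from a trace. The polynomial representation on
    the functions from words to S provides it: the trace of z is the sum
    over the words nu of the functional applied to the diagonal entry of z
    at nu. It vanishes on commutators because an entry of z between two
    words is divisible by Q_ab for pairs a < b that it inverts
    (rho_divisible), so that the relation exchanging neighbours applies. *)

(** * Linear maps on polynomials as arrays *)

Section LinearExtension.
Variables (K : choiceType) (k : nzRingType) (X : lmodType k).

Definition lext (h : K -> X) (g : {malg k[K]}) : X :=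
  \sum_(m <- msupp g) g@_m *: h m.

Variable h : K -> X.

Lemma lextEw (d : {fset K}) g : (msupp g `<=` d)%fset ->
  lext h g = \sum_(m <- d) g@_m *: h m.
Proof.
move=> le; rewrite /lext (big_fset_incl _ le) // => m _ mNg.
by rewrite mcoeff_outdom // scale0r.
Qed.

Lemma lext_is_zmod : zmod_morphism (lext h).
Proof.
move=> f g; have le1 := fsubsetUl (msupp f) (msupp g).
have le2 := fsubsetUr (msupp f) (msupp g).
rewrite (lextEw le1) (lextEw le2) (lextEw (msuppB_le f g)) -sumrB.
by apply: eq_bigr => m _; rewrite mcoeffB scalerBl.
Qed.
HB.instance Definition _ :=
  GRing.isZmodMorphism.Build {malg k[K]} X (lext h) lext_is_zmod.

Lemma lext_is_scalable : scalable (lext h).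
Proof.
move=> c g; rewrite (lextEw (msuppZ_le c g)) /lext scaler_sumr.
by apply: eq_bigr => m _; rewrite mcoeffZ scalerA.
Qed.
HB.instance Definition _ :=
  GRing.isScalable.Build k {malg k[K]} X *:%R (lext h) lext_is_scalable.

Lemma lextZU c m : lext h << c *g m >> = c *: h m.
Proof. by rewrite (lextEw msuppU_le) big_seq_fset1 mcoeffUU. Qed.

Lemma lextU m : lext h << m >> = h m.
Proof. by rewrite lextZU scale1r. Qed.

Lemma lextZ c g : lext h (c *: g) = c *: lext h g.
Proof. exact: lext_is_scalable. Qed.

Lemma malg_ind (P : {malg k[K]} -> Prop) :
    P 0 -> (forall c m g, P g -> P (c *: << m >> + g)) -> forall g, P g.
Proof.
move=> P0 PD g; rewrite [g]monalgE; elim: (enum_fset _) => [|m r IH].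
  by rewrite big_nil.
rewrite big_cons; have -> : << g@_m *g m >> = g@_m *: << m >> :> {malg k[K]}.
  by apply/malgP => j; rewrite mcoeffZ !mcoeffU mulr_natr.
exact: PD.
Qed.

End LinearExtension.

Section Arrays.
Variables (n : nat) (k : fieldType).

Notation S := {malg k[{cmonom 'I_n}]}.
Implicit Types (s t : S) (a : 'I_n -> nat) (i : 'I_n).

Definition var i : S := << ucm i >>.

Definition shift_exp a (m : {cmonom 'I_n}) : 'I_n -> nat := fun i => (a i + m i)%N.
Definition set_exp i v a : 'I_n -> nat := fun j => if j == i then v else a j.

Lemma shift_exp1 a : shift_exp a mone = a.
Proof. by apply: funext => i; rewrite /shift_exp cm1 addn0. Qed.

Lemma shift_expM a m m' : shift_exp a (mmul m m') = shift_exp (shift_exp a m) m'.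
Proof. by apply: funext => i; rewrite /shift_exp cmM addnA. Qed.

Section Act.
Variable X : lmodType k.

(** An exponent vector stands for a monomial, so an array is a linear map from
    the polynomial ring to X; the ring acts on arrays by transposed
    multiplication. *)
Definition arr : Type := ('I_n -> nat) -> X.
HB.instance Definition _ := gen_eqMixin arr.
HB.instance Definition _ := gen_choiceMixin arr.

Implicit Types (f g : arr).
Definition arr_add f g : arr := fun a => f a + g a.
Definition arr_opp f : arr := fun a => - f a.
Definition arr_zero : arr := fun _ => 0.

Fact arr_addA : associative arr_add.
Proof. by move=> f g h; apply: funext => a; apply: addrA. Qed.
Fact arr_addC : commutative arr_add.
Proof. by move=> f g; apply: funext => a; apply: addrC. Qed.
Fact arr_add0 : left_id arr_zero arr_add.
Proof. by move=> f; apply: funext => a; apply: add0r. Qed.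
Fact arr_addN : left_inverse arr_zero arr_opp arr_add.
Proof. by move=> f; apply: funext => a; apply: addNr. Qed.
HB.instance Definition _ :=
  GRing.isZmodule.Build arr arr_addA arr_addC arr_add0 arr_addN.

Definition arr_act s f : arr := fun a => lext (fun m => f (shift_exp a m)) s.

Fact arr_act1 : left_id 1 arr_act.
Proof.
by move=> f; apply: funext => a; rewrite /arr_act lextU shift_exp1.
Qed.

Fact arr_actDr : right_distributive arr_act +%R.
Proof.
move=> s f g; apply: funext => a; rewrite /arr_act /lext /=.
by rewrite /GRing.add /= /arr_add -big_split; apply: eq_bigr => m _; rewrite scalerDr.
Qed.

Fact arr_actDl f : {morph arr_act^~ f : s t / s + t}.
Proof. by move=> s t; apply: funext => a; rewrite /arr_act raddfD. Qed.

Fact arr_actA s t f : arr_act s (arr_act t f) = arr_act (s * t) f.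
Proof.
apply: funext => a; rewrite /arr_act malgME raddf_sum /=.
apply: eq_bigr => m _; rewrite {1}/lext scaler_sumr raddf_sum /=.
apply: eq_bigr => m' _.
by rewrite lextZU scalerA shift_expM.
Qed.

HB.instance Definition _ := GRing.Zmodule_isLmodule.Build S arr
  arr_actA arr_act1 arr_actDr arr_actDl.

Lemma arrDE f g a : (f + g) a = f a + g a. Proof. by []. Qed.
Lemma arrBE f g a : (f - g) a = f a - g a. Proof. by []. Qed.
Lemma arr0E a : (0 : arr) a = 0. Proof. by []. Qed.
Lemma arrZE s f a : (s *: f) a = lext (fun m => f (shift_exp a m)) s.
Proof. by []. Qed.
Lemma arr_sumE (I : Type) (r : seq I) (P : pred I) (F : I -> arr) a :
  (\sum_(i <- r | P i) F i) a = \sum_(i <- r | P i) F i a.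
Proof. by elim/big_rec2: _ => // i x f _ <-. Qed.
Lemma arr_scaleC s t f : s *: (t *: f) = t *: (s *: f).
Proof. by rewrite !scalerA mulrC. Qed.
Lemma arrCE (c : k) f a : (c%:A *: f) a = c *: f a.
Proof.
by rewrite arrZE lextZ lextU shift_exp1.
Qed.
Lemma arrCVK (c : k) f : c != 0 -> c%:A *: (c^-1%:A *: f) = f.
Proof.
by move=> c0; apply: funext => a; rewrite !arrCE scalerA mulfV // scale1r.
Qed.
Lemma arrC_eq0 (c : k) f : c != 0 -> c%:A *: f = 0 -> f = 0.
Proof.
move=> c0 cf0; apply: funext => a.
have /eqP := congr1 (fun h : arr => h a) cf0.
by rewrite arrCE scaler_eq0 (negbTE c0) => /eqP.
Qed.
Lemma arr_varE i f a : (var i *: f) a = f (set_exp i (a i).+1 a).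
Proof.
rewrite arrZE lextU; congr f; apply: funext => j.
rewrite /shift_exp /set_exp cmU eq_sym.
by case: eqP => [->|_]; rewrite ?addn1 ?addn0.
Qed.
Lemma arr_varXE i d f a : (var i ^+ d *: f) a = f (set_exp i (a i + d)%N a).
Proof.
elim: d f a => [|d IH] f a.
  rewrite scale1r addn0; congr f; apply: funext => j.
  by rewrite /set_exp; case: eqP => [->|].
rewrite exprS -scalerA arr_varE IH; congr f; apply: funext => j.
by rewrite /set_exp eqxx; case: eqP; rewrite ?addSnnS.
Qed.

(** Constant in the direction i: slices are kept in the same type, so that
    polynomials without the variable i act on them. *)
Definition slice i v f : arr := fun a => f (set_exp i v a).

(** With the exponents in W frozen, an array becomes one in the other
    variables. In this way a family that depends on two disjoint sets of
    letters is treated as a family over one of them. *)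
Definition fiber (W : seq 'I_n) a f : arr :=
  fun b => f (fun i => if i \in W then a i else b i).

Lemma sliceE i v f : slice i v f = fiber [:: i] (fun=> v) f.
Proof.
apply: funext => a; congr f; apply: funext => j.
by rewrite /set_exp inE.
Qed.

Lemma set_exp_twice i v w a : set_exp i v (set_exp i w a) = set_exp i v a.
Proof. by apply: funext => j; rewrite /set_exp; case: eqP. Qed.

Lemma set_exp_id i a : set_exp i (a i) a = a.
Proof. by apply: funext => j; rewrite /set_exp; case: eqP => [->|]. Qed.

Lemma slice_varX i v d f : slice i v (var i ^+ d *: f) = slice i (v + d)%N f.
Proof.
apply: funext => a; rewrite /slice arr_varXE set_exp_twice.
by rewrite /set_exp eqxx.
Qed.

Lemma slice_inj i f g : (forall v, slice i v f = slice i v g) -> f = g.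
Proof.
move=> e; apply: funext => a.
by have /(congr1 (fun h : arr => h a)) := e (a i); rewrite /slice set_exp_id.
Qed.

Lemma sliceB i v f g : slice i v (f - g) = slice i v f - slice i v g.
Proof. by []. Qed.

Lemma sliceD i v f g : slice i v (f + g) = slice i v f + slice i v g.
Proof. by []. Qed.

Lemma slice_sum i v (I : Type) (r : seq I) (F : I -> arr) :
  slice i v (\sum_(j <- r) F j) = \sum_(j <- r) slice i v (F j).
Proof. by elim: r => [|j r IH]; rewrite !(big_nil, big_cons) ?sliceD ?IH. Qed.

End Act.

Definition free_of i s : Prop := forall m, m \in msupp s -> m i = 0%N.

Lemma free0 i : free_of i 0.
Proof. by move=> m; rewrite msupp0. Qed.

Lemma free1 i : free_of i 1.
Proof. by move=> m /(fsubsetP msuppU_le); rewrite inE => /eqP ->; apply: cm1. Qed.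

Lemma freeD i s t : free_of i s -> free_of i t -> free_of i (s + t).
Proof.
by move=> fs ft m /(fsubsetP (msuppD_le _ _)); rewrite in_fsetU => /orP[/fs|/ft].
Qed.

Lemma freeZ i c s : free_of i s -> free_of i (c *: s).
Proof. by move=> fs m /(fsubsetP (msuppZ_le _ _)) /fs. Qed.

Lemma freeM i s t : free_of i s -> free_of i t -> free_of i (s * t).
Proof.
move=> fs ft m /msuppM_le [m1 [m2 [/fs e1 /ft e2 ->]]].
by rewrite cmM e1 e2.
Qed.

Lemma free_sum i (I : Type) (r : seq I) (P : pred I) (F : I -> S) :
  (forall j, P j -> free_of i (F j)) -> free_of i (\sum_(j <- r | P j) F j).
Proof.
move=> fF; elim/big_rec: _ => [|j s Pj]; first exact: free0.
by apply: freeD; apply: fF.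
Qed.

Lemma free_prod i (I : eqType) (r : seq I) (F : I -> S) :
  (forall j, j \in r -> free_of i (F j)) -> free_of i (\prod_(j <- r) F j).
Proof.
move=> fF; rewrite big_seq; elim/big_rec: _ => [|j s Pj]; first exact: free1.
by apply: freeM; apply: fF.
Qed.

Lemma freeX i s d : free_of i s -> free_of i (s ^+ d).
Proof.
move=> fs; elim: d => [|d IH]; first exact: free1.
by rewrite exprS; apply: freeM.
Qed.

Lemma free_var i j : i != j -> free_of i (var j).
Proof.
by move=> ij m /(fsubsetP msuppU_le); rewrite inE => /eqP ->; rewrite cmU eq_sym (negbTE ij).
Qed.

Section FreeAct.
Variable X : lmodType k.
Implicit Types (f g : arr X).

Lemma free_fiber W a s f :
  (forall i, i \in W -> free_of i s) -> fiber W a (s *: f) = s *: fiber W a f.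
Proof.
move=> fs; apply: funext => b; rewrite /fiber !arrZE /lext big_seq_cond.
rewrite [RHS]big_seq_cond; apply: eq_bigr => m; rewrite andbT => ms.
congr (_ *: f _); apply: funext => j; rewrite /shift_exp.
by case: ifP => // jW; rewrite (fs _ jW _ ms) addn0.
Qed.

Lemma free_slice i v s f : free_of i s -> slice i v (s *: f) = s *: slice i v f.
Proof.
by move=> fs; rewrite !sliceE free_fiber // => j; rewrite inE => /eqP ->.
Qed.

(** Without the variables of W a polynomial only shifts exponents outside W,
    hence it reads f on one fibre only. *)
Lemma free_local (W : seq 'I_n) s f g a :
  (forall i, i \in W -> free_of i s) ->
  (forall b, (forall i, i \in W -> b i = a i) -> f b = g b) ->
  (s *: f) a = (s *: g) a.
Proof.
move=> fs fg; rewrite !arrZE /lext big_seq_cond [RHS]big_seq_cond.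
apply: eq_bigr => m; rewrite andbT => ms; rewrite fg // => i iW.
by rewrite /shift_exp (fs _ iW _ ms) addn0.
Qed.

End FreeAct.

End Arrays.

(** * Polynomials that are monic in one variable *)

Section Monic.
Variables (n : nat) (k : fieldType).
Notation S := {malg k[{cmonom 'I_n}]}.

(** Monic only up to the factor c, since the leading coefficients of the
    crossing polynomials are merely non-zero. *)
Definition monic_in (x : 'I_n) (d : nat) (s : S) : Prop :=
  exists (b : {poly S}) (c : k),
    [/\ c != 0, b \is monic, size b = d.+1, forall j, free_of x b`_j
      & s = c *: b.[var k x]].

Lemma monic_in1 x : monic_in x 0 1.
Proof.
exists 1, 1; split=> //; rewrite ?oner_eq0 ?monic1 ?size_poly1 //.
  by move=> j; rewrite coef1; case: (j == 0%N); [apply: free1 | apply: free0].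
by rewrite hornerC scale1r.
Qed.

Lemma monic_inM x d e s t :
  monic_in x d s -> monic_in x e t -> monic_in x (d + e) (s * t).
Proof.
move=> [b [c [c0 mb sb fb ->]]] [b' [c' [c0' mb' sb' fb' ->]]].
exists (b * b'), (c * c'); split; first by rewrite mulf_neq0.
- by rewrite monicMl.
- rewrite size_Mmonic ?sb ?sb' ?addnS //.
  by rewrite -size_poly_eq0 sb.
- move=> j; rewrite coefM; apply: free_sum => i _.
  exact: freeM (fb _) (fb' _).
- by rewrite hornerM -scalerAl -scalerAr scalerA.
Qed.

Lemma monic_in_varX x d : monic_in x d (var k x ^+ d).
Proof.
exists 'X^d, 1; split; rewrite ?oner_eq0 ?monicXn ?size_polyXn //.
  by move=> j; rewrite coefXn; case: (j == d); [apply: free1 | apply: free0].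
by rewrite hornerXn scale1r.
Qed.

Lemma monic_in_prod (x : 'I_n) (u : seq 'I_n) (d : 'I_n -> nat) (s : 'I_n -> S) :
  (forall l, l \in u -> monic_in x (d l) (s l)) ->
  monic_in x (\sum_(l <- u) d l) (\prod_(l <- u) s l).
Proof.
elim: u => [|l u IH] ms; rewrite ?big_nil ?big_cons; first exact: monic_in1.
apply: monic_inM; first by apply: ms; rewrite mem_head.
by apply: IH => i iu; apply: ms; rewrite inE iu orbT.
Qed.

(** Seen in the direction x, multiplication by a monic polynomial of degree d
    is a linear recurrence of order d: the slice v + d is obtained from the d
    slices before it. *)
Lemma slice_monic (X : lmodType k) x (b : {poly S}) (c : k) d (f : arr n X) v :
  b \is monic -> size b = d.+1 -> (forall j, free_of x b`_j) ->
  slice x v ((c *: b.[var k x]) *: f) =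
  c%:A *: (slice x (v + d) f + \sum_(j < d) b`_j *: slice x (v + j) f).
Proof.
move=> mb sb fb.
have -> : c *: b.[var k x] = c%:A * b.[var k x] by rewrite mulr_algl.
rewrite -scalerA free_slice; last by apply: freeZ; apply: free1.
congr (_ *: _); rewrite horner_coef sb scaler_suml slice_sum.
rewrite big_ord_recr /= addrC; congr (_ + _).
  have -> : b`_d = 1 by move/monicP: mb; rewrite /lead_coef sb.
  by rewrite mul1r slice_varX.
by apply: eq_bigr => j _; rewrite -scalerA free_slice // slice_varX.
Qed.

End Monic.

(** Strong recursion for a step that is given the whole history; it runs the
    recurrence of a monic polynomial. *)
Lemma course_of_values (A : Type) (a0 : A) (step : nat -> (nat -> A) -> A) :
  (forall m h h', (forall i, (i < m)%N -> h i = h' i) -> step m h = step m h') ->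
  exists f, forall m, f m = step m f.
Proof.
move=> loc.
pose F := fix F m : nat -> A := if m is m'.+1 then
  fun i => if (i < m')%N then F m' i else step m' (F m') else fun=> a0.
have FS i M : (i < M)%N -> F M i = F i.+1 i.
  elim: M => // M IH; rewrite ltnS leq_eqVlt => /orP[/eqP -> //|lt].
  by rewrite /= lt IH //= ltnn.
exists (fun m => F m.+1 m) => m; rewrite {1}/F -/F ltnn.
by apply: loc => i /FS.
Qed.

(** * Functionals on the orderings of a set of letters *)

Section Words.
Variables (n : nat) (k : fieldType).
Notation S := {malg k[{cmonom 'I_n}]}.
Notation word := (seq 'I_n).
Variables (Q : 'I_n -> 'I_n -> S) (q : 'I_n -> 'I_n -> nat).
Hypothesis Q_free : forall a b i, i != a -> i != b -> free_of i (Q a b).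
Variable X : lmodType k.
Notation arr := (arr n X).
Implicit Types (V U W s u w : word) (P R : 'I_n -> S) (f g phi : word -> arr).

(** The dual of the module generated by the orderings of V, with the relations
    that P a kills every word beginning with a and that Q a b does not
    distinguish two words that differ by exchanging neighbours a and b. *)
Definition functional V P phi : Prop :=
  (forall a s, perm_eq (a :: s) V -> P a *: phi (a :: s) = 0) /\
  (forall s a b t, perm_eq (s ++ [:: a, b & t]) V ->
     Q a b *: phi (s ++ [:: a, b & t]) = Q a b *: phi (s ++ [:: b, a & t])).

Lemma perm_swap s (a b : 'I_n) t V : perm_eq (s ++ [:: a, b & t]) V ->
  perm_eq (s ++ [:: b, a & t]) V.
Proof.
apply: perm_trans; rewrite perm_cat2l -[_ :: _]/([:: b; a] ++ t).
by rewrite -[[:: a, b & t]]/([:: a; b] ++ t) perm_cat2r (perm_catC [:: b] [:: a]).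
Qed.

Lemma functionalB V P f g : functional V P f -> functional V P g ->
  functional V P (fun s => f s - g s).
Proof.
move=> [f0 f1] [g0 g1]; split=> [a s e|s a b t e].
  by rewrite scalerBr f0 // g0 // subrr.
by rewrite !scalerBr f1 // g1.
Qed.

Lemma functionalZ V P x f : functional V P f -> functional V P (fun s => x *: f s).
Proof.
move=> [f0 f1]; split=> [a s e|s a b t e].
  by rewrite scalerA mulrC -scalerA f0 // scaler0.
by rewrite !scalerA mulrC -!scalerA f1.
Qed.

Lemma functionalD V P f g : functional V P f -> functional V P g ->
  functional V P (fun s => f s + g s).
Proof.
move=> [f0 f1] [g0 g1]; split=> [a s e|s a b t e].
  by rewrite scalerDr f0 // g0 // addr0.
by rewrite !scalerDr f1 // g1.
Qed.

Lemma functional0 V P : functional V P (fun=> 0).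
Proof. by split=> *; rewrite !scaler0. Qed.

Lemma functional_sum V P (I : Type) (r : seq I) (F : I -> word -> arr) :
  (forall i, functional V P (F i)) -> functional V P (fun s => \sum_(i <- r) F i s).
Proof.
move=> fF; elim: r => [|i r IH].
  by under eq_fun do rewrite big_nil; apply: functional0.
by under eq_fun do rewrite big_cons; apply: functionalD.
Qed.

Lemma eq_functional V P P' f g : (forall s, perm_eq s V -> f s = g s) ->
  (forall i, i \in V -> P i = P' i) ->
  functional V P f -> functional V P' g.
Proof.
move=> fg PP [f0 f1]; split=> [a s e|s a b t e].
  by rewrite -fg // -PP ?f0 // -(perm_mem e) mem_head.
by rewrite -!fg ?f1 //; apply: perm_swap e.
Qed.

Lemma perm_functional V V' P f : perm_eq V V' -> functional V P f -> functional V' P f.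
Proof.
by move=> e [f0 f1]; split=> [a s|s a b t]; rewrite -(permPr e); [apply: f0 | apply: f1].
Qed.

(** The relations do not involve the letters of W. *)
Lemma functional_fiber V P W a f : {in W, forall i, i \notin V} ->
  {in V & W, forall v i, free_of i (P v)} ->
  functional V P f -> functional V P (fun s => fiber W a (f s)).
Proof.
move=> VW fP [f0 f1]; split=> [b s e|s b c t e].
  rewrite -free_fiber ?f0 // => i iW; apply: fP => //.
  by rewrite -(perm_mem e) mem_head.
have fQ i : i \in W -> free_of i (Q b c).
  move=> /VW; rewrite -(perm_mem e) mem_cat !inE !negb_or.
  by case/and4P=> _ ib ic _; apply: Q_free.
by rewrite -!free_fiber // f1.
Qed.

(** The relations do not involve x, so they can be verified on each slice. *)
Lemma functional_glue V P x f : x \notin V -> {in V, forall v, free_of x (P v)} ->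
  (forall m, functional V P (fun s => slice x m (f s))) -> functional V P f.
Proof.
move=> xV fP sl; split=> [b s e|s b c t e]; apply: (@slice_inj _ _ _ x) => m.
  rewrite free_slice ?(proj1 (sl m)) //; apply: fP.
  by rewrite -(perm_mem e) mem_head.
have fQ : free_of x (Q b c).
  move: xV; rewrite -(perm_mem e) mem_cat !inE !negb_or.
  by case/and4P=> _ ib ic _; apply: Q_free.
by rewrite !free_slice // (proj2 (sl m)).
Qed.

Lemma functional_slice V P x m f : x \notin V -> {in V, forall v, free_of x (P v)} ->
  functional V P f -> functional V P (fun s => slice x m (f s)).
Proof.
move=> xV fP; under [in X in _ -> X]eq_fun do rewrite sliceE.
by apply: functional_fiber => [i|v i vV]; rewrite inE => /eqP -> //; apply: fP.
Qed.

(** The prefix pre is read backwards from x. Exchanging x with a letter l costs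
    a factor of degree q x l in x; the walk ends at the first letter smaller
    than x, which then plays the part of the beginning of the word, or else at
    the beginning, where the first-letter polynomial of degree p x applies. *)
Fixpoint bound (p : 'I_n -> nat) (x : 'I_n) (pre : word) : nat :=
  if pre is l :: pre' then (q x l + (if (l < x)%N then 0 else bound p x pre'))%N
  else p x.

Fixpoint below (p : 'I_n -> nat) (pre s : word) (a : 'I_n -> nat) : bool :=
  if s is x :: s' then (a x < bound p x pre)%N && below p (x :: pre) s' a
  else true.

(** Dually: the monomials below the bounds span the module of words, and they
    are independent in it. *)
Definition determined V P p : Prop :=
  (forall phi, functional V P phi ->
     (forall s a, perm_eq s V -> below p [::] s a -> phi s a = 0) ->
     forall s, perm_eq s V -> phi s = 0) /\
  (forall c : word -> arr, exists phi, functional V P phi /\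
     forall s a, perm_eq s V -> below p [::] s a -> phi s a = c s a).

Lemma determined_eq V P p f g : determined V P p ->
  functional V P f -> functional V P g ->
  (forall s a, perm_eq s V -> below p [::] s a -> f s a = g s a) ->
  forall s, perm_eq s V -> f s = g s.
Proof.
move=> [uni _] Ff Fg fg s sV; apply: subr0_eq.
apply: uni (functionalB Ff Fg) _ s sV => s a sV /(fg _ _ sV) e.
by rewrite arrBE e subrr.
Qed.

Lemma eq_below p pre s a b :
  (forall i, i \in s -> a i = b i) -> below p pre s a = below p pre s b.
Proof.
elim: s pre => //= x s IH pre ab; rewrite (ab x) ?mem_head // IH // => i i_s.
by apply: ab; rewrite inE i_s orbT.
Qed.

Lemma below_set_exp p s V x m a : perm_eq s V -> x \notin V ->
  below p [::] s (set_exp x m a) = below p [::] s a.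
Proof.
move=> sV xV; apply: eq_below => i; rewrite (perm_mem sV) /set_exp => iV.
by case: eqP xV iV => // -> /negbTE ->.
Qed.

Section Solve.
Variables (U : word) (P : 'I_n -> S) (p : 'I_n -> nat).
Hypothesis detU : determined U P p.
Variables (x : 'I_n) (d : nat) (B : S).
Hypothesis xU : x \notin U.
Hypothesis P_free : {in U, forall l, free_of x (P l)}.
Hypothesis B_monic : monic_in x d B.

(** By slice_monic the equation B f = 0 is a recurrence in the direction x, so
    f vanishes if its first d slices do; each slice is a functional on U, for
    which detU applies. *)
Lemma monic_uniq f : functional U P f ->
  (forall u, perm_eq u U -> B *: f u = 0) ->
  (forall u a, perm_eq u U -> below p [::] u a -> (a x < d)%N -> f u a = 0) ->
  forall u, perm_eq u U -> f u = 0.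
Proof.
move=> Ff Bf f0; have [b [c [c0 mb sb fb Be]]] := B_monic.
suff sl0 m u : perm_eq u U -> slice x m (f u) = 0.
  by move=> u uU; apply: (@slice_inj _ _ _ x) => m; rewrite sl0.
elim/ltn_ind: m u => m IH u uU; have [lt_md|le_dm] := ltnP m d.
  apply: (proj1 detU) (functional_slice m xU P_free Ff) _ u uU => s a sU sa.
  apply: f0; rewrite ?(below_set_exp _ _ _ sU) //.
  by rewrite /set_exp eqxx.
have := slice_monic c (f u) (m - d) mb sb fb; rewrite -Be Bf // subnK //.
rewrite big1 ?addr0 => [|j _]; last first.
  by rewrite IH ?scaler0 // -ltn_subRL subKn ?ltn_ord.
by move=> e0; apply: (arrC_eq0 c0); rewrite -e0.
Qed.

(** The recurrence is run forwards. The first d slices are chosen by the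
    existence half of detU, the later ones are computed from kappa and the
    earlier slices. They remain functionals because functionals are stable
    under the polynomial ring. *)
Lemma monic_solve kappa c : functional U P kappa -> exists f,
  [/\ functional U P f, forall u, perm_eq u U -> B *: f u = kappa u
    & forall u a, perm_eq u U -> below p [::] u a -> (a x < d)%N -> f u a = c u a].
Proof.
move=> Fk; have [b [e [e0 mb sb fb Be]]] := B_monic.
have init m : exists h, functional U P h /\
    forall u a, perm_eq u U -> below p [::] u a -> h u a = slice x m (c u) a.
  exact: (proj2 detU).
have /choice[h /all_and2[Fh hc]] := init.
pose step m (g : nat -> word -> arr) u : arr :=
  if (m < d)%N then slice x m (h m u) else
  e^-1%:A *: slice x (m - d) (kappa u) - \sum_(j < d) b`_j *: g (m - d + j)%N u.
have [|g gE] := @course_of_values _ (fun=> 0) step.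
  move=> m g g' gg; apply: funext => u; rewrite /step.
  case: ltnP => // le_dm; congr (_ - _); apply: eq_bigr => j _.
  by rewrite gg // -ltn_subRL subKn ?ltn_ord.
have slg v m u : slice x v (g m u) = g m u.
  elim/ltn_ind: m => m IH; rewrite gE /step.
  have tw v' (r : arr) : slice x v (slice x v' r) = slice x v' r.
    by apply: funext => a; rewrite /slice set_exp_twice.
  case: ltnP => [_|le_dm]; first exact: tw.
  rewrite sliceB free_slice ?tw; last exact/freeZ/free1.
  congr (_ - _); rewrite slice_sum; apply: eq_bigr => j _.
  by rewrite free_slice // IH // -ltn_subRL subKn ?ltn_ord.
have Fg m : functional U P (g m).
  elim/ltn_ind: m => m IH; rewrite gE /step.
  case: ltnP => [_|le_dm]; first exact: functional_slice.
  apply: functionalB; first exact/functionalZ/functional_slice.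
  apply: (@functional_sum _ _ _ _ (fun j : 'I_d => fun u => _)) => j.
  by apply/functionalZ/IH; rewrite -ltn_subRL subKn ?ltn_ord.
pose f u : arr := fun a => g (a x) u a.
have slf m u : slice x m (f u) = g m u.
  by rewrite -(slg m m u); apply: funext => a; rewrite /slice /f {1}/set_exp eqxx.
exists f; split=> [|u uU|u a uU ua ax].
- by apply: (functional_glue xU P_free) => m; under eq_fun do rewrite slf.
- apply: (@slice_inj _ _ _ x) => m; rewrite Be (slice_monic _ _ _ mb sb) //.
  rewrite !slf gE /step ltnNge leq_addl /= addnK.
  under [X in _ + X]eq_bigr do rewrite slf.
  by rewrite subrK; apply: arrCVK.
- rewrite /f gE /step ax /slice hc // ?(below_set_exp _ _ _ uU) //.
  by rewrite /slice set_exp_twice set_exp_id.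
Qed.

End Solve.
End Words.

(** * Functionals of two words *)

Section Tensor.
Variables (n : nat) (k : fieldType).
Notation S := {malg k[{cmonom 'I_n}]}.
Notation word := (seq 'I_n).
Variables (Q : 'I_n -> 'I_n -> S) (q : 'I_n -> 'I_n -> nat).
Hypothesis Q_free : forall a b i, i != a -> i != b -> free_of i (Q a b).
Variable X : lmodType k.
Notation arr := (arr n X).
Implicit Types (V s u w : word).
Notation functional := (functional Q).
Notation determined := (determined Q q X).
Notation below := (below q).

Variables (U W : word) (P R : 'I_n -> S) (p r : 'I_n -> nat).
Hypotheses (detU : determined U P p) (detW : determined W R r).
Variables (x : 'I_n) (d : nat) (B : S).
Hypotheses (xU : x \notin U) (xW : x \notin W).
Hypothesis UW : {in W, forall i, i \notin U}.
Hypothesis Px : {in U, forall l, free_of x (P l)}.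
Hypothesis PW : {in U & W, forall l i, free_of i (P l)}.
Hypothesis BW : {in W, forall i, free_of i B}.
Hypothesis B_monic : monic_in x d B.

(** The dual of a tensor product of two modules of words. *)
Definition bifunctional (zeta : word -> word -> arr) : Prop :=
  (forall w, perm_eq w W -> functional U P (zeta^~ w)) /\
  (forall u, perm_eq u U -> functional W R (zeta u)).

(** For a fixed second word and fixed exponents on W, what is left is a
    functional on U that B annihilates. *)
Lemma bimonic_uniq zeta : bifunctional zeta ->
  (forall u w, perm_eq u U -> perm_eq w W -> B *: zeta u w = 0) ->
  (forall u w a, perm_eq u U -> perm_eq w W ->
     below p [::] u a -> (a x < d)%N -> below r [::] w a -> zeta u w a = 0) ->
  forall u w, perm_eq u U -> perm_eq w W -> zeta u w = 0.
Proof.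
move=> [FU FW] Bz z0 u w uU wW; move: w wW.
apply: (proj1 detW) (FW u uU) _ => w a wW wa.
pose eta v := fiber W a (zeta v w).
suff eta0 : eta u = 0.
  rewrite -(arr0E X a) -eta0; congr (zeta u w _); apply: funext => i.
  by case: ifP.
apply: (monic_uniq Q_free detU xU Px B_monic) _ _ _ u uU => [|v vU|v b vU vb bx].
- exact: functional_fiber (FU w wW).
- by rewrite -free_fiber // Bz.
- rewrite /eta /fiber z0 //.
  + rewrite -(eq_below _ _ _ (a := b)) // => i; rewrite (perm_mem vU) => iU.
    by case: ifP => // /UW; rewrite iU.
  + by rewrite (negbTE xW).
  + by rewrite (eq_below _ _ _ (b := a)) // => i; rewrite (perm_mem wW) => ->.
Qed.

(** The system is first solved over U for each second word w separately, which
    gives eta without any relation in w. Only the values of eta at exponents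
    small on W are kept, and they are extended to functionals in w. Both sides
    of each relation in u are then functionals in w that agree at small
    exponents, hence everywhere. *)
Lemma bimonic_solve kappa c : bifunctional kappa -> exists zeta : word -> word -> arr,
  [/\ bifunctional zeta,
      forall u w, perm_eq u U -> perm_eq w W -> B *: zeta u w = kappa u w
    & forall u w a, perm_eq u U -> perm_eq w W ->
        below p [::] u a -> (a x < d)%N -> below r [::] w a ->
        zeta u w a = c u w a].
Proof.
move=> [kU kW].
have sol w : exists eta : word -> arr, perm_eq w W ->
    [/\ functional U P eta, forall u, perm_eq u U -> B *: eta u = kappa u w
      & forall u a, perm_eq u U -> below p [::] u a -> (a x < d)%N ->
          eta u a = c u w a].
  case: (boolP (perm_eq w W)) => [wW|]; last by exists (fun=> 0).
  have [eta [e1 e2 e3]] :=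
    monic_solve Q_free detU xU Px B_monic (c^~ w) (kU w wW).
  by exists eta.
have /choice[eta etaP] := sol.
have ext u : exists z : word -> arr, functional W R z /\
    forall w a, perm_eq w W -> below r [::] w a -> z w a = eta w u a.
  exact: (proj2 detW (fun w => eta w u)).
have /choice[zeta /all_and2[Fz ze]] := ext.
(* At exponents that are small on W, zeta is eta, and a polynomial without the
   letters of W only reads such exponents there. *)
have loc (t : S) u w a : {in W, forall i, free_of i t} -> perm_eq w W ->
    below r [::] w a -> (t *: zeta u w) a = (t *: eta w u) a.
  move=> fs wW wa; apply: (free_local fs) => b ba; apply: ze => //.
  by rewrite (eq_below _ _ _ (b := a)) // => i; rewrite (perm_mem wW) => /ba.
exists zeta; split=> [|u w uU wW|u w a uU wW ua ax wa].
- split=> [w wW|u _]; last exact: Fz.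
  split=> [b s e|s b b' t e].
    apply: (determined_eq (f := fun w => P b *: zeta (b :: s) w) (g := fun=> 0) detW) w wW => [||w a wW wa].
    - exact/functionalZ/Fz.
    - exact: functional0.
    have bU : b \in U by rewrite -(perm_mem e) mem_head.
    rewrite loc // => [|i iW]; last exact: PW.
    by have [[-> //]] := etaP w wW.
  apply: (determined_eq (f := fun w => Q b b' *: zeta (s ++ [:: b, b' & t]) w)
    (g := fun w => Q b b' *: zeta (s ++ [:: b', b & t]) w) detW) w wW => [||w a wW wa]; try exact/functionalZ/Fz.
  have fQ i : i \in W -> free_of i (Q b b').
    move=> /UW; rewrite -(perm_mem e) mem_cat !inE !negb_or.
    by case/and4P=> _ ib ic _; apply: Q_free.
  by rewrite !loc //; have [[_ ->]] := etaP w wW.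
- apply: (determined_eq (f := fun w => B *: zeta u w) detW) w wW => [||w a wW wa].
  + exact/functionalZ/Fz.
  + exact: kW.
  + by rewrite loc //; have [_ ->] := etaP w wW.
- by rewrite ze //; have [_ _ ->] := etaP w wW.
Qed.

End Tensor.

(** * Unshuffling *)

(** Words built from the same pieces are compared through the multiplicities of
    a letter. *)
Ltac perm_from e :=
  apply/seq.permP => ?; rewrite -(seq.permP e);
  rewrite -?cats1 /= ?count_cat /= ?count_cat /= ?count_cat /=; lia.

Section Unshuffle.
Variables (n : nat) (k : fieldType) (X : lmodType k).
Notation S := {malg k[{cmonom 'I_n}]}.
Notation word := (seq 'I_n).
Notation arr := (arr n X).
Implicit Types (zeta : word -> word -> arr) (u v w : word).

(** The sum over all ways of distributing the letters of w, in their order,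
    over the ends of u and v. *)
Fixpoint unshuffle zeta u v w : arr :=
  if w is b :: w' then unshuffle zeta (rcons u b) v w' + unshuffle zeta u (rcons v b) w'
  else zeta u v.

Section Relations.
Variables (Z : word) (s : S) (zeta : word -> word -> arr).

Lemma unshuffle_eq0l a u v w :
  (forall u' v', perm_eq (a :: u' ++ v') Z -> s *: zeta (a :: u') v' = 0) ->
  perm_eq (a :: u ++ v ++ w) Z -> s *: unshuffle zeta (a :: u) v w = 0.
Proof.
move=> h; elim: w u v => [|b w IH] u v e /=; first by apply: h; rewrite cats0 in e.
rewrite scalerDr (IH (rcons u b)) ?(IH u (rcons v b)) ?addr0 //.
  by perm_from e.
by perm_from e.
Qed.

Lemma unshuffle_eq0r a u v w :
  (forall u' v', perm_eq (u' ++ a :: v') Z -> s *: zeta u' (a :: v') = 0) ->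
  perm_eq (u ++ a :: v ++ w) Z -> s *: unshuffle zeta u (a :: v) w = 0.
Proof.
move=> h; elim: w u v => [|b w IH] u v e /=; first by apply: h; rewrite cats0 in e.
rewrite scalerDr (IH (rcons u b)) ?(IH u (rcons v b)) ?addr0 //.
  by perm_from e.
by perm_from e.
Qed.

Variables (a b : 'I_n).
Hypothesis swap_l : forall u u' v, perm_eq ((u ++ [:: a, b & u']) ++ v) Z ->
  s *: zeta (u ++ [:: a, b & u']) v = s *: zeta (u ++ [:: b, a & u']) v.

Lemma unshuffle_swapl u u' v w : perm_eq ((u ++ [:: a, b & u']) ++ v ++ w) Z ->
  s *: unshuffle zeta (u ++ [:: a, b & u']) v w =
  s *: unshuffle zeta (u ++ [:: b, a & u']) v w.
Proof.
elim: w u' v => [|c w IH] u' v e /=; first by apply: swap_l; rewrite cats0 in e.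
rewrite !scalerDr !rcons_cat /= IH ?(IH u' (rcons v c)) //; by perm_from e.
Qed.

Hypothesis swap_r : forall u v v', perm_eq (u ++ v ++ [:: a, b & v']) Z ->
  s *: zeta u (v ++ [:: a, b & v']) = s *: zeta u (v ++ [:: b, a & v']).

Lemma unshuffle_swapr u v v' w : perm_eq (u ++ v ++ [:: a, b & v'] ++ w) Z ->
  s *: unshuffle zeta u (v ++ [:: a, b & v']) w =
  s *: unshuffle zeta u (v ++ [:: b, a & v']) w.
Proof.
elim: w u v' => [|c w IH] u v' e /=; first by apply: swap_r; rewrite cats0 in e.
rewrite !scalerDr !rcons_cat /= IH ?(IH u (rcons v' c)) //; by perm_from e.
Qed.

(** Where a and b go to the same side, the relation of this side exchanges
    them; the two terms that separate them are exchanged with each other. *)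
Lemma unshuffle_swap u v w w' : perm_eq (u ++ v ++ w ++ [:: a, b & w']) Z ->
  s *: unshuffle zeta u v (w ++ [:: a, b & w']) =
  s *: unshuffle zeta u v (w ++ [:: b, a & w']).
Proof.
elim: w u v => [|c w IH] u v e /=; last first.
  rewrite !scalerDr IH ?IH //; by perm_from e.
rewrite !scalerDr -!cats1 -!catA /=.
rewrite (@unshuffle_swapl u [::] v w'); last by perm_from e.
rewrite (@unshuffle_swapr u v [::] w'); last by perm_from e.
by rewrite -!addrA; congr (_ + _); rewrite addrCA.
Qed.

End Relations.

Lemma unshuffleD zeta zeta' u v w :
  unshuffle (fun u w => zeta u w + zeta' u w) u v w =
  unshuffle zeta u v w + unshuffle zeta' u v w.
Proof. by elim: w u v => //= b w IH u v; rewrite !IH addrACA. Qed.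

(** Unshuffling only lengthens the first word, so a change of zeta at first
    words of length m is invisible from longer ones; from words of length m it
    is seen in the single term that moves no letter (unshuffle_size). *)
Lemma unshuffle_size_lt zeta m u v w : (m < size u)%N ->
  unshuffle (fun u w => if size u == m then zeta u w else 0) u v w = 0.
Proof.
elim: w u v => [|b w IH] u v lt /=; first by rewrite gtn_eqF.
by rewrite !IH ?addr0 ?size_rcons // ltnW.
Qed.

Lemma unshuffle_size zeta m u v w : size u = m ->
  unshuffle (fun u w => if size u == m then zeta u w else 0) u v w = zeta u (v ++ w).
Proof.
move=> um; elim: w v => [|b w IH] v /=; first by rewrite um eqxx cats0.
by rewrite unshuffle_size_lt ?size_rcons ?um // add0r IH cat_rcons.
Qed.

End Unshuffle.

(** * Functionals are determined by their values at small exponents *)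

Section InductiveStep.
Variables (n : nat) (k : fieldType).
Notation S := {malg k[{cmonom 'I_n}]}.
Notation word := (seq 'I_n).
Variables (Q : 'I_n -> 'I_n -> S) (q : 'I_n -> 'I_n -> nat).
Hypothesis Q_free : forall a b i, i != a -> i != b -> free_of i (Q a b).
Hypothesis Q_sym : forall a b, Q a b = Q b a.
Hypothesis Q_monic : forall a b, a != b -> monic_in a (q a b) (Q a b).
Variable X : lmodType k.
Notation arr := (arr n X).
Implicit Types (s u w U W : word).
Notation functional := (functional Q).
Notation determined := (determined Q q X).
Notation below := (below q).

Variables (x : 'I_n) (V : word).
Hypothesis uniqV : uniq (x :: V).
Hypothesis x_min : {in V, forall l : 'I_n, (x < l)%N}.
Variables (P : 'I_n -> S) (p : 'I_n -> nat).
Hypothesis P_monic : {in x :: V, forall l, monic_in l (p l) (P l)}.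
Hypothesis P_free : {in x :: V &, forall l i, i != l -> free_of i (P l)}.
Hypothesis det_before : forall U, uniq U -> {subset U <= V} -> determined U P p.
Hypothesis det_after : forall W, uniq W -> {subset W <= V} ->
  determined W (Q x) (q^~ x).

(** B u kills the words u x w: it collects the polynomials met by x on its way
    to the front, together with the one that acts on a leading x. Its degree in
    x is d u. *)
Let B u : S := P x * \prod_(l <- u) Q x l.
Let d u : nat := (p x + \sum_(l <- u) q x l)%N.

Lemma perm_B u u' : perm_eq u u' -> B u = B u'.
Proof. by move=> e; rewrite /B (perm_big _ e). Qed.

Lemma perm_d u u' : perm_eq u u' -> d u = d u'.
Proof. by move=> e; rewrite /d (perm_big _ e). Qed.

Lemma B_rcons u b : B (rcons u b) = Q x b * B u.
Proof.
rewrite /B -cats1 big_cat big_seq1 /= mulrA mulrC.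
by rewrite [Q x b * _]mulrC.
Qed.

Lemma split_at_x s : perm_eq s (x :: V) ->
  exists u w, s = u ++ x :: w /\ perm_eq (u ++ w) V.
Proof.
move=> e; have: x \in s by rewrite (perm_mem e) mem_head.
move=> xs; case/splitPr: xs e => u w e; exists u, w; split=> //.
by rewrite -(perm_cons x) -(permPr e) -cat1s perm_catCA.
Qed.

Lemma perm_insert u w : perm_eq (u ++ w) V -> perm_eq (u ++ x :: w) (x :: V).
Proof. by move=> e; rewrite -cat1s perm_catCA /= perm_cons. Qed.

Lemma below_after_x pre0 pre w a : {in w, forall l : 'I_n, (x < l)%N} ->
  below p (pre ++ x :: pre0) w a = below (q^~ x) pre w a.
Proof.
have bE (z : 'I_n) : (x < z)%N -> bound q p z (pre ++ x :: pre0) = bound q (q^~ x) z pre.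
  by move=> xz; elim: (pre) => /= [|l pre' ->]; rewrite ?xz ?addn0.
elim: w pre bE => //= z w IH pre bE wx.
rewrite bE; last by apply: wx; rewrite mem_head.
congr (_ && _); apply: (IH (z :: pre)) => [y xy /=|l lw].
  by rewrite bE.
by apply: wx; rewrite inE lw orbT.
Qed.

Lemma bound_x pre : {in pre, forall l : 'I_n, (x < l)%N} -> bound q p x pre = d pre.
Proof.
rewrite /d; elim: pre => [|l pre IH] xp /=; first by rewrite big_nil addn0.
have /ltnW := xp l (mem_head _ _); rewrite leqNgt => /negbTE ->.
rewrite big_cons IH ?(addnCA (q x l)) // => y yp.
by apply: xp; rewrite inE yp orbT.
Qed.

Lemma below_cat pre u w a :
  below p pre (u ++ w) a = below p pre u a && below p (catrev u pre) w a.
Proof. by elim: u pre => //= z u IH pre; rewrite IH andbA. Qed.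

(** The walk of the least letter x always reaches the beginning of the word,
    and the walk of a letter after x ends at x at the latest. So the bounds
    after x are those of the word w alone, with the polynomials Q x for its
    first letter. *)
Lemma below_split u w a : perm_eq (u ++ w) V ->
  below p [::] (u ++ x :: w) a =
  [&& below p [::] u a, (a x < d u)%N & below (q^~ x) [::] w a].
Proof.
move=> e; have xuw y : y \in u ++ w -> (x < y)%N by rewrite (perm_mem e) => /x_min.
rewrite below_cat /= -/(rev u) bound_x => [|y]; last first.
  by rewrite mem_rev => yu; apply: xuw; rewrite mem_cat yu.
rewrite (perm_d (permEl (perm_rev u))).
by rewrite (@below_after_x (rev u) [::]) // => y yw; apply: xuw; rewrite mem_cat yw orbT.
Qed.

Section Blocks.
Variables (U W : word).
Hypothesis UWV : perm_eq (U ++ W) V.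

Let subU : {subset U <= V}.
Proof. by move=> i iU; rewrite -(perm_mem UWV) mem_cat iU. Qed.
Let subW : {subset W <= V}.
Proof. by move=> i iW; rewrite -(perm_mem UWV) mem_cat iW orbT. Qed.
Let uniqUW : uniq (U ++ W).
Proof. by rewrite (perm_uniq UWV); case/andP: uniqV. Qed.
Let xV : x \notin V. Proof. by case/andP: uniqV. Qed.
Let xU : x \notin U. Proof. exact: contra (@subU x) xV. Qed.
Let xW : x \notin W. Proof. exact: contra (@subW x) xV. Qed.
Let UW : {in W, forall i, i \notin U}.
Proof.
by move=> i iW; move: uniqUW; rewrite cat_uniq => /and3P[_ /hasPn h _]; apply: h.
Qed.
Let detU : determined U P p.
Proof. by apply: det_before => //; move: uniqUW; rewrite cat_uniq => /andP[]. Qed.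
Let detW : determined W (Q x) (q^~ x).
Proof. by apply: det_after => //; move: uniqUW; rewrite cat_uniq => /and3P[]. Qed.
Let Px : {in U, forall l, free_of x (P l)}.
Proof.
move=> l lU; apply: P_free; rewrite ?mem_head ?inE ?(subU lU) ?orbT //.
by apply: contraNneq xU => ->.
Qed.
Let PW : {in U & W, forall l i, free_of i (P l)}.
Proof.
move=> l i lU iW; apply: P_free; rewrite ?inE ?(subU lU) ?(subW iW) ?orbT //.
by apply: contraNneq (UW iW) => ->.
Qed.
Let BW : {in W, forall i, free_of i (B U)}.
Proof.
move=> i iW; have ix : i != x by apply: contraNneq xW => <-.
apply: freeM; first by apply: P_free; rewrite ?mem_head ?inE ?(subW iW) ?orbT.
apply: free_prod => l lU; apply: Q_free => //.
by apply: contraNneq (UW iW) => ->.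
Qed.
Let B_monic : monic_in x (d U) (B U).
Proof.
apply: monic_inM; first by apply: P_monic; rewrite mem_head.
apply: monic_in_prod => l lU; apply: Q_monic.
by apply: contraNneq xU => ->.
Qed.

Definition block_uniq := bimonic_uniq Q_free detU detW xU xW UW Px PW BW B_monic.
Definition block_solve := bimonic_solve Q_free detU detW xU UW Px PW BW B_monic.

End Blocks.

(** The letters of u are exchanged with x one after the other, starting on the
    right. *)
Lemma B_vanish (phi : word -> arr) u w : functional (x :: V) P phi ->
  perm_eq (u ++ w) V -> B u *: phi (u ++ x :: w) = 0.
Proof.
move=> [phi0 phi1]; elim/last_ind: u w => [|u b IH] w e.
  by rewrite /B big_nil mulr1 phi0 // perm_cons.
have e' : perm_eq (u ++ b :: w) V by rewrite -cat_rcons.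
rewrite B_rcons mulrC -scalerA cat_rcons Q_sym phi1; last first.
  by rewrite -cat_rcons; apply: perm_insert.
by rewrite -Q_sym scalerA mulrC -scalerA (IH (b :: w)) // scaler0.
Qed.

(** Induction on the length of w in u x w. Over fixed sets of letters before
    and after x, the values at u x w form a bifunctional: the relation for the
    first letter b of w = b w' is Q x b [u x b w'] = Q x b [u b x w'], where
    the right-hand side vanishes by induction. *)
Lemma step_uniq (phi : word -> arr) : functional (x :: V) P phi ->
  (forall s a, perm_eq s (x :: V) -> below p [::] s a -> phi s a = 0) ->
  forall s, perm_eq s (x :: V) -> phi s = 0.
Proof.
move=> Fphi phi_below.
suff main m : forall u w, perm_eq (u ++ w) V -> (size w < m)%N -> phi (u ++ x :: w) = 0.
  move=> s /split_at_x[u [w [-> e]]]; exact: main e (ltnSn _).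
elim: m => // m IH U W e; rewrite ltnS leq_eqVlt => /predU1P[Wm|]; last exact: IH.
have perm_UW u w : perm_eq u U -> perm_eq w W -> perm_eq (u ++ w) V.
  by move=> uU wW; apply: perm_trans e; apply: perm_cat.
have [phi0 phi1] := Fphi.
apply: (block_uniq e (zeta := fun u w => phi (u ++ x :: w))) => //.
- split=> [w wW|u uU]; split.
  + by move=> a s sU; rewrite phi0 // (perm_insert (u := a :: s)) // perm_UW.
  + move=> s a b t sU; rewrite -!catA /= phi1 //.
    by have := perm_insert (perm_UW _ _ sU wW); rewrite -!catA.
  + move=> b t bW; rewrite phi1 ?perm_insert ?perm_UW // -cat_rcons.
    rewrite IH ?scaler0 ?cat_rcons ?perm_UW //.
    by have /= := perm_size bW; rewrite Wm => ->.
  + move=> s a b t sW; rewrite -!cat_cons !catA phi1 //.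
    by have := perm_insert (perm_UW _ _ uU sW); rewrite -!cat_cons !catA.
- by move=> u w uU wW; rewrite -(perm_B uU) B_vanish // perm_UW.
- move=> u w a uU wW ua ax wa; apply: phi_below; first exact/perm_insert/perm_UW.
  by rewrite below_split ?perm_UW // ua wa (perm_d uU) ax.
Qed.

Section Existence.
Variable c : word -> arr.

(** The decoupled problem: relations within u and within w, first-letter
    relations P for u and Q x for w, and no interaction through x. *)
Definition blockwise (zeta : word -> word -> arr) : Prop :=
  forall U W, perm_eq (U ++ W) V -> bifunctional Q U W P (Q x) zeta.

Section Blockwise.
Variable zeta : word -> word -> arr.
Hypothesis bz : blockwise zeta.

Lemma unshuffle_first a u w : perm_eq (a :: u ++ w) V ->
  P a *: unshuffle zeta (a :: u) [::] w = 0.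
Proof.
move=> e; apply: (@unshuffle_eq0l _ _ _ V) => // u' v' e'.
by have [F _] := bz (U := a :: u') e'; have [F0 _] := F v' (perm_refl _); apply: F0.
Qed.

Lemma unshuffle_swap_before u a b u' w :
  perm_eq ((u ++ [:: a, b & u']) ++ w) V ->
  Q a b *: unshuffle zeta (u ++ [:: a, b & u']) [::] w =
  Q a b *: unshuffle zeta (u ++ [:: b, a & u']) [::] w.
Proof.
move=> e; apply: (@unshuffle_swapl _ _ _ V) => // s s' v e'.
by have [F _] := bz e'; have [_ F1] := F v (perm_refl _); apply: F1.
Qed.

Lemma unshuffle_swap_after u w a b w' :
  perm_eq (u ++ w ++ [:: a, b & w']) V ->
  Q a b *: unshuffle zeta u [::] (w ++ [:: a, b & w']) =
  Q a b *: unshuffle zeta u [::] (w ++ [:: b, a & w']).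
Proof.
move=> e; apply: (@unshuffle_swap _ _ _ V) => // [s s' v|s v v'] e'.
  by have [F _] := bz e'; have [_ F1] := F v (perm_refl _); apply: F1.
by have [_ F] := bz e'; have [_ F1] := F s (perm_refl _); apply: F1.
Qed.

(** This is where the exchange of x and b comes from: of the two parts of the
    unshuffled sum, the one that leaves b at the beginning of the second word
    is killed by Q x b, and the other one is the right-hand side. *)
Lemma unshuffle_cross u b w : perm_eq (u ++ b :: w) V ->
  Q x b *: unshuffle zeta u [::] (b :: w) =
  Q x b *: unshuffle zeta (rcons u b) [::] w.
Proof.
move=> e; rewrite /= scalerDr [X in _ + X](@unshuffle_eq0r _ _ _ V) ?addr0 //.
move=> u' v' e'.
by have [_ F] := bz e'; have [F0 _] := F u' (perm_refl _); apply: F0.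
Qed.

End Blockwise.

(** The two remaining conditions on the words u x w, namely the relation that
    involves x in the first place and the prescribed values; they are achieved
    for long u first. *)
Definition solved m zeta : Prop :=
  (forall u w, perm_eq (u ++ w) V -> (m <= size u)%N ->
     B u *: unshuffle zeta u [::] w = 0) /\
  (forall u w a, perm_eq (u ++ w) V -> (m <= size u)%N ->
     below p [::] u a -> (a x < d u)%N -> below (q^~ x) [::] w a ->
     unshuffle zeta u [::] w a = c (u ++ x :: w) a).

(** A common representative of all orderings of a word, so that one solution is
    chosen for each pair of sets of letters. *)
Definition canon : word -> word := sort (fun i j : 'I_n => (i <= j)%N).

Lemma perm_canon u : perm_eq u (canon u).
Proof. by rewrite perm_sym; apply/permEl/perm_sort. Qed.

Lemma eq_canon u u' : perm_eq u u' -> canon u = canon u'.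
Proof.
move=> e; apply/perm_sortP => //.
- by move=> i j; apply: leq_total.
- by move=> i j l; apply: leq_trans.
- by move=> i j /anti_leq /val_inj.
Qed.

(** A correction supported on first words of length m does not disturb longer
    ones and enters once at length m. It has to solve a bimonic system whose
    right-hand side is minus the current defect. The defect is a bifunctional:
    its relation for the first letter b of w moves b across x, where the
    condition on u b already holds. *)
Lemma solve_level m zeta : blockwise zeta -> solved m.+1 zeta ->
  exists zeta', blockwise zeta' /\ solved m zeta'.
Proof.
move=> bz [zB zc].
pose Phi u w : arr := unshuffle zeta u [::] w.
have sol (UW : word * word) : exists z : word -> word -> arr,
    perm_eq (UW.1 ++ UW.2) V -> size UW.1 = m ->
    [/\ bifunctional Q UW.1 UW.2 P (Q x) z,
      forall u w, perm_eq u UW.1 -> perm_eq w UW.2 -> B UW.1 *: z u w = - (B UW.1 *: Phi u w)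
    & forall u w a, perm_eq u UW.1 -> perm_eq w UW.2 ->
        below p [::] u a -> (a x < d UW.1)%N -> below (q^~ x) [::] w a ->
        z u w a = c (u ++ x :: w) a - Phi u w a].
  case: UW => U W /=; case: (boolP (perm_eq (U ++ W) V)) => [e|_]; last by exists zeta.
  have [Um|/eqP ne] := eqVneq (size U) m; last by exists zeta => _ h; case: (ne h).
  have perm_UW u w : perm_eq u U -> perm_eq w W -> perm_eq (u ++ w) V.
    by move=> uU wW; apply: perm_trans e; apply: perm_cat.
  have bk : bifunctional Q U W P (Q x) (fun u w => - (B U *: Phi u w)).
    split=> [w wW|u uU]; split.
    - move=> a s sU; rewrite scalerN arr_scaleC /Phi unshuffle_first //.
        by rewrite scaler0 oppr0.
      exact: (perm_UW (a :: s)).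
    - move=> s a b t sU; rewrite !scalerN; congr (- _); rewrite arr_scaleC.
      by rewrite (arr_scaleC _ _ (Phi (_ ++ [:: b, a & _]) _)) /Phi unshuffle_swap_before // perm_UW.
    - move=> b t bW; rewrite scalerN arr_scaleC.
      have e' : perm_eq (u ++ b :: t) V by apply: perm_UW.
      rewrite unshuffle_cross // scalerA mulrC -(perm_B uU) -B_rcons zB ?oppr0 //.
        by rewrite cat_rcons.
      by rewrite size_rcons (perm_size uU) Um.
    - move=> s a b t sW; rewrite !scalerN; congr (- _); rewrite arr_scaleC.
      by rewrite (arr_scaleC _ _ (Phi _ (_ ++ [:: b, a & _]))) /Phi unshuffle_swap_after // perm_UW.
  have [z [bz' zk zc']] := block_solve e (fun u w a => c (u ++ x :: w) a - Phi u w a) bk.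
  by exists z.
have /choice[z zP] := sol.
pose zm u w : arr := z (canon u, canon w) u w.
pose zeta' u w : arr := zeta u w + (if size u == m then zm u w else 0).
have canonV u w : perm_eq (u ++ w) V -> perm_eq (canon u ++ canon w) V.
  by apply: perm_trans; rewrite perm_sym; apply: perm_cat; apply: perm_canon.
exists zeta'; split=> [U W e|].
  have [bU bW] := bz _ _ e.
  have [Um|UNm] := eqVneq (size U) m; last first.
    split=> [w wW|u uU].
      apply: eq_functional (bU w wW) => // u uU.
      by rewrite /zeta' (perm_size uU) (negbTE UNm) addr0.
    apply: eq_functional (bW u uU) => // w wW.
    by rewrite /zeta' (perm_size uU) (negbTE UNm) addr0.
  have cU := perm_canon U; have cW := perm_canon W.
  have [|[zU zW] _ _] := zP (canon U, canon W) (canonV _ _ e).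
    by rewrite -(perm_size cU).
  have zE u w : perm_eq u U -> perm_eq w W ->
      zeta u w + z (canon U, canon W) u w = zeta' u w.
    by move=> uU wW; rewrite /zeta' (perm_size uU) Um eqxx /zm (eq_canon uU) (eq_canon wW).
  have cU' : perm_eq (canon U) U by rewrite perm_sym.
  have cW' : perm_eq (canon W) W by rewrite perm_sym.
  split=> [w wW|u uU].
    have zUw := perm_functional cU' (zU w (perm_trans wW cW)).
    by apply: eq_functional (functionalD (bU w wW) zUw) => // u uU; apply: zE.
  have zWu := perm_functional cW' (zW u (perm_trans uU cU)).
  by apply: eq_functional (functionalD (bW u uU) zWu) => // w wW; apply: zE.
have zeta'E u w : (m <= size u)%N -> unshuffle zeta' u [::] w =
    Phi u w + (if size u == m then zm u w else 0).
  rewrite leq_eqVlt unshuffleD => /orP[/eqP um|lt].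
    by rewrite unshuffle_size -?um ?eqxx.
  by rewrite unshuffle_size_lt // gtn_eqF.
have zmP u w : perm_eq (u ++ w) V -> size u = m ->
    B u *: zm u w = - (B u *: Phi u w) /\
    forall a, below p [::] u a -> (a x < d u)%N -> below (q^~ x) [::] w a ->
      zm u w a = c (u ++ x :: w) a - Phi u w a.
  move=> e um; have cu := perm_canon u; have cw := perm_canon w.
  have [|_ h1 h2] := zP (canon u, canon w) (canonV _ _ e).
    by rewrite -(perm_size cu).
  split=> [|a]; first by rewrite (perm_B cu); apply: h1.
  by rewrite (perm_d cu); apply: h2.
split=> [u w e le_mu|u w a e le_mu ua ax wa]; rewrite zeta'E //.
  rewrite scalerDr; case: eqP => [um|/eqP]; first by rewrite (zmP _ _ e um).1 subrr.
  by move=> uNm; rewrite scaler0 addr0 zB // ltn_neqAle eq_sym uNm.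
case: eqP => [um|/eqP uNm].
  by rewrite arrDE (zmP _ _ e um).2 // addrC subrK.
by rewrite addr0 /Phi zc // ltn_neqAle eq_sym uNm.
Qed.

(** The value at u x w is the unshuffled sum. Exchanges on either side of x are
    inherited from the decoupled problem, and the exchange of x with a
    neighbour is unshuffle_cross. *)
Lemma step_solution : exists phi, functional (x :: V) P phi /\
  forall s a, perm_eq s (x :: V) -> below p [::] s a -> phi s a = c s a.
Proof.
have [zeta [bz [zB zc]]] : exists zeta, blockwise zeta /\ solved 0 zeta.
  suff: forall m, exists zeta, blockwise zeta /\ solved ((size V).+1 - m) zeta.
    by move=> /(_ (size V).+1); rewrite subnn.
  elim=> [|m [zeta [bz sz]]].
    exists (fun _ _ => 0); split=> [U W e|].
      by split=> *; apply: functional0.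
    have szV u w : perm_eq (u ++ w) V -> ((size V).+1 - 0 <= size u)%N = false.
      by move=> /perm_size <-; rewrite subn0 size_cat ltnNge leq_addr.
    by split=> [u w|u w a] /szV ->.
  have [lt_m|le_m] := ltnP m (size V).+1; last first.
    by exists zeta; rewrite (_ : (_ - m.+1 = (size V).+1 - m)%N) //; lia.
  by apply: solve_level bz _; rewrite -subnSK in sz.
have xV : x \notin V by case/andP: uniqV.
pose phi s := unshuffle zeta (take (index x s) s) [::] (drop (index x s).+1 s).
have phiE u w : perm_eq (u ++ w) V -> phi (u ++ x :: w) = unshuffle zeta u [::] w.
  move=> e; have xu : x \notin u.
    by apply: contra xV => xu; rewrite -(perm_mem e) mem_cat xu.
  rewrite /phi index_cat (negbTE xu) /= eqxx addn0 take_size_cat //.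
  by rewrite -cat_rcons drop_size_cat ?size_rcons.
exists phi; split; last first.
  by move=> s a /split_at_x[u [w [-> e]]]; rewrite below_split // phiE // => /and3P[]; apply: zc.
split=> [a s e|s a b t e].
  have [u [w [as_e e']]] := split_at_x e; rewrite as_e phiE //.
  case: u as_e e' => [|a' u] [-> _] e'; last exact: unshuffle_first.
  by have := zB [::] w e' isT; rewrite /B big_nil mulr1.
have eV w u : perm_eq (u ++ x :: w) (x :: V) -> perm_eq (u ++ w) V.
  by move=> e1; rewrite -(perm_cons x) -(permPr e1) -cat1s perm_catCA.
have [ax|ax] := eqVneq a x.
  rewrite ax in e *; have e' := eV _ _ e.
  rewrite phiE // -[in RHS]cat_rcons phiE ?cat_rcons //.
  exact: unshuffle_cross.
have [bx|bx] := eqVneq b x.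
  rewrite bx in e *; have e' := eV _ _ (perm_swap e).
  rewrite (phiE s (a :: t)) // -[in LHS]cat_rcons phiE ?cat_rcons //.
  by rewrite Q_sym unshuffle_cross.
have: x \in s ++ [:: a, b & t] by rewrite (perm_mem e) mem_head.
rewrite mem_cat !inE [x == a]eq_sym [x == b]eq_sym (negbTE ax) (negbTE bx) /=.
case/orP => [xs|xt].
  case/splitPr: xs e => u w; rewrite -!catA /= => e; have e' := eV _ _ e.
  by rewrite !phiE ?unshuffle_swap_after //; perm_from e'.
case/splitPr: xt e => u w e.
have sE (i j : 'I_n) : s ++ [:: i, j & u ++ x :: w] = (s ++ [:: i, j & u]) ++ x :: w.
  by rewrite -catA.
rewrite !sE in e *; have e' := eV _ _ e.
by rewrite !phiE ?unshuffle_swap_before //; perm_from e'.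
Qed.

End Existence.
End InductiveStep.

Section Determined.
Variables (n : nat) (k : fieldType).
Notation S := {malg k[{cmonom 'I_n}]}.
Notation word := (seq 'I_n).
Variables (Q : 'I_n -> 'I_n -> S) (q : 'I_n -> 'I_n -> nat).
Hypothesis Q_free : forall a b i, i != a -> i != b -> free_of i (Q a b).
Hypothesis Q_sym : forall a b, Q a b = Q b a.
Hypothesis Q_monic : forall a b, a != b -> monic_in a (q a b) (Q a b).
Variable X : lmodType k.

(** Strong induction on the number of letters. With the least letter x split
    off, the letters before x form a smaller problem with the same first-letter
    polynomials, those after x one with the polynomials Q x, which are again
    monic in their own letter and free of the others. *)
Theorem functional_determined (V : word) (P : 'I_n -> S) (p : 'I_n -> nat) :
  uniq V ->
  {in V, forall l, monic_in l (p l) (P l)} ->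
  {in V &, forall l i, i != l -> free_of i (P l)} ->
  determined Q q X V P p.
Proof.
have [m] := ubnP (size V); elim: m V P p => // m IH V P p ltm uV Pm Pf.
pose le (i j : 'I_n) := (i <= j)%N.
have sV : perm_eq (sort le V) V by apply/permEl/perm_sort.
suff [uni exi] : determined Q q X (sort le V) P p.
  have sV' : perm_eq V (sort le V) by rewrite perm_sym.
  split=> [phi F h s e|c].
    apply: (uni phi (perm_functional sV' F)) (perm_trans e sV') => s' a e'.
    exact: h (perm_trans e' sV).
  have [phi [F h]] := exi c; exists phi; split; first exact: perm_functional F.
  by move=> s a e; apply: h (perm_trans e sV').
have srt : sorted le (sort le V) by apply: sort_sorted => i j; apply: leq_total.
have mem_s := perm_mem sV; move: srt (perm_size sV) (perm_uniq sV).
case: (sort le V) mem_s => [|x V'] mem_s srt sz us.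
  split=> [phi _ h s /perm_nilP ->|c]; first exact/funext/(fun a => h [::] a isT isT).
  by exists (c); split; [split=> [a s|s a b t] /perm_size; rewrite ?size_cat ?addnS | ].
have uxV : uniq (x :: V') by rewrite us.
have xmin : {in V', forall l : 'I_n, (x < l)%N}.
  move=> l lV; rewrite ltn_neqAle; apply/andP; split.
    by case/andP: uxV => + _; apply: contraNneq => /val_inj ->.
  have trle : transitive le by move=> i j h; apply: leq_trans.
  by have /allP le_x := order_path_min trle srt; apply: (le_x l).
have ltV' U : uniq U -> {subset U <= V'} -> (size U < m)%N.
  by move=> uU sUV; apply: leq_ltn_trans (uniq_leq_size uU sUV) _; rewrite -sz in ltm.
have Pm' : {in x :: V', forall l, monic_in l (p l) (P l)}.
  by move=> l; rewrite mem_s; apply: Pm.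
have Pf' : {in x :: V' &, forall l i, i != l -> free_of i (P l)}.
  by move=> l i; rewrite !mem_s; apply: Pf.
have xV' : x \notin V' by case/andP: uxV.
have db U : uniq U -> {subset U <= V'} -> determined Q q X U P p.
  move=> uU sU; apply: IH (ltV' U uU sU) uU _ _ => [l lU|l i lU iU].
    by apply: Pm'; rewrite inE sU ?orbT.
  by apply: Pf'; rewrite inE sU ?orbT.
have da W : uniq W -> {subset W <= V'} -> determined Q q X W (Q x) (q^~ x).
  move=> uW sW; apply: IH (ltV' W uW sW) uW _ _ => [l lW|l i lW iW il].
    by rewrite Q_sym; apply: Q_monic; apply: contraNneq xV' => <-; apply: sW.
  by apply: Q_free => //; apply: contraNneq xV' => <-; apply: sW.
split.
  exact: (step_uniq Q_free Q_sym Q_monic uxV xmin Pm' Pf' db da).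
exact: (step_solution Q_free Q_sym Q_monic uxV xmin Pm' Pf' db da).
Qed.

End Determined.

(** * Words with distinct letters *)

Section LetterCount.
Variables (I : finType) (D : cartan_datum I) (n : nat).

Lemma sum_sroot (f : 'I_n -> I) :
  \sum_t sroot D (f t) = \sum_l sroot D l *~ #|[pred t | f t == l]|.
Proof.
rewrite (partition_big f predT) //=; apply: eq_bigr => l _.
rewrite (eq_bigr (fun=> sroot D l)) => [|t /eqP -> //].
by rewrite sumr_const pmulrn.
Qed.

(** The simple roots are linearly independent, so the weight of a word
    determines the multiplicity of each letter. *)
Lemma card_letter (f g : 'I_n -> I) l :
  \sum_t sroot D (f t) = \sum_t sroot D (g t) ->
  #|[pred t | f t == l]| = #|[pred t | g t == l]|.
Proof.
move=> e; apply/eqP; rewrite -eqz_nat -subr_eq0; apply/eqP; move: l.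
apply: (@sroot_indep _ D (fun l => _ - _)).
under eq_bigr do rewrite mulrzBr; rewrite sumrB -!sum_sroot.
by rewrite e subrr.
Qed.

Lemma inj_same_weight (f g : 'I_n -> I) :
  \sum_t sroot D (f t) = \sum_t sroot D (g t) -> injective g -> injective f.
Proof.
move=> e g_inj s t st; have : (#|[pred r | f r == f s]| <= 1)%N.
  rewrite (card_letter _ e); apply/card_le1_eqP => a b.
  by rewrite !inE => /eqP <- /eqP /g_inj.
by move/card_le1_eqP; apply; rewrite inE ?st.
Qed.

End LetterCount.

Section Letters.
Variables (I : finType) (D : cartan_datum I) (n : nat) (beta : wlat D).
Variables (gamma : Iseq n beta) (gamma_inj : injective gamma).
Implicit Types (nu mu : Iseq n beta).

Lemma sum_letter nu : \sum_t sroot D (nu t) = \sum_t sroot D (gamma t).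
Proof. exact: etrans (eqP (valP nu)) (esym (eqP (valP gamma))). Qed.

Lemma letter_inj nu : injective nu.
Proof. exact: inj_same_weight (sum_letter nu) gamma_inj. Qed.

Lemma letter_index nu t : exists j, gamma j == nu t.
Proof.
have /card_gt0P[j] : (0 < #|[pred j | gamma j == nu t]|)%N.
  rewrite -(card_letter _ (sum_letter nu)); apply/card_gt0P.
  by exists t; rewrite inE.
by rewrite inE; exists j.
Qed.

(** Letters are named by their position in gamma: the order of the theorem
    becomes the order of the ordinals. *)
Definition rk nu t : 'I_n := xchoose (letter_index nu t).

Lemma rkE nu t : gamma (rk nu t) = nu t.
Proof. exact/eqP/(xchooseP (letter_index nu t)). Qed.

Lemma rk_inj nu : injective (rk nu).
Proof.
move=> s t e; apply: (@letter_inj nu).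
by apply: etrans (esym (rkE nu s)) _; rewrite e rkE.
Qed.

Lemma rk_eq nu mu : rk nu =1 rk mu -> nu = mu.
Proof.
move=> e; apply/val_inj/ffunP => t.
by have := rkE nu t; rewrite e rkE.
Qed.

Definition pos nu : 'I_n -> 'I_n := invF (@rk_inj nu).

Lemma posK nu : cancel (pos nu) (rk nu). Proof. exact: f_invF. Qed.
Lemma rkK nu : cancel (rk nu) (pos nu). Proof. exact: invF_f. Qed.

Definition word_of nu : seq 'I_n := [seq rk nu t | t <- enum 'I_n].

Lemma size_word_of nu : size (word_of nu) = n.
Proof. by rewrite size_map size_enum_ord. Qed.

Lemma nth_word_of nu (t0 t : 'I_n) : nth t0 (word_of nu) t = rk nu t.
Proof. by rewrite /word_of (nth_map t) ?size_enum_ord ?nth_ord_enum. Qed.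

Lemma word_of_inj : injective word_of.
Proof.
move=> nu mu e; apply: rk_eq => t.
by rewrite -(nth_word_of nu t t) e nth_word_of.
Qed.

Lemma perm_word_of nu : perm_eq (word_of nu) (enum 'I_n).
Proof.
apply: uniq_perm; rewrite ?enum_uniq //.
  by rewrite map_inj_uniq ?enum_uniq //; apply: rk_inj.
move=> j; rewrite mem_enum inE; apply/mapP.
by exists (pos nu j); rewrite ?mem_enum ?posK.
Qed.

Lemma word_of_surj s : perm_eq s (enum 'I_n) -> exists nu, word_of nu = s.
Proof.
move=> e; have sz : size s = n by rewrite (perm_size e) size_enum_ord.
pose f : {ffun 'I_n -> I} := [ffun t : 'I_n => gamma (nth t s t)].
have fP : \sum_t sroot D (f t) == beta.
  rewrite -(eqP (valP gamma)); apply/eqP.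
  have [t0|noI] := pickP 'I_n; last by rewrite !big_pred0.
  transitivity (\sum_(j <- s) sroot D (gamma j)).
    rewrite [RHS](big_nth t0) sz big_mkord; apply: eq_bigr => t _.
    by rewrite ffunE (set_nth_default t0) ?sz.
  by rewrite (perm_big _ e) big_enum.
pose nu : Iseq n beta := exist _ f fP.
exists nu; have [t0 _|noI] := pickP 'I_n; last first.
  have n0 : n = 0%N by apply: etrans (esym (card_ord n)) _; apply: eq_card0.
  by rewrite (size0nil (etrans (size_word_of nu) n0)) (size0nil (etrans sz n0)).
apply: (@eq_from_nth _ t0); rewrite size_word_of ?sz // => m mn.
rewrite (nth_word_of _ t0 (Ordinal mn)); apply: (@letter_inj gamma).
by rewrite rkE /letter ffunE (set_nth_default t0) ?sz.
Qed.

End Letters.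

(** * Exchanging neighbours in a word *)

Section Crossings.
Variables (I : finType) (D : cartan_datum I) (n : nat) (beta : wlat D).
Variables (gamma : Iseq n beta) (gamma_inj : injective gamma).
Implicit Types (nu mu : Iseq n beta).
Notation rk := (rk gamma).
Notation pos := (pos gamma_inj).
Notation word_of := (word_of gamma).

Lemma sactE m nu t : sact m nu t = nu (sperm m t).
Proof. by rewrite /sact /letter ffunE. Qed.

Lemma sactK m : involutive (sact m : Iseq n beta -> Iseq n beta).
Proof. by move=> nu; apply/val_inj/ffunP => t; rewrite -/(letter _ t) !sactE tpermK. Qed.

Lemma rk_sact m nu t : rk (sact m nu) t = rk nu (sperm m t).
Proof.
by apply: (letter_inj gamma_inj (nu := gamma)); rewrite rkE sactE rkE.
Qed.

Lemma pos_sact m nu j : pos (sact m nu) j = sperm m (pos nu j).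
Proof.
by apply: (rk_inj gamma_inj (nu := sact m nu)); rewrite posK rk_sact tpermK posK.
Qed.

Lemma lo_neq_hi (m : 'I_n.-1) : lo m != hi m.
Proof. by rewrite -val_eqE /= ltn_eqF. Qed.

Lemma word_swap nu s a b t : word_of nu = s ++ [:: a, b & t] -> exists m,
  [/\ rk nu (lo m) = a, rk nu (hi m) = b & word_of (sact m nu) = s ++ [:: b, a & t]].
Proof.
move=> e; have sz : (size s + (size t).+2 = n)%N.
  by have := size_word_of gamma nu; rewrite e size_cat.
have sm : (size s < n.-1)%N by move: sz; lia.
pose m : 'I_n.-1 := Ordinal sm; exists m.
have rkw nu' (j : 'I_n) : rk nu' j = nth a (word_of nu') j by rewrite nth_word_of.
have rlo : rk nu (lo m) = a by rewrite rkw e nth_cat ltnn subnn.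
have rhi : rk nu (hi m) = b by rewrite rkw e nth_cat ltnNge leqnSn /= subSnn.
split=> //; apply: (@eq_from_nth _ a); first by rewrite size_word_of size_cat.
rewrite size_word_of => j jn; rewrite -(rkw _ (Ordinal jn)) rk_sact /sperm.
case: tpermP => [/(congr1 val) /= ->|/(congr1 val) /= ->|/eqP jl /eqP jh].
- by rewrite rhi nth_cat ltnn subnn.
- by rewrite rlo nth_cat ltnNge leqnSn /= subSnn.
rewrite rkw e !nth_cat /=; case: ltnP => // le_j.
move: jl jh; rewrite -!val_eqE /= => jl jh.
by case E : (j - size s)%N => [|[|r]] //; move: jl jh E; lia.
Qed.

End Crossings.

(** * Generators and relations for distinct letters *)

Lemma kalg_linM (k : pzRingType) (A : kalg k) (c : k) (u v w : A) :
  (c *: u + v) * w = c *: (u * w) + v * w.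
Proof. by rewrite mulrDl kalg_scalerAl. Qed.

Lemma kalg_Mlin (k : pzRingType) (A : kalg k) (c : k) (u v w : A) :
  w * (c *: u + v) = c *: (w * u) + w * v.
Proof. by rewrite mulrDr kalg_scalerAr. Qed.

Section FreeAlgebra.
Variables (k : fieldType) (G : choiceType).
Notation F := (free_alg k G).

Lemma malg_scaleE (c : k) (f : {malg k[{fmonom G}]}) : c *: f = c *: (f : F).
Proof. by rewrite -[LHS]mulr_algl. Qed.

Lemma free_alg_ind (P : F -> Prop) : P 0 ->
  (forall c (w : {fmonom G}) (z : F), P z -> P (c *: (<< w >> : F) + z)) ->
  forall z, P z.
Proof.
move=> P0 PD; apply: malg_ind => // c w z Pz.
by rewrite malg_scaleE; apply: PD.
Qed.

Lemma free_monomM (w w' : {fmonom G}) : << w >> * << w' >> = << mmul w w' >> :> F.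
Proof. by apply: etrans (fgmulUU 1 1 w w') _; rewrite mulr1. Qed.

Lemma fvar_cons g (w : seq G) :
  << FMonom (g :: w) >> = fvar k g * (<< FMonom w >> : F).
Proof.
by rewrite /fvar free_monomM; congr << _ >>; rewrite /mmul /= fmmulE fmuE.
Qed.

End FreeAlgebra.

(** Reduces identities of the algebra to identities on each single word nu. *)
Lemma eq_on_idempotents (R : pzRingType) (T : finType) (e : T -> R) (a b : R) :
  \sum_i e i = 1 -> (forall i, a * e i = b * e i) -> a = b.
Proof.
move=> e1 ab; rewrite -[a]mulr1 -[b]mulr1 -e1 !mulr_sumr.
by apply: eq_bigr => i _; apply: ab.
Qed.

Lemma qeval_morph (k : fieldType) (A B : kalg k) (f : {rmorphism A -> B})
    (fZ : scalable f) (P : {poly {poly k}}) (u v : A) :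
  f (qeval P u v) = qeval P (f u) (f v).
Proof.
rewrite /qeval rmorph_sum; apply: eq_bigr => q _.
rewrite rmorph_sum; apply: eq_bigr => p _.
by rewrite fZ rmorphM !rmorphXn.
Qed.

Section Relations.
Variables (I : finType) (D : cartan_datum I) (k : fieldType) (Q : klr_poly D k).
Variables (n : nat) (beta : wlat D).
Variables (gamma : Iseq n beta) (gamma_inj : injective gamma).
Implicit Types (nu mu : Iseq n beta).
Notation rk := (rk gamma).
Notation pos := (pos gamma_inj).
Notation F := (free_alg k (klr_gen n beta)).
Notation K := (klr Q n beta).
Notation pi := (@klr_pi I D k Q n beta).
Notation e := (klr_e Q).
Notation x := (@klr_x I D k Q n beta).
Notation tau := (@klr_tau I D k Q n beta).

HB.instance Definition _ := GRing.RMorphism.on (pi : F -> K).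

Lemma klr_piZ : scalable (pi : F -> K).
Proof. exact: aproj_scalable. Qed.

Lemma klr_pi_lin c (a b : F) : pi (c *: a + b) = c *: pi a + pi b.
Proof. exact: (linearP (aproj _ : {linear F -> K})). Qed.

Lemma klr_piM (a b : F) : pi (a * b) = pi a * pi b. Proof. exact: rmorphM. Qed.
Lemma piB (a b : F) : pi (a - b) = pi a - pi b. Proof. exact: rmorphB. Qed.

Notation fe nu := (fvar k (Idem nu) : F).
Notation fx l := (fvar k (Defs.Dot beta l) : F).
Notation ft m := (fvar k (@Cross I D n beta m) : F).

Lemma e_mul nu mu : e nu * e mu = if nu == mu then e nu else 0.
Proof.
apply: etrans (esym (klr_piM _ _)) (etrans (klr_pi_rel (@rel_ee _ _ _ Q n beta nu mu)) _).
by case: eqP => // _; apply: rmorph0.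
Qed.

Lemma sum_e : \sum_(nu : Iseq n beta) e nu = 1 :> K.
Proof.
apply: etrans (esym (rmorph_sum pi _ _ _)) (etrans (klr_pi_rel _) (rmorph1 pi)).
exact: rel_e1.
Qed.

Lemma eq_on_klr_e (a b : K) : (forall nu, a * e nu = b * e nu) -> a = b.
Proof. exact: eq_on_idempotents sum_e. Qed.

Lemma x_comm l l' : x l * x l' = x l' * x l.
Proof.
exact: etrans (esym (klr_piM _ _)) (etrans (klr_pi_rel (@rel_xx _ _ _ Q n beta l l')) (klr_piM _ _)).
Qed.

Lemma x_e l nu : x l * e nu = e nu * x l.
Proof.
exact: etrans (esym (klr_piM _ _)) (etrans (klr_pi_rel (@rel_xe _ _ _ Q n beta l nu)) (klr_piM _ _)).
Qed.

Lemma tau_e m nu : tau m * e nu = e (sact m nu) * tau m.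
Proof.
exact: etrans (esym (klr_piM _ _)) (etrans (klr_pi_rel (@rel_te _ _ _ Q n beta m nu)) (klr_piM _ _)).
Qed.

Lemma tau_far (m m' : 'I_n.-1) : (m.+1 < m')%N || (m'.+1 < m)%N ->
  tau m * tau m' = tau m' * tau m.
Proof.
move=> /(@rel_tt _ _ _ Q n beta) /klr_pi_rel h.
exact: etrans (esym (klr_piM _ _)) (etrans h (klr_piM _ _)).
Qed.

Lemma tau_sq m nu : tau m * tau m * e nu =
  qeval (Defs.qpoly Q (nu (lo m)) (nu (hi m))) (x (lo m)) (x (hi m)) * e nu.
Proof.
rewrite -[LHS](etrans (klr_piM (ft m * ft m) (fe nu)) (congr1 (fun z => z * _) (klr_piM _ _))).
apply: etrans (klr_pi_rel (@rel_t2 _ _ _ Q n beta m nu)) (etrans (klr_piM _ _) _).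
by congr (_ * _); apply: (qeval_morph klr_piZ).
Qed.

(** The right-hand side of the defining relation vanishes on words without
    repeated letters; the same happens for the braid relation. *)
Lemma tau_x m l : tau m * x l = x (sperm m l) * tau m.
Proof.
apply: eq_on_klr_e => nu; apply: subr0_eq; rewrite -mulrBl.
have := klr_pi_rel (@rel_tx _ _ _ Q n beta m l nu).
have -> : nu (lo m) != nu (hi m).
  by rewrite (inj_eq (letter_inj gamma_inj (nu := nu))) lo_neq_hi.
move=> h; apply: etrans (etrans (esym _) h) (rmorph0 pi).
apply: etrans (klr_piM _ _) _; congr (_ * _).
apply: etrans (piB (ft m * fx l) (fx (sperm m l) * ft m)) _.
exact: (f_equal2 (fun a b : K => a - b) (klr_piM (ft m) (fx l)) (klr_piM (fx (sperm m l)) (ft m))).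
Qed.

Lemma tau_braid (m m' : 'I_n.-1) : m' = m.+1 :> nat ->
  tau m' * tau m * tau m' = tau m * tau m' * tau m.
Proof.
move=> mm'; apply: eq_on_klr_e => nu; apply: subr0_eq; rewrite -mulrBl.
have := klr_pi_rel (@rel_braid _ _ _ Q n beta m m' nu mm').
have /negbTE -> : nu (lo m) != nu (hi m').
  by rewrite (inj_eq (letter_inj gamma_inj (nu := nu))) -val_eqE /= mm' ltn_eqF // ltnW.
move=> h; apply: etrans (etrans (esym _) h) (rmorph0 pi).
apply: etrans (klr_piM _ _) _; congr (_ * _).
have pi3 (a b c : F) : pi (a * b * c) = pi a * pi b * pi c.
  exact: etrans (klr_piM _ _) (congr1 (fun z => z * _) (klr_piM _ _)).
apply: etrans (piB (ft m' * ft m * ft m') (ft m * ft m' * ft m)) _.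
exact: (f_equal2 (fun a b : K => a - b) (pi3 (ft m') (ft m) (ft m')) (pi3 (ft m) (ft m') (ft m))).
Qed.

Lemma klr_ind (P : K -> Prop) : P 0 -> P 1 ->
  (forall c a b, P a -> P b -> P (c *: a + b)) ->
  (forall nu a, P a -> P (e nu * a)) -> (forall l a, P a -> P (x l * a)) ->
  (forall m a, P a -> P (tau m * a)) -> forall a, P a.
Proof.
move=> P0 P1 PD Pe Px Pt a; have [f ->] := aproj_surj a.
rewrite -[aproj _ _]/(pi f); elim/free_alg_ind: f => [|c w f IH].
  by rewrite (rmorph0 pi).
rewrite klr_pi_lin; apply: PD => // {IH f}.
case: w => w; elim: w => [|g w IH].
  have -> : << FMonom [::] >> = 1 :> F by rewrite -fmoneE.
  by rewrite (rmorph1 pi).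
rewrite fvar_cons klr_piM.
case: g => [nu|l|m]; [exact: Pe | exact: Px | exact: Pt].
Qed.

End Relations.

(** * Central dots and normal forms *)

Section CommutingProducts.
Variables (R : pzRingType) (T : eqType) (G : T -> R).
Hypothesis G_comm : forall i j, GRing.comm (G i) (G j).

Lemma comm_prod_perm (r s : seq T) : perm_eq r s ->
  \prod_(i <- r) G i = \prod_(i <- s) G i.
Proof.
elim: r s => [|i r IH] s rs; first by move: rs; rewrite perm_sym => /perm_nilP ->.
have is_ : i \in s by rewrite -(perm_mem rs) mem_head.
case/splitPr: is_ rs => s1 s2 rs.
have /IH e : perm_eq r (s1 ++ s2).
  by rewrite -(perm_cons i) (permPl rs) -cat1s perm_catCA.
rewrite big_cons e !big_cat /= big_cons mulrA [RHS]mulrA; congr (_ * _).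
by apply: commr_prod => j _; apply: G_comm.
Qed.

End CommutingProducts.

Section Presented.
Variables (I : finType) (D : cartan_datum I) (k : fieldType) (Q : klr_poly D k).
Variables (n : nat) (beta : wlat D).

(** What the computations use of the algebra: the relations in the form that
    they take for distinct letters, and generation, as an induction principle.
    Working with an arbitrary ring of this kind keeps the quotient construction
    out of the calculations. *)
Record presented (A : kalg k) := Presented {
  pe : Iseq n beta -> A;
  px : 'I_n -> A;
  pt : 'I_n.-1 -> A;
  pe_mul : forall nu mu, pe nu * pe mu = if nu == mu then pe nu else 0;
  pe_sum : \sum_nu pe nu = 1;
  px_comm : forall l l', px l * px l' = px l' * px l;
  px_e : forall l nu, px l * pe nu = pe nu * px l;
  pt_e : forall m nu, pt m * pe nu = pe (sact m nu) * pt m;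
  pt_far : forall m m' : 'I_n.-1, (m.+1 < m')%N -> pt m * pt m' = pt m' * pt m;
  pt_sq : forall m nu, pt m * pt m * pe nu =
    qeval (Defs.qpoly Q (nu (lo m)) (nu (hi m))) (px (lo m)) (px (hi m)) * pe nu;
  pt_x : forall m l, pt m * px l = px (sperm m l) * pt m;
  pt_braid : forall m m' : 'I_n.-1, m' = m.+1 :> nat ->
    pt m' * pt m * pt m' = pt m * pt m' * pt m;
  p_ind : forall P : A -> Prop, P 0 -> P 1 ->
    (forall c a b, P a -> P b -> P (c *: a + b)) ->
    (forall nu a, P a -> P (pe nu * a)) -> (forall l a, P a -> P (px l * a)) ->
    (forall m a, P a -> P (pt m * a)) -> forall a, P a
}.

Definition klr_presented (gamma : Iseq n beta) (gamma_inj : injective gamma) :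
  presented (klr Q n beta) :=
  Presented (@e_mul _ _ _ Q n beta) (@sum_e _ _ _ Q n beta)
    (@x_comm _ _ _ Q n beta) (@x_e _ _ _ Q n beta)
    (@tau_e _ _ _ Q n beta)
    (fun m m' h => @tau_far _ _ _ Q n beta m m' (introT orP (or_introl h)))
    (@tau_sq _ _ _ Q n beta) (@tau_x _ _ _ Q n beta _ gamma_inj)
    (@tau_braid _ _ _ Q n beta _ gamma_inj) (@klr_ind _ _ _ Q n beta).

End Presented.

Section Centre.
Variables (I : finType) (D : cartan_datum I) (k : fieldType) (Q : klr_poly D k).
Variables (n : nat) (beta : wlat D).
Variables (gamma : Iseq n beta) (gamma_inj : injective gamma).
Variables (K : kalg k) (pK : presented Q n beta K).
Implicit Types (nu mu : Iseq n beta) (a : 'I_n -> nat).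
Notation rk := (rk gamma).
Notation pos := (pos gamma_inj).
Notation e := (pe pK).
Notation x := (px pK).
Notation tau := (pt pK).

Lemma e_idem nu : e nu * e nu = e nu. Proof. by rewrite pe_mul eqxx. Qed.

Lemma eq_on_e (u v : K) : (forall nu, u * e nu = v * e nu) -> u = v.
Proof. exact: eq_on_idempotents (pe_sum pK). Qed.

(** The dot attached to a letter instead of a position. *)
Definition letter_dot (j : 'I_n) : K := \sum_(nu : Iseq n beta) x (pos nu j) * e nu.

Notation y := letter_dot.

Lemma y_e j nu : y j * e nu = x (pos nu j) * e nu.
Proof.
rewrite /letter_dot mulr_suml (bigD1 nu) //= big1 ?addr0 -?mulrA ?e_idem // => mu ne.
by rewrite -mulrA pe_mul (negbTE ne) mulr0.
Qed.

Lemma x_e_y l nu : x l * e nu = y (rk nu l) * e nu.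
Proof. by rewrite y_e rkK. Qed.

(** A crossing moves the strand of j and its dot together, and no error term
    arises. *)
Lemma y_central j (z : K) : GRing.comm (y j) z.
Proof.
have ye nu : GRing.comm (y j) (e nu).
  rewrite /GRing.comm y_e /letter_dot mulr_sumr (bigD1 nu) //= big1 ?addr0 => [|mu ne].
    by rewrite mulrA -px_e -mulrA e_idem.
  by rewrite mulrA -px_e -mulrA pe_mul eq_sym (negbTE ne) mulr0.
apply: (@p_ind _ _ _ _ _ _ _ pK (fun z => GRing.comm (y j) z)) => {z}.
- exact: commr0.
- exact: commr1.
- by move=> c u v uy vy; rewrite /GRing.comm mulrDr mulrDl -kalg_scalerAr -kalg_scalerAl uy vy.
- by move=> nu z; apply: commrM.
- move=> l z; apply: commrM; apply: eq_on_e => nu.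
  rewrite -mulrA px_e mulrA y_e -!mulrA -px_e [RHS]mulrA.
  by rewrite -[in RHS]mulrA y_e [in RHS]mulrA px_comm -mulrA.
- move=> m z; apply: commrM; apply: eq_on_e => nu.
  rewrite -mulrA pt_e mulrA y_e -[LHS]mulrA -pt_e pos_sact mulrA -pt_x.
  by rewrite -mulrA -y_e mulrA.
Qed.

Definition mono a : K := \prod_(j < n) y j ^+ a j.

Lemma mono_central a z : GRing.comm (mono a) z.
Proof.
by apply/commr_sym/commr_prod => j _; apply/commrX/commr_sym/y_central.
Qed.

Lemma mono0 : mono (fun=> 0%N) = 1.
Proof. by rewrite /mono big1 // => j _; rewrite expr0. Qed.

Lemma monoM a b : mono a * mono b = mono (fun j => a j + b j)%N.
Proof.
rewrite /mono; elim: (index_enum _) => [|j r IH]; first by rewrite !big_nil mul1r.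
rewrite !big_cons -IH exprD -!mulrA; congr (_ * _); rewrite !mulrA; congr (_ * _).
apply/esym/commr_prod => l _; exact/commrX/commr_sym/commrX/y_central.
Qed.

Lemma mono_set_exp j d a : mono (set_exp j (a j + d)%N a) = y j ^+ d * mono a.
Proof.
rewrite /mono; have := index_enum_uniq 'I_n; have := mem_index_enum j.
elim: (index_enum _) => // l r IH; rewrite inE => /predU1P[<- /andP[jr _]|jr /andP[lr ur]].
  rewrite !big_cons mulrA -exprD addnC {1}/set_exp eqxx; congr (_ * _).
  apply: eq_big_seq => t tr; rewrite /set_exp; case: eqP => // tj.
  by rewrite -tj tr in jr.
rewrite !big_cons IH // !mulrA {1}/set_exp.
have -> : (l == j) = false by apply: contraNF lr => /eqP ->.
by congr (_ * _); apply/commrX/commr_sym/commrX/y_central.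
Qed.

Lemma x_pow_e d l nu : x l ^+ d * e nu = y (rk nu l) ^+ d * e nu.
Proof.
elim: d => // d IHd; rewrite exprS -mulrA IHd.
have c : GRing.comm (y (rk nu l) ^+ d) (e nu).
  exact/commr_sym/commrX/commr_sym/y_central.
by rewrite c mulrA x_e_y -mulrA -c mulrA -exprS.
Qed.

Lemma prod_x_e a nu : (\prod_(t < n) x t ^+ a t) * e nu = mono (a \o pos nu) * e nu.
Proof.
have main (r : seq 'I_n) : (\prod_(t <- r) x t ^+ a t) * e nu =
    (\prod_(t <- r) y (rk nu t) ^+ a t) * e nu.
  elim: r => [|t r IH]; first by rewrite !big_nil.
  rewrite !big_cons -mulrA IH.
  have c : GRing.comm (e nu) (\prod_(j <- r) y (rk nu j) ^+ a j).
    by apply: commr_prod => j _; apply/commrX/commr_sym/y_central.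
  by rewrite -c mulrA x_pow_e -!mulrA c.
rewrite main; congr (_ * _); rewrite /mono.
transitivity (\prod_(j <- map (rk nu) (index_enum 'I_n)) y j ^+ (a \o pos nu) j).
  by rewrite big_map; apply: eq_bigr => t _; rewrite /= rkK.
apply: comm_prod_perm => [j l|]; first exact/commrX/commr_sym/commrX/y_central.
apply: uniq_perm; rewrite ?index_enum_uniq //.
  by rewrite map_inj_uniq ?index_enum_uniq //; apply: rk_inj.
move=> j; rewrite mem_index_enum; apply/mapP.
by exists (pos nu j); rewrite ?mem_index_enum ?posK.
Qed.

(** Crossings indexed by natural numbers, zero out of range, so that products
    of crossings are given by plain sequences of numbers. *)
Definition tn (m : nat) : K := oapp tau 0 (insub m).
Definition taus (w : seq nat) : K := \prod_(m <- w) tn m.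
Definition sn (m : nat) nu : Iseq n beta := oapp (fun m' => sact m' nu) nu (insub m).
Definition acts (w : seq nat) nu : Iseq n beta := foldr sn nu w.

Lemma tnE (m : 'I_n.-1) : tn m = tau m.
Proof. by rewrite /tn valK. Qed.

Lemma tn_e m nu : tn m * e nu = e (sn m nu) * tn m.
Proof.
by rewrite /tn /sn; case: insubP => [m' _ _|_] /=; rewrite ?pt_e ?mul0r ?mulr0.
Qed.

Lemma tn_far m m' : (m.+1 < m')%N -> tn m * tn m' = tn m' * tn m.
Proof.
rewrite /tn; case: insubP => [l _ <-|_]; case: insubP => [l' _ <-|_] h /=.
all: rewrite ?mul0r ?mulr0 //.
exact: pt_far.
Qed.

Lemma tn_braid m : tn m.+1 * tn m * tn m.+1 = tn m * tn m.+1 * tn m.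
Proof.
rewrite /tn; case: (insubP _ m.+1) => [l' _ e'|_] /=; last by rewrite !(mul0r, mulr0).
case: insubP => [l _ el|_] /=; last by rewrite !(mul0r, mulr0).
by apply: pt_braid; rewrite el.
Qed.

Lemma taus_cat w w' : taus (w ++ w') = taus w * taus w'.
Proof. by rewrite /taus big_cat. Qed.

Lemma taus_cons m w : taus (m :: w) = tn m * taus w.
Proof. by rewrite /taus big_cons. Qed.

Lemma taus_e w nu : taus w * e nu = e (acts w nu) * taus w.
Proof.
elim: w => [|m w IH]; first by rewrite /taus big_nil mul1r mulr1.
by rewrite taus_cons -mulrA IH mulrA tn_e -mulrA.
Qed.

Lemma tn_taus_far m w : {in w, forall l, (m.+1 < l)%N || (l.+1 < m)%N} ->
  tn m * taus w = taus w * tn m.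
Proof.
move=> far; rewrite /taus big_seq; apply: commr_prod => l lw.
by case/orP: (far l lw) => h; [apply: tn_far | apply/esym/tn_far].
Qed.

(** One reduced word for each permutation of the positions 0, .., j: an
    increasing run i, .., j - 1 followed by a normal form on the positions
    below j. *)
Inductive nf : nat -> seq nat -> Prop :=
| nf0 : nf 0 [::]
| nfS j i w of (i <= j.+1)%N & nf j w : nf j.+1 (iota i (j.+1 - i) ++ w).

Definition normal_span j nu : K -> Prop :=
  Defs.span (fun z => exists a w, nf j w /\ z = mono a * (taus w * e nu)).

Lemma nf_nil j : nf j [::].
Proof.
by elim: j => [|j IH]; [exact: nf0 | have := nfS (leqnn j.+1) IH; rewrite subnn].
Qed.

Lemma nspan_gen j nu w : nf j w -> normal_span j nu (taus w * e nu).
Proof.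
move=> nw; apply: span_gen; exists (fun=> 0%N), w; split=> //.
by rewrite mono0 mul1r.
Qed.

(** Linear maps that commute with the central monomials need only be examined
    on the normal forms. *)
Lemma nspan_lin j j' nu (f : K -> K) :
  (forall c u v, f (c *: u + v) = c *: f u + f v) ->
  (forall a u, f (mono a * u) = mono a * f u) ->
  (forall w, nf j w -> normal_span j' nu (f (taus w * e nu))) ->
  forall z, normal_span j nu z -> normal_span j' nu (f z).
Proof.
move=> flin fmono fw z; have f0 : f 0 = 0.
  by have := flin (-1) 0 0; rewrite scaler0 addr0 scaleN1r addNr.
have monoL a u : normal_span j' nu u -> normal_span j' nu (mono a * u).
  elim=> [|c v u' [b [w [nw ->]]] _ IH]; first by rewrite mulr0; apply: Defs.span0.
  rewrite mulrDr -kalg_scalerAr; apply: Defs.span_cons; last exact: IH.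
  have -> : mono a * (mono b * (taus w * e nu)) =
      mono (fun j => a j + b j)%N * (taus w * e nu) by rewrite -monoM mulrA.
  by exists (fun j => a j + b j)%N, w.
elim=> [|c _ v [a [w [nw ->]]] _ IH]; first by rewrite f0; apply: Defs.span0.
rewrite flin; apply: spanD IH; apply: spanZ.
by rewrite fmono; apply: monoL; apply: fw.
Qed.

Lemma nspan_y j nu l z : normal_span j nu z -> normal_span j nu (y l * z).
Proof.
apply: (@nspan_lin j j nu (fun u => y l * u)) => [c u v|a u|w nw].
- by rewrite mulrDr -kalg_scalerAr.
- by rewrite !mulrA y_central.
- apply: span_gen; exists (set_exp l 1 (fun=> 0%N)), w; split=> //.
  have := mono_set_exp l 1 (fun=> 0%N); rewrite add0n mono0 mulr1 expr1 => ->.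
  by [].
Qed.

Lemma nspan_qeval j nu P l l' z : normal_span j nu z ->
  normal_span j nu (qeval P (y l) (y l') * z).
Proof.
have pow d l0 u : normal_span j nu u -> normal_span j nu (y l0 ^+ d * u).
  by elim: d => [|d IH] Lu; rewrite ?mul1r // exprS -mulrA; apply/nspan_y/IH.
move=> Lz; rewrite /qeval mulr_suml.
elim/big_rec: _ => [|q u _ Lu]; first exact: Defs.span0.
apply: spanD => //; rewrite mulr_suml.
elim/big_rec: _ => [|p v _ Lv]; first exact: Defs.span0.
apply: spanD => //; rewrite -kalg_scalerAl; apply: spanZ.
by rewrite -mulrA; apply/pow/pow.
Qed.

Lemma qeval_x_y P l l' nu : qeval P (x l) (x l') * e nu =
  qeval P (y (rk nu l)) (y (rk nu l')) * e nu.
Proof.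
rewrite /qeval !mulr_suml; apply: eq_bigr => q _.
rewrite !mulr_suml; apply: eq_bigr => p _; rewrite -!kalg_scalerAl; congr (_ *: _).
rewrite -mulrA x_pow_e.
have c : GRing.comm (y (rk nu l') ^+ q) (e nu).
  exact/commr_sym/commrX/commr_sym/y_central.
by rewrite c mulrA x_pow_e -mulrA -c mulrA.
Qed.

Lemma pt_sq_y m nu : tau m * tau m * e nu =
  qeval (Defs.qpoly Q (nu (lo m)) (nu (hi m))) (y (rk nu (lo m))) (y (rk nu (hi m))) * e nu.
Proof. by rewrite pt_sq qeval_x_y. Qed.

Lemma nspan_tn_sq j nu m w : normal_span j nu (taus w * e nu) ->
  normal_span j nu (tn m * (tn m * (taus w * e nu))).
Proof.
move=> Lw; rewrite mulrA taus_e /tn; case: insubP => [m' _ _|_] /=; last first.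
  by rewrite !mul0r; apply: Defs.span0.
by rewrite mulrA pt_sq_y -mulrA -taus_e; apply: nspan_qeval.
Qed.

Lemma nspan_run j nu i z : (i <= j.+1)%N -> normal_span j nu z ->
  normal_span j.+1 nu (taus (iota i (j.+1 - i)) * z).
Proof.
move=> ij; apply: (nspan_lin (f := fun u => taus _ * u)) => [c u v|a u|w nw].
- by rewrite mulrDr -kalg_scalerAr.
- by rewrite !mulrA -mono_central.
- by rewrite mulrA -taus_cat; apply/nspan_gen/nfS.
Qed.

(** The crossing m meets the run i, .., j at the head of a normal form. For m +
    1 < i it commutes past the run, for m + 1 = i it lengthens the run, for m =
    i it meets itself and the quadratic relation makes it a central polynomial,
    and for m > i it travels through the run by one braid move and comes out as
    m - 1; what then remains is a smaller crossing before a shorter normal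
    form. *)
Lemma nspan_tn j nu m z : (m < j)%N -> normal_span j nu z ->
  normal_span j nu (tn m * z).
Proof.
elim: j m z => // j IH m z; rewrite ltnS => mj.
apply: (nspan_lin (f := fun u => tn m * u)) => [c u v|a u|w nw].
- by rewrite mulrDr -kalg_scalerAr.
- by rewrite !mulrA -mono_central.
inversion nw as [|j' i w' ij nw' [ej] ew]; subst j'.
have Lw' := nspan_gen nu nw'.
have [lt_mi|le_im] := ltnP m i.
  have [mi|mi] := ltnP m.+1 i.
    rewrite taus_cat !mulrA tn_taus_far => [|l]; last first.
      by rewrite mem_iota => /andP[il _]; rewrite (leq_trans mi il).
    rewrite -!mulrA; apply: nspan_run => //; apply: IH => //; move: ij; lia.
  have im : i = m.+1 by apply/eqP; rewrite eqn_leq mi lt_mi.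
  rewrite taus_cat !mulrA -taus_cons -mulrA im subSS -[m :: _]/(iota m (j - m).+1) -subSn //.
  by apply: nspan_run => //; apply: leqW.
have [->|ne_mi] := eqVneq m i.
  have ij' : (i <= j)%N := leq_trans le_im mj.
  rewrite subSn // /= taus_cons -mulrA; apply: nspan_tn_sq.
  rewrite taus_cat -mulrA -[(j - i)%N]/(j.+1 - i.+1)%N.
  exact: nspan_run.
have lt_im : (i < m)%N by rewrite ltn_neqAle eq_sym ne_mi.
case: m => // m in mj le_im ne_mi lt_im *.
have iotaE : iota i (j.+1 - i) = iota i (m - i) ++ [:: m; m.+1] ++ iota m.+2 (j.+1 - m.+2).
  have -> : (j.+1 - i)%N = (m - i + (2 + (j.+1 - m.+2)))%N by move: mj lt_im; lia.
  rewrite iotaD iotaD; congr (_ ++ _); rewrite subnKC //.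
  by rewrite addn2.
rewrite iotaE -!catA !taus_cat !mulrA tn_taus_far => [|l]; last first.
  by rewrite mem_iota => /andP[_ l_lt]; apply/orP; right; move: l_lt lt_im; lia.
have two : taus [:: m; m.+1] = tn m * tn m.+1.
  by rewrite !taus_cons /taus big_nil mulr1.
rewrite two -[taus _ * tn m.+1 * _]mulrA [tn m.+1 * (_ * _)]mulrA tn_braid.
rewrite -!mulrA [tn m * (taus _ * _)]mulrA tn_taus_far => [|l]; last first.
  by rewrite mem_iota => /andP[-> _].
have -> : taus (iota i (m - i)) * (tn m * (tn m.+1 * (taus (iota m.+2 (j.+1 - m.+2)) * tn m *
    (taus w' * e nu)))) = taus (iota i (j.+1 - i)) * (tn m * (taus w' * e nu)).
  by rewrite iotaE !taus_cat two !mulrA.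
by apply: nspan_run => //; apply: IH.
Qed.

Lemma nspan_all nu z : normal_span n.-1 nu (z * e nu).
Proof.
move: nu; apply: (@p_ind _ _ _ _ _ _ _ pK
  (fun z => forall nu, normal_span n.-1 nu (z * e nu))) => {z}.
- by move=> nu; rewrite mul0r; apply: Defs.span0.
- by move=> nu; have := nspan_gen nu (nf_nil n.-1); rewrite /taus big_nil.
- by move=> c u v Lu Lv nu; rewrite mulrDl -kalg_scalerAl; apply: spanD (spanZ _ (Lu _)) (Lv _).
- move=> mu z Lz nu; rewrite -mulrA; move: (z * _) (Lz nu).
  apply: (nspan_lin (f := fun u => e mu * u)) => [c u v|a u|w nw].
  + by rewrite mulrDr -kalg_scalerAr.
  + by rewrite !mulrA -mono_central.
  rewrite taus_e mulrA pe_mul; case: eqP => [->|_]; last by rewrite mul0r; apply: Defs.span0.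
  by rewrite -taus_e; apply: nspan_gen.
- move=> l z Lz nu; rewrite -mulrA; move: (z * _) (Lz nu).
  apply: (nspan_lin (f := fun u => x l * u)) => [c u v|a u|w nw].
  + by rewrite mulrDr -kalg_scalerAr.
  + by rewrite !mulrA -mono_central.
  rewrite taus_e mulrA x_e_y -mulrA -taus_e; apply/nspan_y/nspan_gen/nw.
- move=> m z Lz nu; rewrite -mulrA -tnE; apply: nspan_tn => //.
Qed.

End Centre.

(** * Traces live on the central polynomials *)

Section Trace.
Variables (I : finType) (D : cartan_datum I) (k : fieldType) (Q : klr_poly D k).
Variables (n : nat) (beta : wlat D).
Variables (gamma : Iseq n beta) (gamma_inj : injective gamma).
Variables (K : kalg k) (pK : presented Q n beta K).
Implicit Types (nu mu : Iseq n beta) (a : 'I_n -> nat).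
Notation rk := (rk gamma).
Notation e := (pe pK).
Notation mono := (mono gamma_inj pK).
Notation taus := (taus pK).

Lemma nf_lt j w : nf j w -> {in w, forall m, (m < j)%N}.
Proof.
elim=> // {}j i {}w ij nw IH m; rewrite mem_cat mem_iota => /orP[/andP[_]|/IH].
  by move: ij; lia.
exact: leqW.
Qed.

Lemma acts_out w nu (t : 'I_n) : {in w, forall m, (m.+1 < t)%N} -> acts w nu t = nu t.
Proof.
elim: w => // m w IH h /=; rewrite -IH => [|l lw]; last by apply: h; rewrite inE lw orbT.
have mt := h m (mem_head _ _); rewrite /sn; case: insubP => //= m' _ em.
by rewrite sactE /sperm tpermD // -val_eqE /= em ltn_eqF // ltnW.
Qed.

Lemma acts_run l nu (s t : 'I_n) : t = (s + l)%N :> nat -> acts (iota s l) nu s = nu t.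
Proof.
elim: l s => [|l IH] s ts.
  by congr (nu _); apply/val_inj; rewrite /= ts addn0.
have sn1 : (s < n.-1)%N by have := ltn_ord t; rewrite ts; lia.
rewrite /= /sn insubT /= sactE /sperm.
have slo : s = lo (Sub (s : nat) sn1) by apply: val_inj.
rewrite [X in tperm _ _ X]slo tpermL; apply: (IH (hi (Sub (s : nat) sn1))).
by rewrite /= ts addnS.
Qed.

(** The run i, .., j places at position i the letter of position j + 1. Letters
    being distinct, a normal form that fixes a word has an empty leading run,
    and one continues with the rest. *)
Lemma nf_acts_id j w nu : nf j w -> (j <= n.-1)%N -> acts w nu = nu -> w = [::].
Proof.
elim=> // {}j i {}w ij nw IH jn; rewrite [acts _ _]foldr_cat -!/(acts _ _) => act_id.
have tn : (j.+1 < n)%N by move: jn; case: (n) => // m; rewrite ltnS.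
have si : (i < n)%N := leq_ltn_trans ij tn.
have := @acts_run (j.+1 - i)%N (acts w nu) (Ordinal si) (Ordinal tn).
rewrite /= subnKC // => /(_ erefl); rewrite act_id acts_out; last first.
  by move=> m /(nf_lt nw); rewrite ltnS.
move/(letter_inj gamma_inj)/(congr1 val) => /= ei.
move: act_id; rewrite ei subnn /= => /IH -> //.
exact: ltnW.
Qed.

(** If the normal form w moves nu, then tau_w e(nu) = e(w.nu) tau_w e(nu) is a
    commutator because e(nu) e(w.nu) = 0, so f sees only the central monomials
    times idempotents. *)
Lemma tracial_span (X : lmodType k) (f : {linear K -> X}) (Y : X -> Prop) :
  Y 0 -> (forall c u v, Y u -> Y v -> Y (c *: u + v)) ->
  (forall u v, f (u * v) = f (v * u)) ->
  (forall a nu, Y (f (mono a * e nu))) -> forall z, Y (f z).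
Proof.
move=> Y0 YD ftr fY z; rewrite -[z]mulr1 -(pe_sum pK) mulr_sumr linear_sum.
elim/big_rec: _ => // nu v _ Yv; rewrite -[f _]scale1r; apply: (YD) _ Yv.
elim: (nspan_all gamma_inj pK nu z) => [|c _ v' [a [w [nw ->]]] _ IH].
  by rewrite linear0.
rewrite linearD linearZ; apply: (YD) _ IH.
have [act_id|moved] := eqVneq (acts w nu) nu.
  by rewrite (nf_acts_id nw (leqnn _) act_id) /taus big_nil mul1r.
rewrite -(e_idem pK nu) [taus w * _]mulrA mulrA ftr !mulrA -[e nu * _]mono_central.
rewrite -!mulrA taus_e [e nu * _]mulrA pe_mul eq_sym (negbTE moved) mul0r mulr0.
by rewrite linear0.
Qed.

End Trace.

(** * The crossing polynomials *)

Lemma poly2_sum_widen (k : fieldType) (V : lmodType k) (P : {poly {poly k}})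
    (G : nat -> nat -> V) N : (size P <= N)%N -> (forall q : nat, (size (P`_q)%R <= N)%N) ->
  \sum_(q < size P) \sum_(p < size P`_q) P`_q`_p *: G p q =
  \sum_(q < N) \sum_(p < N) P`_q`_p *: G p q.
Proof.
move=> sP sPq.
have inner (q : nat) : \sum_(p < size P`_q) P`_q`_p *: G p q = \sum_(p < N) P`_q`_p *: G p q.
  rewrite (big_ord_widen _ (fun p => P`_q`_p *: G p q) (sPq q)) big_mkcond /=.
  apply: eq_bigr => p _; case: ltnP => // le_p.
  by rewrite nth_default // scale0r.
under eq_bigr do rewrite inner.
rewrite (big_ord_widen _ (fun q => \sum_(p < N) P`_q`_p *: G p q) sP) big_mkcond /=.
apply: eq_bigr => q _; case: ltnP => // le_q.
by rewrite big1 // => p _; rewrite (nth_default _ le_q) coef0 scale0r.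
Qed.

Lemma scale_divK (k : fieldType) (A : lalgType k) (c : k) (u v : A) :
  c != 0 -> c *: ((c^-1 *: u) * v) = u * v.
Proof. by move=> c0; rewrite -scalerAl scalerA divff // scale1r. Qed.

Lemma sum_scaleMl (k : fieldType) (A : lalgType k) m (c : 'I_m -> k) (u : 'I_m -> A) v :
  \sum_i c i *: (u i * v) = (\sum_i c i *: u i) * v.
Proof. by rewrite mulr_suml; apply: eq_bigr => i _; rewrite scalerAl. Qed.

Section QPolynomials.
Variables (I : finType) (D : cartan_datum I) (k : fieldType) (Q : klr_poly D k).
Variables (n : nat) (beta : wlat D).
Variables (gamma : Iseq n beta) (gamma_inj : injective gamma).
Notation S := {malg k[{cmonom 'I_n}]}.
Notation QQ a b := (Defs.qpoly Q (gamma a) (gamma b)).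

Definition qS (a b : 'I_n) : S :=
  \sum_(q < size (QQ a b)) \sum_(p < size (QQ a b)`_q)
    (QQ a b)`_q`_p *: (var k a ^+ p * var k b ^+ q).

Definition qdeg (a b : 'I_n) : nat := `|cartan D (gamma a) (gamma b)|%N.

Lemma qS_free a b l : l != a -> l != b -> free_of l (qS a b).
Proof.
move=> la lb; apply: free_sum => q _; apply: free_sum => p _.
by apply/freeZ/freeM; apply/freeX/free_var.
Qed.

Lemma qS_sym a b : qS a b = qS b a.
Proof.
pose N := maxn (maxn (size (QQ a b)) (sizeY (QQ a b))) (maxn (size (QQ b a)) (sizeY (QQ b a))).
have bnd (P : {poly {poly k}}) (q : nat) : (size (P`_q)%R <= sizeY P)%N by apply: max_size_coefXY.
rewrite /qS (@poly2_sum_widen _ _ _ (fun p q => var k a ^+ p * var k b ^+ q) N); last 2 first.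
- by rewrite !leq_max leqnn.
- by move=> q; apply: leq_trans (bnd _ q) _; rewrite !leq_max leqnn orbT.
rewrite (@poly2_sum_widen _ _ _ (fun p q => var k b ^+ p * var k a ^+ q) N); last 2 first.
- by rewrite !leq_max leqnn !orbT.
- by move=> q; apply: leq_trans (bnd _ q) _; rewrite !leq_max leqnn !orbT.
rewrite [LHS]exchange_big; apply: eq_bigr => p _; apply: eq_bigr => q _.
have -> : (QQ b a)`_p`_q = (QQ a b)`_q`_p by rewrite qpoly_sym coef_swapXY.
by rewrite (mulrC (var k b ^+ q)).
Qed.

Lemma cartan_qdeg a b : a != b -> cartan D (gamma a) (gamma b) = - (qdeg a b)%:Z.
Proof.
by move=> ab; have := cartan_le0 D (contra_neq (@gamma_inj a b) ab); rewrite /qdeg; lia.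
Qed.

(** The homogeneity of Q_ij confines the exponents (p, q) of its monomials to a
    line, by symmetrizability the one through (0, d) and (d', 0) with d = -
    a_ji and d' = - a_ij. So the top monomial in either variable is a pure
    power, and its coefficient is the one required to be non-zero. *)
Lemma qpoly_top a b : a != b ->
  [/\ forall q, (qdeg a b < q)%N -> (QQ b a)`_q = 0,
      forall p, (0 < p)%N -> (QQ b a)`_(qdeg a b)`_p = 0
    & (QQ b a)`_(qdeg a b)`_0 != 0].
Proof.
move=> ab; have gab : gamma a != gamma b by rewrite (inj_eq gamma_inj).
have gba : gamma b != gamma a by rewrite eq_sym.
have dE := cartan_qdeg ab.
have rE : rform D (gamma b) (gamma a) = - ((symd D (gamma a))%:Z * (qdeg a b)%:Z).
  by rewrite /rform symd_sym dE mulrN.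
have d0 := symd_gt0 D (gamma a); have d0' := symd_gt0 D (gamma b).
have supp p q : (symd D (gamma b) * p + symd D (gamma a) * q)%N <>
    (symd D (gamma a) * qdeg a b)%N -> (QQ b a)`_q`_p = 0.
  move=> ne; apply: qpoly_supp => //; apply/eqP; rewrite rE /rform !cartan_diag.
  by move: ne; lia.
split=> [q lt_q|p p0|].
- apply/polyP => p; rewrite coef0; apply: supp.
  by move: lt_q d0; nia.
- by apply: supp; move: p0 d0'; nia.
- by rewrite qpoly_sym coef_swapXY; apply: qpoly_lead.
Qed.

Lemma qS_monic a b : a != b -> monic_in a (qdeg a b) (qS a b).
Proof.
move=> ab; have [top top0 lead] := qpoly_top ab.
set d := qdeg a b in top top0 lead *; set R := QQ b a in top top0 lead *.
pose c := R`_d`_0; pose h q : S := \sum_(p < size R`_q) R`_q`_p *: var k b ^+ p.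
have hd : h d = c *: 1.
  have : (0 < size (R`_d)%R)%N.
    by rewrite lt0n size_poly_eq0; apply: contraNneq lead => ->; rewrite coef0.
  rewrite /h; case: (size _) => // m _; rewrite big_ord_recl expr0 big1 ?addr0 // => j _.
  by rewrite top0 // scale0r.
have sR : size R = d.+1.
  apply/eqP; rewrite eqn_leq; apply/andP; split.
    by apply/leq_sizeP => q; apply: top.
  rewrite ltnNge; apply: contra lead => /leq_sizeP/(_ d (leqnn d)) ->.
  by rewrite coef0.
exists (\poly_(q < d.+1) (c^-1 *: h q)), c.
have hd1 : c^-1 *: h d = 1 by rewrite hd scalerA mulVf ?scale1r.
split.
- exact: lead.
- by rewrite monicE lead_coef_poly ?hd1 ?oner_eq0.
- by rewrite size_poly_eq ?hd1 ?oner_eq0.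
- move=> j; rewrite coef_poly; case: ifP => _; last exact: free0.
  by apply/freeZ/free_sum => p _; apply/freeZ/freeX/free_var.
- rewrite qS_sym horner_poly scaler_sumr /qS -/R sR; apply: eq_bigr => q _.
  exact: etrans (sum_scaleMl _ _ _) (esym (scale_divK _ _ lead)).
Qed.

Lemma qS_actE (X : lmodType k) a b (f : arr n X) m :
  (qS a b *: f) m =
  \sum_(q < size (QQ a b)) \sum_(p < size (QQ a b)`_q) (QQ a b)`_q`_p *:
     f (let m' := set_exp a (m a + p) m in set_exp b (m' b + q) m').
Proof.
rewrite scaler_suml arr_sumE; apply: eq_bigr => q _.
rewrite scaler_suml arr_sumE; apply: eq_bigr => p _.
by rewrite arrZE lextZ -arrZE -scalerA !arr_varXE.
Qed.

Lemma cyclotomic_determined (X : lmodType k) (p : 'I_n -> nat) :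
  determined qS qdeg X (enum 'I_n) (fun a => var k a ^+ p a) p.
Proof.
apply: functional_determined (enum_uniq _) _ _ => [||||l i _ _ il].
- exact: qS_free.
- exact: qS_sym.
- exact: qS_monic.
- by move=> l _; apply: monic_in_varX.
- exact/freeX/free_var.
Qed.

End QPolynomials.

(** * Monomials with small exponents span *)

Section Spanning.
Variables (I : finType) (D : cartan_datum I) (k : fieldType) (Q : klr_poly D k).
Variables (n : nat) (beta : wlat D).
Variables (gamma : Iseq n beta) (gamma_inj : injective gamma).
Variables (K : kalg k) (pK : presented Q n beta K).
Variables (X : lmodType k) (f : {linear K -> X}).
Hypothesis f_trace : forall u v, f (u * v) = f (v * u).
Implicit Types (nu mu : Iseq n beta) (m : 'I_n -> nat).
Notation rk := (rk gamma).
Notation word_of := (word_of gamma).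
Notation e := (pe pK).
Notation x := (px pK).
Notation tau := (pt pK).
Notation y := (letter_dot gamma_inj pK).
Notation mono := (mono gamma_inj pK).
Notation qS := (qS Q gamma).
Notation QQ a b := (Defs.qpoly Q (gamma a) (gamma b)).

(** The functional attached to a trace f: its array at a word records f on the
    central multiples of the idempotent. *)
Definition trace_fun (s : seq 'I_n) : arr n X := fun m =>
  if [pick nu | word_of nu == s] is Some nu then f (mono m * e nu) else 0.

Lemma trace_funE nu m : trace_fun (word_of nu) m = f (mono m * e nu).
Proof.
rewrite /trace_fun; case: pickP => [mu /eqP/word_of_inj -> //|/(_ nu)].
by rewrite eqxx.
Qed.

Lemma qS_trace_fun a b nu m : (qS a b *: trace_fun (word_of nu)) m =
  f (qeval (QQ a b) (y a) (y b) * (mono m * e nu)).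
Proof.
rewrite qS_actE /qeval mulr_suml linear_sum; apply: eq_bigr => q _.
rewrite mulr_suml linear_sum; apply: eq_bigr => p _.
rewrite /= trace_funE !mono_set_exp -kalg_scalerAl linearZ /=; congr (_ *: f _).
rewrite !mulrA; congr (_ * _ * _).
exact/commrX/commr_sym/commrX/y_central.
Qed.

(** The trace property turns tau tau e(nu) = tau e(r.nu) tau into tau tau
    e(r.nu). *)
Lemma trace_tau_sq nu m (r : 'I_n.-1) :
  f (mono m * (tau r * tau r * e nu)) = f (mono m * (tau r * tau r * e (sact r nu))).
Proof.
rewrite -[tau r * tau r * e nu]mulrA pt_e !mulrA f_trace; congr (f _).
by rewrite !mulrA -mono_central.
Qed.

Lemma trace_swap a b s t : perm_eq (s ++ [:: a, b & t]) (enum 'I_n) ->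
  qS a b *: trace_fun (s ++ [:: a, b & t]) = qS a b *: trace_fun (s ++ [:: b, a & t]).
Proof.
move=> st; apply: funext => m; have [nu nuE] := word_of_surj gamma_inj st.
have [r [rlo rhi swapE]] := word_swap gamma_inj nuE.
have sqE mu c d : rk mu (lo r) = c -> rk mu (hi r) = d ->
    (qS c d *: trace_fun (word_of mu)) m = f (mono m * (tau r * tau r * e mu)).
  move=> <- <-; rewrite qS_trace_fun (pt_sq_y gamma_inj) !rkE.
  by rewrite mulrA -mono_central -mulrA.
rewrite -nuE -swapE (sqE nu) // trace_tau_sq qS_sym (sqE (sact r nu)) //.
  by rewrite rk_sact // tpermL.
by rewrite rk_sact // tpermR.
Qed.

Variables (hn : (0 < n)%N) (p : 'I_n -> nat).
Hypothesis f_cyc : forall z nu,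
  f (z * (x (Ordinal hn) ^+ p (rk nu (Ordinal hn)) * e nu)) = 0.

Lemma trace_first a s : perm_eq (a :: s) (enum 'I_n) ->
  (var k a ^+ p a) *: trace_fun (a :: s) = 0.
Proof.
move=> st; apply: funext => m; have [nu nuE] := word_of_surj gamma_inj st.
have rk0 : rk nu (Ordinal hn) = a by rewrite -(nth_word_of gamma nu a) nuE.
rewrite arr_varXE -nuE trace_funE mono_set_exp -mono_central -mulrA -[a in y a]rk0.
by rewrite -(x_pow_e gamma_inj) -rk0 f_cyc.
Qed.

(** The values of f on central multiples of idempotents form a functional, so
    the uniqueness half of cyclotomic_determined applies to them, and
    tracial_span extends the conclusion to the whole algebra. *)
Lemma trace_eq0 : (forall nu m, below (qdeg gamma) p [::] (word_of nu) m ->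
    f (mono m * e nu) = 0) -> forall z, f z = 0.
Proof.
move=> f_below z; apply: (@tracial_span _ _ _ _ _ _ _ gamma_inj _ pK X f (fun u => u = 0)) => //.
  by move=> c u v -> ->; rewrite scaler0 addr0.
move=> m nu.
rewrite -trace_funE.
have [uni _] := cyclotomic_determined Q gamma_inj X p.
rewrite (uni trace_fun) ?perm_word_of //; first split.
- exact: trace_first.
- by move=> s a b t; apply: trace_swap.
move=> s m' st; have [mu <-] := word_of_surj gamma_inj st.
by rewrite trace_funE; apply: f_below.
Qed.

End Spanning.

(** * The polynomial representation *)

Section Representation.
Variables (I : finType) (D : cartan_datum I) (k : fieldType) (Q : klr_poly D k).
Variables (n : nat) (beta : wlat D).
Variables (gamma : Iseq n beta) (gamma_inj : injective gamma).
Variables (S : comAlgType k) (y : 'I_n -> S).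
Implicit Types (nu mu : Iseq n beta) (v : Iseq n beta -> S) (s : S).
Notation rk := (rk gamma).
Notation pos := (pos gamma_inj).
Notation gen := (klr_gen n beta).
Notation F := (free_alg k gen).
Notation QQ a b := (Defs.qpoly Q (gamma a) (gamma b)).

Definition Qy (a b : 'I_n) : S :=
  \sum_(q < size (QQ a b)) \sum_(p < size (QQ a b)`_q)
    (QQ a b)`_q`_p *: (y a ^+ p * y b ^+ q).
Hypothesis Qy_sym : forall a b, Qy a b = Qy b a.

(** Of the two crossings between strands a and b, one acts by Q_ab and the
    other by 1, so that their composite is Q_ab; the order of the letters
    decides which is which. *)
Definition cross (m : 'I_n.-1) nu : S :=
  if (rk nu (lo m) < rk nu (hi m))%N then Qy (rk nu (lo m)) (rk nu (hi m)) else 1.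

Definition gact (g : gen) v : Iseq n beta -> S :=
  match g with
  | Idem nu => fun mu => if mu == nu then v mu else 0
  | Defs.Dot l => fun mu => y (rk mu l) * v mu
  | Cross m => fun mu => cross m (sact m mu) * v (sact m mu)
  end.

(** The polynomial representation, as an action of the free algebra on
    functions from words to S. For distinct letters no divided differences
    occur. *)
Definition rho (z : F) v : Iseq n beta -> S :=
  fun mu => lext (fun w : {fmonom gen} => foldr gact v w mu) z.

Lemma gact_lin g (c : k) v v' mu :
  gact g (fun mu => c *: v mu + v' mu) mu = c *: gact g v mu + gact g v' mu.
Proof.
case: g => [nu|l|m] /=; last by rewrite mulrDr scalerAr.
  by case: ifP; rewrite ?scaler0 ?addr0.
by rewrite mulrDr scalerAr.
Qed.

Lemma gact_mul g s v mu : gact g (fun mu => s * v mu) mu = s * gact g v mu.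
Proof.
case: g => [nu|l|m] /=; last by rewrite mulrCA.
  by case: ifP; rewrite ?mulr0.
by rewrite mulrCA.
Qed.

Lemma eq_gact g v v' : v =1 v' -> gact g v =1 gact g v'.
Proof. by move=> e mu; case: g => [nu|l|m] /=; rewrite e. Qed.

Lemma eq_rho z v v' : v =1 v' -> rho z v =1 rho z v'.
Proof. by move=> /funext ->. Qed.

Lemma foldr_gact_lin (w : seq gen) (c : k) v v' mu :
  foldr gact (fun mu => c *: v mu + v' mu) w mu =
  c *: foldr gact v w mu + foldr gact v' w mu.
Proof.
elim: w mu => //= g w IH mu; rewrite -gact_lin.
exact: eq_gact.
Qed.

Lemma foldr_gact_mul (w : seq gen) s v mu :
  foldr gact (fun mu => s * v mu) w mu = s * foldr gact v w mu.
Proof. by elim: w mu => //= g w IH mu; rewrite -gact_mul; apply: eq_gact. Qed.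

Lemma rhoD (z z' : F) v mu : rho (z + z') v mu = rho z v mu + rho z' v mu.
Proof. exact: raddfD. Qed.

Lemma rhoB (z z' : F) v mu : rho (z - z') v mu = rho z v mu - rho z' v mu.
Proof. exact: raddfB. Qed.

Lemma rho0 v mu : rho 0 v mu = 0.
Proof. exact: raddf0. Qed.

Lemma rhoZ (c : k) (z : F) v mu : rho (c *: z) v mu = c *: rho z v mu.
Proof. by rewrite -malg_scaleE /rho lextZ. Qed.

Lemma rho_linl (c : k) (z z' : F) v mu :
  rho (c *: z + z') v mu = c *: rho z v mu + rho z' v mu.
Proof. by rewrite rhoD rhoZ. Qed.

Lemma rho_sum (T : Type) (r : seq T) (P : pred T) (z : T -> F) v mu :
  rho (\sum_(i <- r | P i) z i) v mu = \sum_(i <- r | P i) rho (z i) v mu.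
Proof. exact: raddf_sum. Qed.

Lemma rho_lin z (c : k) v v' mu :
  rho z (fun mu => c *: v mu + v' mu) mu = c *: rho z v mu + rho z v' mu.
Proof.
rewrite /rho /lext scaler_sumr -big_split; apply: eq_bigr => w _.
by rewrite foldr_gact_lin scalerDr !scalerA mulrC.
Qed.

Lemma rho_mul z s v mu : rho z (fun mu => s * v mu) mu = s * rho z v mu.
Proof.
rewrite /rho /lext mulr_sumr; apply: eq_bigr => w _.
by rewrite foldr_gact_mul scalerAr.
Qed.

Lemma rho_zero z mu : rho z (fun=> 0) mu = 0.
Proof.
apply: etrans (etrans (rho_mul z 0 (fun=> 0) mu) (mul0r _)).
by apply: eq_rho => ?; rewrite mul0r.
Qed.

Lemma rho_monom (w : {fmonom gen}) v mu : rho << w >> v mu = foldr gact v w mu.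
Proof. exact: lextU. Qed.

Lemma rho_var (g : gen) v mu : rho (fvar k g) v mu = gact g v mu.
Proof. by rewrite rho_monom fmuE. Qed.

Lemma rho1 v mu : rho 1 v mu = v mu.
Proof. by rewrite -[1 : F]/(<< mone >> : F) rho_monom /mone /= fmoneE. Qed.

Lemma rhoM (z z' : F) v mu : rho (z * z') v mu = rho z (rho z' v) mu.
Proof.
elim/free_alg_ind: z => [|c w z IH]; first by rewrite (mul0r z') !rho0.
rewrite kalg_linM rho_linl [RHS]rho_linl IH; congr (_ *: _ + _).
elim/free_alg_ind: z' {IH} => [|c' w' z' IH'].
  by rewrite (mulr0 (<< w >> : F)) rho0 -(rho_zero << w >> mu); apply: eq_rho => ?; rewrite rho0.
rewrite kalg_Mlin rho_linl IH'.
transitivity (rho << w >> (fun mu => c' *: rho << w' >> v mu + rho z' v mu) mu).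
  rewrite rho_lin; congr (_ *: _ + _).
  rewrite free_monomM !rho_monom fmM foldr_cat.
  by congr (foldr gact _ w mu); apply: funext => ?; rewrite rho_monom.
by apply: eq_rho => ?; rewrite rho_linl.
Qed.

Lemma rho_varM (g : gen) (z : F) v mu : rho (fvar k g * z) v mu = gact g (rho z v) mu.
Proof. by rewrite rhoM rho_var. Qed.

Lemma rho2 (g h : gen) v mu : rho (fvar k g * fvar k h) v mu = gact g (gact h v) mu.
Proof. by apply: etrans (rho_varM _ _ _ _) _; apply: eq_gact => ?; apply: rho_var. Qed.

Lemma rho3 (g h h' : gen) v mu :
  rho (fvar k g * fvar k h * fvar k h') v mu = gact g (gact h (gact h' v)) mu.
Proof.
apply: etrans (rhoM _ _ _ _) _; apply: etrans (rho2 _ _ _ _) _.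
by do 2!apply: eq_gact => ?; apply: rho_var.
Qed.

Notation fx l := (fvar k (Defs.Dot beta l) : F).

Lemma rho_x_pow l d v mu : rho (fx l ^+ d) v mu = y (rk mu l) ^+ d * v mu.
Proof.
elim: d v mu => [|d IH] v mu; first by apply: etrans (rho1 v mu) _; rewrite mul1r.
rewrite exprS; apply: etrans (rho_varM _ _ _ _) _; rewrite /= IH.
by rewrite exprS mulrA.
Qed.

Lemma rho_qeval P l l' v mu : rho (qeval P (fx l) (fx l')) v mu =
  (\sum_(q < size P) \sum_(p < size P`_q)
     P`_q`_p *: (y (rk mu l) ^+ p * y (rk mu l') ^+ q)) * v mu.
Proof.
apply: etrans (rho_sum _ _ _ _ _) _; rewrite mulr_suml; apply: eq_bigr => q _.
apply: etrans (rho_sum _ _ _ _ _) _; rewrite mulr_suml; apply: eq_bigr => p _.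
apply: etrans (rhoZ _ _ _ _) _; rewrite -scalerAl; congr (_ *: _).
apply: etrans (rhoM _ _ _ _) _; apply: etrans (rho_x_pow _ _ _ _) _.
by rewrite rho_x_pow mulrA.
Qed.

Lemma crossK m nu : cross m nu * cross m (sact m nu) = Qy (rk nu (lo m)) (rk nu (hi m)).
Proof.
rewrite /cross !rk_sact // /sperm tpermL tpermR.
case: (ltngtP (rk nu (lo m)) (rk nu (hi m))) => [_|_|/val_inj/(rk_inj gamma_inj)/eqP].
- by rewrite mulr1.
- by rewrite mul1r Qy_sym.
- by rewrite (negbTE (lo_neq_hi m)).
Qed.

Lemma sactC (m m' : 'I_n.-1) nu : (m.+1 < m')%N || (m'.+1 < m)%N ->
  sact m (sact m' nu) = sact m' (sact m nu).
Proof.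
move=> far; apply: (rk_eq (gamma := gamma)) => t; rewrite !rk_sact // /sperm.
have d1 : lo m' != lo m by rewrite -val_eqE /=; lia.
have d2 : hi m' != lo m by rewrite -val_eqE /=; lia.
have d3 : lo m' != hi m by rewrite -val_eqE /=; lia.
have d4 : hi m' != hi m by rewrite -val_eqE /=; lia.
case: (tpermP (lo m) (hi m) t) => [->|->|/eqP tl /eqP th].
- by rewrite (tpermD d3 d4) (tpermD d1 d2) tpermL.
- by rewrite (tpermD d1 d2) (tpermD d3 d4) tpermR.
by case: (tpermP (lo m') (hi m') t) => [_|_|_ _]; rewrite tpermD // eq_sym.
Qed.

Lemma cross_far (m m' : 'I_n.-1) nu : (m.+1 < m')%N || (m'.+1 < m)%N ->
  cross m (sact m' nu) = cross m nu.
Proof.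
move=> far; rewrite /cross !rk_sact // /sperm !tpermD // -val_eqE /=; move: far; lia.
Qed.

Section Braid.
Variables (m m' : 'I_n.-1).
Hypothesis mm' : m' = m.+1 :> nat.

Let lo_m' : lo m' = hi m. Proof. exact: val_inj. Qed.
Let pr : lo m != hi m. Proof. exact: lo_neq_hi. Qed.
Let rt : hi m != hi m'. Proof. by rewrite -lo_m' lo_neq_hi. Qed.
Let pt : lo m != hi m'. Proof. by rewrite -val_eqE /=; lia. Qed.
Let rp : hi m != lo m. Proof. by rewrite eq_sym. Qed.
Let tr : hi m' != hi m. Proof. by rewrite eq_sym. Qed.
Let tp : hi m' != lo m. Proof. by rewrite eq_sym. Qed.

Lemma rk_lo nu : rk (sact m nu) (lo m) = rk nu (hi m).
Proof. by rewrite rk_sact // tpermL. Qed.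
Lemma rk_hi nu : rk (sact m nu) (hi m) = rk nu (lo m).
Proof. by rewrite rk_sact // tpermR. Qed.
Lemma rk_hi' nu : rk (sact m nu) (hi m') = rk nu (hi m').
Proof. by rewrite rk_sact // tpermD. Qed.
Lemma rk'_lo nu : rk (sact m' nu) (lo m) = rk nu (lo m).
Proof. by rewrite rk_sact // /sperm lo_m' tpermD. Qed.
Lemma rk'_hi nu : rk (sact m' nu) (hi m) = rk nu (hi m').
Proof. by rewrite rk_sact // /sperm lo_m' tpermL. Qed.
Lemma rk'_hi' nu : rk (sact m' nu) (hi m') = rk nu (hi m).
Proof. by rewrite rk_sact // /sperm lo_m' tpermR. Qed.

Let rk_swap := (rk_lo, rk_hi, rk_hi', rk'_lo, rk'_hi, rk'_hi').

Lemma sact_braid nu : sact m' (sact m (sact m' nu)) = sact m (sact m' (sact m nu)).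
Proof.
apply: (rk_eq (gamma := gamma)) => t.
have [->|tp0] := eqVneq t (lo m); first by rewrite !rk_swap.
have [->|tr0] := eqVneq t (hi m); first by rewrite !rk_swap.
have [->|tt0] := eqVneq t (hi m'); first by rewrite !rk_swap.
have out nu' : rk (sact m nu') t = rk nu' t by rewrite rk_sact // /sperm tpermD // eq_sym.
have out' nu' : rk (sact m' nu') t = rk nu' t.
  by rewrite rk_sact // /sperm lo_m' tpermD // eq_sym.
by rewrite !(out, out').
Qed.

Lemma gact_braid v mu : gact (Cross beta m') (gact (Cross beta m) (gact (Cross beta m') v)) mu =
  gact (Cross beta m) (gact (Cross beta m') (gact (Cross beta m) v)) mu.
Proof.
rewrite /= -sact_braid !mulrA; congr (_ * v _).
by rewrite /cross lo_m' !rk_swap; ring.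
Qed.

End Braid.

Lemma rho_rel a b : klr_rel Q a b -> forall v mu, rho a v mu = rho b v mu.
Proof.
case=> [nu nu'||l l'|l nu|m nu|m m' far|m nu|m l nu|m m' nu mm'] v mu.
- apply: etrans (rho2 _ _ _ _) _.
  case: (eqVneq nu nu') => [->|ne]; rewrite ?rho_var ?rho0 /=.
    by case: eqP.
  by case: eqP => // ->; rewrite (negbTE ne).
- rewrite rho_sum rho1 (bigD1 mu) //= big1 ?addr0 => [|nu ne].
    by rewrite rho_var /= eqxx.
  by rewrite rho_var /= eq_sym (negbTE ne).
- apply: etrans (rho2 _ _ _ _) (etrans _ (esym (rho2 _ _ _ _))).
  by rewrite /= mulrCA.
- apply: etrans (rho2 _ _ _ _) (etrans _ (esym (rho2 _ _ _ _))).
  by rewrite /=; case: ifP; rewrite ?mulr0.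
- apply: etrans (rho2 _ _ _ _) (etrans _ (esym (rho2 _ _ _ _))).
  rewrite /= -(inj_eq (can_inj (@sactK _ D n beta m)) mu) sactK.
  by case: ifP; rewrite ?mulr0.
- apply: etrans (rho2 _ _ _ _) (etrans _ (esym (rho2 _ _ _ _))).
  have far' : (m'.+1 < m)%N || (m.+1 < m')%N by rewrite orbC.
  have e1 : cross m' (sact m' (sact m mu)) = cross m' (sact m' mu).
    by rewrite -(sactC _ far) cross_far.
  have e2 : cross m (sact m (sact m' mu)) = cross m (sact m mu).
    by rewrite sactC // cross_far.
  by rewrite /= e1 e2 sactC // mulrCA.
- apply: etrans (rhoM _ _ _ _) _; rewrite expr2; apply: etrans (rho2 _ _ _ _) _.
  rewrite /= sactK mulrA [cross _ _ * _]mulrC crossK.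
  apply: etrans _ (esym (rhoM _ _ _ _)); rewrite rho_qeval !rho_var /=.
  by case: eqP => [->|_]; rewrite ?mulr0 // /Qy !rkE.
- apply: etrans (rhoM _ _ _ _) _; apply: etrans (rhoB _ _ _ _) _.
  have -> : nu (lo m) != nu (hi m).
    by rewrite (inj_eq (letter_inj gamma_inj (nu := nu))) lo_neq_hi.
  rewrite rho0; apply/eqP; rewrite subr_eq0; apply/eqP.
  apply: etrans (rho2 _ _ _ _) (etrans _ (esym (rho2 _ _ _ _))).
  by rewrite /= rk_sact // mulrCA.
- apply: etrans (rhoM _ _ _ _) _; apply: etrans (rhoB _ _ _ _) _.
  have /negbTE -> : nu (lo m) != nu (hi m').
    rewrite (inj_eq (letter_inj gamma_inj (nu := nu))) -val_eqE /=; lia.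
  rewrite rho0; apply/eqP; rewrite subr_eq0; apply/eqP.
  apply: etrans (rho3 _ _ _ _ _) (etrans _ (esym (rho3 _ _ _ _ _))).
  exact: gact_braid.
Qed.

End Representation.

(** * Traces from the polynomial representation *)

Lemma adjacent_inversion n (m : 'I_n.-1) (s t : 'I_n) :
  (s < t)%N -> (sperm m t < sperm m s)%N -> s = lo m /\ t = hi m.
Proof.
move=> lt; rewrite /sperm.
case: (tpermP (lo m) (hi m) s) => [es|es|/eqP sl /eqP sh];
  case: (tpermP (lo m) (hi m) t) => [et|et|/eqP tl /eqP th] //.
all: rewrite ?es ?et ?(negbTE sl) /= in lt *; try lia.
all: move: (tl) (th) || move: (sl) (sh); rewrite -!val_eqE /=; lia.
Qed.

Section RepresentationTrace.
Variables (I : finType) (D : cartan_datum I) (k : fieldType) (Q : klr_poly D k).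
Variables (n : nat) (beta : wlat D).
Variables (gamma : Iseq n beta) (gamma_inj : injective gamma).
Variables (S : comAlgType k) (y : 'I_n -> S).
Implicit Types (nu mu : Iseq n beta) (v : Iseq n beta -> S) (s : S).
Notation rk := (rk gamma).
Notation pos := (pos gamma_inj).
Notation gen := (klr_gen n beta).
Notation F := (free_alg k gen).
Notation Qy := (Qy Q gamma y).
Notation gact := (gact Q gamma y).
Notation rho := (rho Q gamma y).
Notation cross := (cross Q gamma y).
Hypothesis Qy_sym : forall a b, Qy a b = Qy b a.

Definition unit_fun nu : Iseq n beta -> S := fun mu => (mu == nu)%:R.

(** Relative to the word nu, each pair a < b in increasing order that is
    inverted in mu costs a factor Q_ab at mu. *)
Definition reorder_divisible nu v : Prop := forall a b : 'I_n,
  (a < b)%N -> (pos nu a < pos nu b)%N ->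
  forall mu, (pos mu b < pos mu a)%N -> exists s, v mu = Qy a b * s.

Lemma unit_fun_divisible nu : reorder_divisible nu (unit_fun nu).
Proof.
move=> a b _ lt_ab mu lt_ba; exists 0; rewrite mulr0 /unit_fun.
by case: eqP lt_ba => // ->; rewrite ltnNge ltnW.
Qed.

(** A pair becomes inverted only when a crossing exchanges its two strands as
    neighbours, and in this direction the crossing acts by Q_ab. *)
Lemma gact_divisible nu g v : reorder_divisible nu v -> reorder_divisible nu (gact g v).
Proof.
move=> dv a b ab nu_ab mu mu_ba; case: g => [ka|l|m] /=.
- case: eqP => [_|_]; first exact: dv nu_ab _ mu_ba.
  by exists 0; rewrite mulr0.
- have [s ->] := dv _ _ ab nu_ab _ mu_ba.
  by exists (y (rk mu l) * s); rewrite mulrCA.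
have [smu_ba|smu_ab] := ltnP (pos (sact m mu) b) (pos (sact m mu) a).
  have [s ->] := dv _ _ ab nu_ab _ smu_ba.
  by exists (cross m (sact m mu) * s); rewrite mulrCA.
have ne : pos (sact m mu) a != pos (sact m mu) b.
  by apply: contraTneq ab => /(congr1 (rk (sact m mu))); rewrite !posK => ->; rewrite ltnn.
have {ne} lt_ab : (pos (sact m mu) a < pos (sact m mu) b)%N by rewrite ltn_neqAle ne.
have mua : pos mu a = sperm m (pos (sact m mu) a) by rewrite pos_sact tpermK.
have mub : pos mu b = sperm m (pos (sact m mu) b) by rewrite pos_sact tpermK.
have [alo bhi] : pos (sact m mu) a = lo m /\ pos (sact m mu) b = hi m.
  by apply: adjacent_inversion lt_ab _; rewrite -mua -mub.
exists (v (sact m mu)); rewrite /cross -alo -bhi !posK ab.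
by [].
Qed.

Lemma rho_divisible nu (z : F) : reorder_divisible nu (rho z (unit_fun nu)).
Proof.
move=> a b ab nu_ab mu mu_ba.
elim/free_alg_ind: z => [|c w z [s IH]].
  by exists 0; rewrite mulr0 rho0.
have [s' e'] : exists s', rho << w >> (unit_fun nu) mu = Qy a b * s'.
  suff h : reorder_divisible nu (foldr gact (unit_fun nu) w).
    by rewrite rho_monom; apply: h nu_ab _ mu_ba.
  elim: (w : seq gen) => [|g w' IHw]; first exact: unit_fun_divisible.
  exact: gact_divisible.
exists (c *: s' + s); rewrite rho_linl IH e' mulrDr; congr (_ + _).
by rewrite scalerAr.
Qed.

Variables (X : lmodType k) (psi : Iseq n beta -> {linear S -> X}).
Hypothesis psi_swap : forall m nu s,
  psi nu (Qy (rk nu (lo m)) (rk nu (hi m)) * s) =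
  psi (sact m nu) (Qy (rk nu (lo m)) (rk nu (hi m)) * s).

(** A matrix trace with a separate linear form psi on each diagonal entry; the
    hypothesis psi_swap makes up for the dependence of psi on the word. *)
Definition rtrace (z : F) : X := \sum_nu psi nu (rho z (unit_fun nu) nu).

Lemma rtrace_lin c (z z' : F) : rtrace (c *: z + z') = c *: rtrace z + rtrace z'.
Proof.
rewrite /rtrace scaler_sumr -big_split; apply: eq_bigr => nu _.
by rewrite rho_linl linearP.
Qed.

(** For a crossing m, both sides are sums over the words nu of the entry of z
    from nu to m.nu times the entry of m in the opposite direction, evaluated
    by the form at nu on one side and at m.nu on the other. The product of the
    two entries is divisible by the crossing polynomial of the two letters,
    through one factor or the other, and psi_swap applies. *)
Lemma rtrace_gen (g : gen) (z : F) : rtrace (fvar k g * z) = rtrace (z * fvar k g).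
Proof.
transitivity (\sum_nu psi nu (gact g (rho z (unit_fun nu)) nu)).
  by apply: eq_bigr => nu _; congr (psi nu _); apply: rho_varM.
transitivity (\sum_nu psi nu (rho z (gact g (unit_fun nu)) nu)); last first.
  apply: eq_bigr => nu _; congr (psi nu _); apply/esym/(etrans (rhoM _ _ _ _ _ _ _)).
  by apply: eq_rho => ?; apply: rho_var.
case: g => [ka|l|m] /=.
- apply: eq_bigr => nu _; congr (psi nu _); case: eqP => [->|ne].
    by apply: eq_rho => mu; rewrite /unit_fun; case: eqP.
  rewrite -[LHS](rho_zero Q gamma y z nu); apply: eq_rho => mu.
  by rewrite /unit_fun; case: eqP => // ->; case: eqP ne => // ->.
- apply: eq_bigr => nu _; congr (psi nu _); rewrite -rho_mul; apply: eq_rho => mu.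
  by rewrite /unit_fun; case: eqP => [->|]; rewrite ?mulr0.
rewrite [RHS](reindex_inj (can_inj (@sactK _ D n beta m))) /=.
apply: eq_bigr => nu _.
have -> : rho z (fun mu => cross m (sact m mu) * unit_fun (sact m nu) (sact m mu)) (sact m nu) =
    cross m (sact m nu) * rho z (unit_fun nu) (sact m nu).
  rewrite -rho_mul; apply: eq_rho => mu.
  rewrite /unit_fun (inj_eq (can_inj (@sactK _ D n beta m))).
  by case: eqP => [->|]; rewrite ?mulr0.
set u := _ * _; suff [s ->] : exists s, u = Qy (rk nu (lo m)) (rk nu (hi m)) * s by [].
rewrite {}/u; have [lt|le] := ltnP (rk nu (lo m)) (rk nu (hi m)).
  have [||s ->] := @rho_divisible nu z _ _ lt _ (sact m nu).
  - by rewrite !rkK /=.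
  - by rewrite !pos_sact // !rkK /sperm tpermL tpermR.
  by exists (cross m (sact m nu) * s); rewrite mulrCA.
exists (rho z (unit_fun nu) (sact m nu)).
rewrite /cross !rk_sact // /sperm tpermL tpermR ltn_neqAle le andbT.
case: eqP => [/val_inj/(rk_inj gamma_inj)/eqP|_]; last by rewrite Qy_sym.
by rewrite eq_sym (negbTE (lo_neq_hi m)).
Qed.

Lemma rtrace_comm (z z' : F) : rtrace (z * z') = rtrace (z' * z).
Proof.
elim/free_alg_ind: z => [|c w z IH]; first by rewrite (mul0r z') (mulr0 z').
apply: etrans (congr1 rtrace (kalg_linM c (<< w >> : F) z z')) _.
apply: etrans (rtrace_lin _ _ _) _; apply/esym.
apply: etrans (congr1 rtrace (kalg_Mlin c (<< w >> : F) z z')) _.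
apply: etrans (rtrace_lin _ _ _) _; apply/esym.
apply: (f_equal2 (fun u v : X => c *: u + v)) IH.
case: w => w; elim: w z' => [|g w IH] z'.
  have -> : << FMonom [::] >> = 1 :> F by rewrite -fmoneE.
  by rewrite (mul1r z') (mulr1 z').
rewrite fvar_cons; set W : F := << FMonom w >>.
apply: etrans (congr1 rtrace (esym (mulrA (fvar k g) W z'))) _.
apply: etrans (rtrace_gen g (W * z')) _.
apply: etrans (congr1 rtrace (esym (mulrA W z' (fvar k g)))) _.
apply: etrans (IH (z' * fvar k g)) _.
exact: (congr1 rtrace (esym (mulrA z' (fvar k g) W))).
Qed.

End RepresentationTrace.

(** * Descent to the algebra *)

Lemma rmorph_word3 (R R' : pzRingType) (phi : {rmorphism R -> R'}) (a b c : R) d :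
  phi a * (phi b ^+ d * phi c) = phi (a * (b ^+ d * c)).
Proof. by rewrite !rmorphM rmorphXn. Qed.

Lemma rmorph_monomial (R R' : pzRingType) (phi : {rmorphism R -> R'}) n
    (a : 'I_n -> nat) (u : 'I_n -> R) (c : R) :
  (\prod_(t < n) phi (u t) ^+ a t) * phi c = phi ((\prod_(t < n) u t ^+ a t) * c).
Proof.
by rewrite rmorphM rmorph_prod; congr (_ * _); apply: eq_bigr => t _; rewrite rmorphXn.
Qed.

Section Descent.
Variables (I : finType) (D : cartan_datum I) (k : fieldType) (Q : klr_poly D k).
Variables (n : nat) (beta : wlat D).
Variables (gamma : Iseq n beta) (gamma_inj : injective gamma).
Variables (S : comAlgType k) (y : 'I_n -> S).
Implicit Types (nu mu : Iseq n beta) (v : Iseq n beta -> S) (s : S).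
Notation rk := (rk gamma).
Notation gen := (klr_gen n beta).
Notation F := (free_alg k gen).
Notation K := (klr Q n beta).
Notation pi := (@klr_pi I D k Q n beta).
Notation Qy := (Qy Q gamma y).
Notation rho := (rho Q gamma y).
Hypothesis Qy_sym : forall a b, Qy a b = Qy b a.
Variables (X : lmodType k) (psi : Iseq n beta -> {linear S -> X}).
Hypothesis psi_swap : forall m nu s,
  psi nu (Qy (rk nu (lo m)) (rk nu (hi m)) * s) =
  psi (sact m nu) (Qy (rk nu (lo m)) (rk nu (hi m)) * s).
Notation rtrace := (rtrace Q gamma y psi).
Notation fe nu := (fvar k (Idem nu) : F).
Notation fx l := (fvar k (Defs.Dot beta l) : F).

(** The representation respects the defining relations, so it kills the ideal.
    *)
Lemma rho_ideal (z : F) : ideal_gen (fun z : F => exists a b, klr_rel Q a b /\ z = a - b) z ->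
  forall v mu, rho z v mu = 0.
Proof.
elim=> [|c _ z' [a [_ [b [[r1 [r2 [rel ->]]] ->]]]] _ IH] v mu; first exact: rho0.
apply: etrans (rho_linl _ _ _ _ _ _ _ _) _; rewrite IH addr0.
have -> : rho (a * (r1 - r2) * b) v mu = 0; last by rewrite scaler0.
apply: etrans (rhoM _ _ _ _ _ _ _) _; apply: etrans (rhoM _ _ _ _ _ _ _) _.
rewrite -[RHS](rho_zero Q gamma y a mu); apply: eq_rho => ka.
apply: etrans (rhoB _ _ _ _ _ _ _) _.
by rewrite (rho_rel gamma_inj Qy_sym rel) subrr.
Qed.

Lemma rtrace_ideal (z z' : F) : pi z = pi z' -> rtrace z = rtrace z'.
Proof.
move=> /aproj_eq /rho_ideal h; apply: eq_bigr => nu _; congr (psi nu _).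
by apply/subr0_eq; rewrite -(h (unit_fun S nu) nu); apply/esym/rhoB.
Qed.

Definition klr_trace (z : K) : X := rtrace (aquot_repr z).

Lemma klr_traceE (z : F) : klr_trace (pi z) = rtrace z.
Proof. by apply: rtrace_ideal; apply: aquot_reprK. Qed.

Lemma klr_pi_surj (z : K) : exists f, z = pi f.
Proof. exact: aproj_surj. Qed.

Lemma klr_trace_is_linear : linear klr_trace.
Proof.
move=> c u v; have [f ->] := klr_pi_surj u; have [g ->] := klr_pi_surj v.
rewrite -(klr_pi_lin Q c f g) !klr_traceE.
exact: rtrace_lin.
Qed.
Lemma klr_trace_comm (z z' : K) : klr_trace (z * z') = klr_trace (z' * z).
Proof.
have [f ->] := klr_pi_surj z; have [g ->] := klr_pi_surj z'.
apply: etrans (congr1 klr_trace (esym (klr_piM Q f g))) _.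
apply: etrans (klr_traceE _) _; apply: etrans (rtrace_comm gamma_inj Qy_sym psi_swap f g) _.
exact: etrans (esym (klr_traceE _)) (congr1 klr_trace (klr_piM Q g f)).
Qed.

Lemma rtrace_xe (z : F) l d nu : rtrace (z * (fx l ^+ d * fe nu)) =
  psi nu (y (rk nu l) ^+ d * rho z (unit_fun S nu) nu).
Proof.
have rhoE ka mu : rho (z * (fx l ^+ d * fe nu)) (unit_fun S ka) mu =
    rho z (fun mu => y (rk ka l) ^+ d * (if ka == nu then unit_fun S ka mu else 0)) mu.
  apply: etrans (rhoM _ _ _ _ _ _ _) _; apply: eq_rho => mu'.
  apply: etrans (rhoM _ _ _ _ _ _ _) _; apply: etrans (rho_x_pow _ _ _ _ _ _ _) _.
  rewrite rho_var /= /unit_fun; case: (eqVneq mu' ka) => [->|ne] //.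
  by rewrite !if_same !mulr0.
rewrite /rtrace (bigD1 nu) //= big1 ?addr0 => [|ka ne].
  by rewrite rhoE eqxx rho_mul.
rewrite rhoE (negbTE ne) -[RHS](linear0 (psi ka)); congr (psi ka _).
by rewrite -[RHS](rho_zero Q gamma y z ka); apply: eq_rho => mu; rewrite mulr0.
Qed.

Lemma klr_trace_xe z l d nu :
  (forall s, psi nu (y (rk nu l) ^+ d * s) = 0) ->
  klr_trace (z * (klr_x Q beta l ^+ d * klr_e Q nu)) = 0.
Proof.
move=> psi0; have [f ->] := klr_pi_surj z.
have -> : pi f * (klr_x Q beta l ^+ d * klr_e Q nu) = pi (f * (fx l ^+ d * fe nu)).
  exact: (rmorph_word3 pi f (fx l) (fe nu) d).
exact: etrans (klr_traceE _) (etrans (rtrace_xe _ _ _ _) (psi0 _)).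
Qed.

Lemma klr_trace_monomial (a : 'I_n -> nat) nu :
  klr_trace ((\prod_(t < n) klr_x Q beta t ^+ a t) * klr_e Q nu) =
  psi nu (\prod_(t < n) y (rk nu t) ^+ a t).
Proof.
have -> : (\prod_(t < n) klr_x Q beta t ^+ a t) * klr_e Q nu =
    pi ((\prod_(t < n) fx t ^+ a t) * fe nu).
  exact: (rmorph_monomial pi a (fun t => fx t) (fe nu)).
apply: etrans (klr_traceE _) _.
have rhoE v mu : rho (\prod_(t < n) fx t ^+ a t) v mu =
    (\prod_(t < n) y (rk mu t) ^+ a t) * v mu.
  elim: (index_enum _) v mu => [|t r IH] v mu.
    by rewrite !big_nil mul1r; apply: rho1.
  rewrite !big_cons; apply: etrans (rhoM _ _ _ _ _ _ _) _.
  by apply: etrans (rho_x_pow _ _ _ _ _ _ _) _; rewrite IH mulrA.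
have rhoE' ka mu : rho ((\prod_(t < n) fx t ^+ a t) * fe nu) (unit_fun S ka) mu =
    (\prod_(t < n) y (rk mu t) ^+ a t) * (if mu == nu then unit_fun S ka mu else 0).
  by apply: etrans (rhoM _ _ _ _ _ _ _) _; rewrite rhoE rho_var.
move: (_ * fe nu) rhoE' => z zE.
rewrite /rtrace (bigD1 nu) //= big1 ?addr0 => [|ka ne].
  by rewrite zE eqxx /unit_fun eqxx mulr1.
by rewrite zE (negbTE ne) mulr0 linear0.
Qed.

End Descent.

(** * Comparison of the exponent bounds *)

Lemma belowP n (q : 'I_n -> 'I_n -> nat) p (x0 : 'I_n) pre s a :
  reflect (forall i, (i < size s)%N ->
             (a (nth x0 s i) < bound q p (nth x0 s i) (rev (take i s) ++ pre))%N)
          (below q p pre s a).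
Proof.
elim: s pre => [|x s IH] pre /=; first by constructor.
apply: (iffP andP) => [[ax /IH h] [|i] lti|h]; first by [].
  by rewrite /= rev_cons -cats1 -catA; apply: h.
split; first exact: (h 0).
by apply/IH => i lti; have := h i.+1 lti; rewrite /= rev_cons -cats1 -catA.
Qed.

Section ExponentBounds.
Variables (I : finType) (D : cartan_datum I) (n : nat) (beta : wlat D).
Variables (gamma : Iseq n beta) (gamma_inj : injective gamma).
Variables (L : wlat D) (L_dom : dominant L).
Notation rk := (rk gamma).
Notation pos := (pos gamma_inj).
Notation word_of := (word_of gamma).
Notation qdeg := (qdeg gamma).
Implicit Types (nu : Iseq n beta) (t : 'I_n).

Definition cyc_exp (j : 'I_n) : nat := `|coroot D (gamma j) L|%N.

Lemma gamma_ltE nu (s t : 'I_n) : gamma_lt gamma (nu s) (nu t) = (rk nu s < rk nu t)%N.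
Proof.
apply/existsP/idP => [[p /existsP[q /and3P[pq /eqP ps /eqP qt]]]|lt].
  suff [-> ->] : rk nu s = p /\ rk nu t = q by [].
  by split; apply: gamma_inj; rewrite rkE.
by exists (rk nu s); apply/existsP; exists (rk nu t); rewrite lt !rkE !eqxx.
Qed.

(** Reading the prefix backwards up to the last smaller letter is the same as
    summing from the position of that letter. *)
Lemma bound_take nu t m : (m <= t)%N ->
  let K := \max_(s < n | (s < m)%N && (rk nu s < rk nu t)%N) s.+1 in
  bound qdeg cyc_exp (rk nu t) (rev (take m (word_of nu))) =
  (\sum_(l < n | (K <= l.+1)%N && (l < m)%N) qdeg (rk nu t) (rk nu l) +
   if K == 0%N then cyc_exp (rk nu t) else 0)%N.
Proof.
elim: m => [|m IH] mt /=.
  by rewrite take0 big_pred0 // big_pred0 // => l; rewrite ltn0 andbF.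
have mn : (m < n)%N by apply: leq_trans mt (ltnW (ltn_ord t)).
pose mo : 'I_n := Ordinal mn.
have ltS (l : 'I_n) : (l < m.+1)%N && (l != mo) = (l < m)%N.
  by rewrite -val_eqE /=; lia.
rewrite (take_nth t) ?size_word_of // rev_rcons /= (nth_word_of gamma nu t mo).
have {IH} := IH (ltnW mt); set K := \max_(s | _) _ => ->.
set K' := \max_(s | _) _.
have Km : (K <= m)%N by apply/bigmax_leqP => s /andP[].
case: ltnP => lt.
  have -> : K' = m.+1.
    rewrite /K' (bigD1 mo) /= ?leqnn //; apply/maxn_idPl.
    by apply/bigmax_leqP => s /andP[/andP[lts _] _].
  rewrite (bigD1 mo) /= ?leqnn // big_pred0 ?addn0 // => l.
  by rewrite -andbA ltS; lia.
have -> : K' = K.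
  apply: eq_bigl => s; rewrite ltnS leq_eqVlt andb_orl; case: eqP => // es.
  have -> : s = mo by apply: val_inj.
  by rewrite [(_ < rk nu t)%N]ltnNge lt /= andbF.
rewrite addnA; congr (_ + _)%N; rewrite [RHS](bigD1 mo) /= ?leqnn ?andbT; last exact: leqW.
by congr (_ + _)%N; apply: eq_bigl => l; rewrite -andbA ltS.
Qed.

Lemma exp_boundE nu t : exp_bound L gamma nu t =
  (bound qdeg cyc_exp (rk nu t) (rev (take t (word_of nu))))%:Z.
Proof.
rewrite bound_take // /exp_bound.
have -> : kpos gamma nu t = \max_(s < n | (s < t)%N && (rk nu s < rk nu t)%N) s.+1.
  by apply: eq_bigl => s; rewrite gamma_ltE.
set K := \max_(s | _) _; rewrite PoszD; congr (_ + _); last first.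
  by case: ifP => // _; rewrite /cyc_exp rkE gez0_abs.
rewrite -sumrN (big_morph _ PoszD (erefl _)).
apply: eq_big => [l|l /andP[_ lt]]; first by rewrite geq_max andbT.
have ne : rk nu t != rk nu l.
  by rewrite (inj_eq (rk_inj gamma_inj (nu := nu))) -val_eqE /= gtn_eqF.
by rewrite -[in LHS](rkE gamma nu t) -[in LHS](rkE gamma nu l) cartan_qdeg // opprK.
Qed.

(** A cyclotomic monomial has exponents indexed by positions, the bounds of
    functionals are indexed by letters. *)
Lemma exp_bound_below nu (a : 'I_n -> nat) :
  (forall t, (a t)%:Z < exp_bound L gamma nu t) <->
  below qdeg cyc_exp [::] (word_of nu) (a \o pos nu).
Proof.
split=> [h|h t].
  have [t0 _|noI] := pickP 'I_n; last first.
    have n0 : n = 0%N by apply: etrans (esym (card_ord n)) _; apply: eq_card0.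
    by rewrite (size0nil (etrans (size_word_of gamma nu) n0)).
  apply/(belowP _ _ t0) => i; rewrite size_word_of => lti.
  rewrite cats0 (nth_word_of gamma nu t0 (Ordinal lti)) /= rkK.
  by have := h (Ordinal lti); rewrite exp_boundE.
have /(belowP _ _ t)/(_ t) := h; rewrite size_word_of ltn_ord => /(_ isT).
by rewrite cats0 nth_word_of /= rkK exp_boundE.
Qed.

End ExponentBounds.

(** * The cocenter *)

Lemma linear_comb (k : pzRingType) (V W : lmodType k) (f : {linear V -> W})
    (s : seq V) (c : V -> k) :
  f (\sum_(u <- s) c u *: u) = \sum_(u <- s) c u *: f u.
Proof. by rewrite linear_sum; apply: eq_bigr => u _; rewrite linearZ. Qed.

Section TraceFunctionals.
Variables (k : fieldType) (K : kalg k) (G : K -> Prop).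

(** A trace that kills the generators of a two-sided ideal factors through the
    cocenter of the quotient. *)
Lemma tracial_cocenter (X : lmodType k) (f : {linear K -> X}) :
  (forall u v, f (u * v) = f (v * u)) ->
  (forall u g, G g -> f (u * g) = 0) ->
  forall z, to_cocenter (aproj G z) = 0 -> f z = 0.
Proof.
move=> f_trace fG z z0.
have f_ideal u v : aproj G u = aproj G v -> f u = f v.
  move=> /aproj_eq uv; apply/subr0_eq; rewrite -linearB.
  elim: uv => [|c _ w [a [g [b [Gg ->]]]] _ IH]; first exact: linear0.
  by rewrite linearP IH addr0 f_trace mulrA fG // scaler0.
have: Defs.span (@commutator k (quot_alg G)) (aproj G z).
  have /lproj_eq : to_cocenter (aproj G z) = to_cocenter 0 by rewrite z0 raddf0.
  by rewrite subr0.
move E: (aproj G z) => z' h; elim: h z E {z0} => [|c _ u [a' [b' ->]] _ IH] z E.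
  by rewrite -[RHS](linear0 f); apply: f_ideal; rewrite E raddf0.
have [a ea] := aproj_surj a'; have [b eb] := aproj_surj b'.
have [w ew] := aproj_surj u.
have -> : f z = f (c *: (a * b - b * a) + w).
  by apply: f_ideal; rewrite E ea eb ew linearP (linearB (aproj G)) !(rmorphM (aproj G)).
by rewrite linearP linearB (f_trace a b) subrr scaler0 add0r; apply: IH.
Qed.

Lemma cocenter_proj_comm (u v : K) :
  to_cocenter (aproj G (u * v)) = to_cocenter (aproj G (v * u)).
Proof.
apply/lproj_eq/span_gen; exists (aproj G u), (aproj G v).
by rewrite -!(rmorphM (aproj G)).
Qed.

Lemma cocenter_proj_surj (w : cocenter (quot_alg G)) :
  exists z, w = to_cocenter (aproj G z).
Proof.
have [u ->] : exists u, w = to_cocenter u by exists (repr w); rewrite [RHS]lprojK.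
by have [z ->] := aproj_surj u; exists z.
Qed.

End TraceFunctionals.

Lemma span_image_sum (k : fieldType) (V W : lmodType k) (f : V -> W) (T : V -> Prop) w :
  Defs.span (fun w => exists2 v, T v & w = f v) w ->
  exists (s : seq V) (c : V -> k),
    (forall v, v \in s -> T v) /\ w = \sum_(v <- s) c v *: f v.
Proof.
suff h : Defs.span (fun w => exists2 v, T v & w = f v) w ->
    exists (s : seq V) (c : V -> k), uniq s /\
      (forall v, v \in s -> T v) /\ w = \sum_(v <- s) c v *: f v.
  by move=> /h [s [c [_ h']]]; exists s, c.
elim=> [|d _ {}w [v Tv ->] _ [s [c [us [sT ->]]]]].
  by exists [::], (fun=> 0); rewrite big_nil.
have [vs|vs] := boolP (v \in s).
  exists s, (fun u => (if u == v then d else 0) + c u); split=> //; split=> //.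
  under [RHS]eq_bigr do rewrite scalerDl.
  rewrite big_split /=; congr (_ + _); rewrite (bigD1_seq v) //= eqxx big1 ?addr0 // => u.
  by move=> /negbTE ->; rewrite scale0r.
exists (v :: s), (fun u => if u == v then d else c u); split; first by rewrite /= vs.
split=> [u|]; first by rewrite inE => /orP[/eqP ->|/sT].
rewrite big_cons eqxx; congr (_ + _); apply: eq_big_seq => u us'.
by case: eqP vs us' => // -> /negbTE ->.
Qed.

Section MainParts.
Variables (I : finType) (D : cartan_datum I) (k : fieldType) (Q : klr_poly D k).
Variables (n : nat) (hn : (0 < n)%N) (beta : wlat D).
Variables (gamma : Iseq n beta) (gamma_inj : injective gamma).
Variables (L : wlat D) (L_dom : dominant L).
Implicit Types (nu mu : Iseq n beta).
Notation rk := (rk gamma).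
Notation pos := (pos gamma_inj).
Notation word_of := (word_of gamma).
Notation p := (cyc_exp gamma L).
Notation qdeg := (qdeg gamma).
Notation S := {malg k[{cmonom 'I_n}]}.
Notation K := (klr Q n beta).
Notation o := (Ordinal hn).

Lemma sum_x_e (A : kalg k) (pA : presented Q n beta A) l (d : Iseq n beta -> nat) nu :
  (\sum_mu px pA l ^+ d mu * pe pA mu) * pe pA nu = px pA l ^+ d nu * pe pA nu.
Proof.
rewrite mulr_suml (bigD1 nu) //= big1 ?addr0 => [|mu ne]; rewrite -mulrA pe_mul ?eqxx //.
by rewrite (negbTE ne) mulr0.
Qed.

(** The generator of the cyclotomic ideal is homogeneous for the idempotents,
    so it splits into one relation for each word. *)
Lemma cyc_gen_e nu : cyc_gen Q beta hn L * klr_e Q nu =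
  klr_x Q beta o ^+ p (rk nu o) * klr_e Q nu.
Proof.
rewrite /cyc_exp rkE.
exact: (sum_x_e (klr_presented Q gamma_inj) o (fun mu => `|coroot D (mu o) L|%N) nu).
Qed.

Lemma word_of_cons nu : exists s, word_of nu = rk nu o :: s.
Proof.
have := size_word_of gamma nu; have := nth_word_of gamma nu o o.
case: (word_of nu) => [_ n0|a s /= <- _]; last by exists s.
by exfalso; have := hn; rewrite -[X in (_ < X)%N]n0.
Qed.

Lemma word_of_split nu m : exists s t,
  word_of nu = s ++ [:: rk nu (lo m), rk nu (hi m) & t] /\
  word_of (sact m nu) = s ++ [:: rk nu (hi m), rk nu (lo m) & t].
Proof.
have e : word_of nu =
    take m (word_of nu) ++ [:: rk nu (lo m), rk nu (hi m) & drop m.+2 (word_of nu)].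
  rewrite -{1}[word_of nu](cat_take_drop m); congr (_ ++ _).
  have hm := ltn_ord (hi m); have lm := ltn_ord (lo m).
  rewrite (drop_nth (lo m)) ?size_word_of // (nth_word_of gamma nu _ (lo m)).
  by rewrite (drop_nth (lo m)) ?size_word_of // (nth_word_of gamma nu _ (hi m)).
have [m' [el eh es]] := word_swap gamma_inj e.
have em : m' = m.
  by apply/val_inj; have /(congr1 val) := rk_inj gamma_inj el.
by rewrite em in es; do 2!eexists; split; [exact: e | exact: es].
Qed.

Notation cls z := (to_cocenter (cyc_pi hn L z) : cocenter (cyclotomic Q beta hn L)).

(** The map from the algebra to the quotient of the cocenter by the span of the
    monomials is a trace that vanishes on all of them, hence zero. *)
Lemma klr_span (z : K) :
  Defs.span (fun w => exists2 v, Tset L gamma v & w = cls v) (cls z).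
Proof.
set T := fun w => _.
pose f : {linear K -> lquot T} := lproj T \o
  (to_cocenter (B := cyclotomic Q beta hn L) \o @aproj k K (fun z : K => z = cyc_gen Q beta hn L)).
suff : f z = 0.
  move=> h; have /lproj_eq : lproj T (cls z) = lproj T 0 by rewrite raddf0.
  by rewrite subr0.
have fE u : f u = lproj T (cls u) by [].
apply: (@trace_eq0 _ _ _ _ _ _ _ gamma_inj _ (klr_presented Q gamma_inj) _ f _ hn p).
- by move=> u v; apply: (congr1 (lproj T)); apply: cocenter_proj_comm.
- move=> u nu; rewrite fE /= -cyc_gen_e.
  suff -> : cyc_pi hn L (u * (cyc_gen Q beta hn L * klr_e Q nu)) = 0 by rewrite !raddf0.
  rewrite -[RHS](raddf0 (@aproj k K (fun z : K => z = cyc_gen Q beta hn L))).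
  apply/aproj_eq; rewrite subr0 mulrA; apply: span_gen.
  by exists u, (cyc_gen Q beta hn L), (klr_e Q nu).
move=> nu m below_m; rewrite fE.
rewrite -[RHS](raddf0 (lproj T)); apply/lproj_eq; rewrite subr0; apply: span_gen.
have em : (m \o rk nu) \o pos nu = m by apply: funext => j /=; rewrite posK.
exists (mono gamma_inj (klr_presented Q gamma_inj) m * klr_e Q nu) => //.
exists nu, (m \o rk nu); split; first by apply/(exp_bound_below gamma_inj L_dom); rewrite em.
by rewrite -{1}em; apply/esym; apply: (prod_x_e gamma_inj (klr_presented Q gamma_inj)).
Qed.

(** The exponent of a strand in the monomial shifts the array in the direction
    of its letter. *)
Lemma monomial_act (X : lmodType k) (f : arr n X) (a : 'I_n -> nat) nu :
  ((\prod_(t < n) var k (rk nu t) ^+ a t) *: f) (fun=> 0%N) = f (a \o pos nu).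
Proof.
have h (r : seq 'I_n) b : ((\prod_(t <- r) var k (rk nu t) ^+ a t) *: f) b =
    f (fun j => b j + \sum_(t <- r | rk nu t == j) a t)%N.
  elim: r b => [|t r IH] b.
    rewrite big_nil scale1r; congr f; apply: funext => j.
    by rewrite big_nil addn0.
  rewrite big_cons -scalerA arr_varXE IH; congr f; apply: funext => j.
  by rewrite big_cons /set_exp eq_sym; case: eqP => [->|]; rewrite ?addnA.
rewrite h; congr f; apply: funext => j; rewrite add0n /=.
by rewrite (big_pred1 (pos nu j)) // => t; rewrite (can2_eq (rkK gamma_inj nu) (posK gamma_inj nu)).
Qed.

(** The functional with value 1 at the given monomial and 0 at the other
    monomials below the bounds, turned into a trace through the polynomial
    representation. *)
Lemma dual_trace (nu0 : Iseq n beta) (a0 : 'I_n -> nat) :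
  exists f : {linear K -> k^o},
    [/\ forall z, cls z = 0 -> f z = 0
      & forall nu a, (forall t, (a t)%:Z < exp_bound L gamma nu t) ->
         f ((\prod_(t < n) klr_x Q beta t ^+ a t) * klr_e Q nu) =
         if `[< nu = nu0 /\ a = a0 >] then 1 else 0].
Proof.
pose c (s : seq 'I_n) : arr n k^o := fun m =>
  if `[< s = word_of nu0 /\ m = a0 \o pos nu0 >] then 1 else 0.
have [_ /(_ c) [phi [[phi0 phi1] phi_c]]] := cyclotomic_determined Q gamma_inj k^o p.
pose psi nu : {linear S -> k^o} :=
  lext (fun m => phi (word_of nu) (shift_exp (fun=> 0%N) m)).
have psiE nu s : psi nu s = (s *: phi (word_of nu)) (fun=> 0%N) by [].
have psi_swap m nu s :
    psi nu (Qy Q gamma (var k) (rk nu (lo m)) (rk nu (hi m)) * s) =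
    psi (sact m nu) (Qy Q gamma (var k) (rk nu (lo m)) (rk nu (hi m)) * s).
  have [u [t [e e']]] := word_of_split nu m.
  rewrite !psiE mulrC -!scalerA e e'; apply: (congr1 (fun h : arr n k^o => (s *: h) (fun=> 0%N))).
  by apply: phi1; rewrite -e perm_word_of.
have Qsym a b : Qy Q gamma (var k) a b = Qy Q gamma (var k) b a by apply: qS_sym.
pose tr : {linear K -> k^o} := HB.pack (klr_trace gamma (var k) psi)
  (GRing.isLinear.Build k K k^o *:%R _ (klr_trace_is_linear gamma_inj Qsym psi)).
have tr_comm u v : tr (u * v) = tr (v * u) by apply: (klr_trace_comm gamma_inj Qsym psi_swap).
exists tr; split=> [z|nu a bnd].
  apply: tracial_cocenter => // u _ ->.
  have -> : u * cyc_gen Q beta hn L = \sum_(nu : Iseq n beta)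
      u * (klr_x Q beta o ^+ `|coroot D (nu o) L|%N * klr_e Q nu) by apply: mulr_sumr.
  rewrite linear_sum big1 // => nu _; apply: (klr_trace_xe gamma_inj Qsym) => s.
  rewrite psiE mulrC -scalerA; have [t e] := word_of_cons nu.
  have : var k (rk nu o) ^+ p (rk nu o) *: phi (word_of nu) = 0.
    by rewrite e; apply: phi0; rewrite -e perm_word_of.
  by rewrite /cyc_exp rkE => ->; rewrite scaler0.
apply: etrans (klr_trace_monomial gamma_inj Qsym _ _ _) _.
rewrite psiE monomial_act phi_c ?perm_word_of //; last first.
  exact/(exp_bound_below gamma_inj L_dom).
rewrite /c; congr (if _ then _ else _); apply: asbool_equiv_eq.
split=> [[/word_of_inj -> e]|[-> ->] //]; split=> //.
apply: funext => t; have := congr1 (fun h => h (rk nu0 t)) e.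
by rewrite /= !rkK.
Qed.

End MainParts.

Theorem theorem4p8 (I : finType) (D : cartan_datum I) (k : fieldType)
  (Q : klr_poly D k) (L : wlat D) (hL : dominant L)
  (n : nat) (hn : (0 < n)%N)
  (i : 'I_n -> I) (i_inj : injective i)
  (beta : wlat D) (hbeta : beta = \sum_j sroot D (i j))
  (gamma : Iseq n beta) :
  image_is_basis
    (fun z : klr Q n beta =>
       to_cocenter (cyc_pi hn L z) : cocenter (cyclotomic Q beta hn L))
    (Tset L gamma).
Proof.
have gamma_inj : injective gamma.
  exact: inj_same_weight (etrans (eqP (valP gamma)) hbeta) i_inj.
split=> [s c us sT c0 v vs|w]; last first.
  have [z ->] := cocenter_proj_surj w; apply: span_image_sum.
  exact: klr_span.
have [nu0 [a0 [bnd0 ev]]] := sT v vs.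
have [f [f_cls f_mono]] := dual_trace Q hn gamma_inj hL nu0 a0.
have fE u : u \in s -> f u = if u == v then 1 else 0.
  move=> us'; have [nu [a [bnd eu]]] := sT u us'.
  case: eqP => [->|ne]; first by rewrite ev f_mono // asboolT.
  have ne' : ~ (nu = nu0 /\ a = a0).
    by case=> enu ea; apply: ne; subst nu a; apply: etrans eu (esym ev).
  by rewrite eu (f_mono _ _ bnd) (asboolF ne').
have c0' : to_cocenter (cyc_pi hn L (\sum_(u <- s) c u *: u)) = 0.
  pose g : {linear klr Q n beta -> cocenter (cyclotomic Q beta hn L)} :=
    to_cocenter (B := cyclotomic Q beta hn L) \o
    @aproj k (klr Q n beta) (fun z => z = cyc_gen Q beta hn L).
  exact: etrans (linear_comb g s c) c0.
have := f_cls _ c0'; rewrite linear_comb (bigD1_seq v) //= big_seq_cond big1.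
  by rewrite addr0 fE // eqxx [_ *: _]mulr1.
by move=> u /andP[us' /negbTE ne]; rewrite fE // ne scaler0.
Qed.
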